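(* Let $m\in\{1,\dots,n\}$, let $M=(M_1,\dots,M_n)$ be a multi-index of non-negative integers, and let $\alpha\in\mathbb R$ be such that $\beta(\alpha)\le 1$. Let $f\in J_{\alpha,M,m}$, and suppose that the corresponding one-variable function $\tilde f\in d_{\beta(\alpha)}$ has no zeros inside its domain $\mathbb D(\mu(m)^{-1/4})$, has at least one zero on the boundary, and admits an analytic continuation to a strictly bigger domain. Then $f$ is cyclic in $D_\alpha(\mathbb B_n)$ whenever $\alpha\le\frac{2n-m+1}{2}$, and $$\mathrm{dist}^2_{D_\alpha(\mathbb B_n)}(1,f\cdot P_N^n)\asymp \phi_{\beta(\alpha)}(N+1)^{-1},$$ i.e. there are constants $0<c\le C<\infty$ independent of $N$ such that for all integers $N\ge 1$, $c\,\phi_{\beta(\alpha)}(N+1)^{-1}\le \mathrm{dist}^2_{D_\alpha(\mathbb B_n)}(1,f\cdot P_N^n)\le C\,\phi_{\beta(\alpha)}(N+1)^{-1}$.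
   Context: $\mathbb B_n$ is the Euclidean unit ball of $\mathbb C^n$. For $\alpha\in\mathbb R$, $D_\alpha(\mathbb B_n)$ is the Hilbert space of all holomorphic $f(z)=\sum_k a_kz^k$ on $\mathbb B_n$ (sum over multi-indices $k$ of non-negative integers, $|k|=k_1+\dots+k_n$, $k!=k_1!\cdots k_n!$) with $$\|f\|_\alpha^2:=\sum_{k}(n+|k|)^\alpha\frac{(n-1)!\,k!}{(n-1+|k|)!}|a_k|^2<\infty .$$ A function $f\in D_\alpha(\mathbb B_n)$ is cyclic if the closed linear span in $D_\alpha(\mathbb B_n)$ of $\{z_1^{k_1}\cdots z_n^{k_n}f: k_1,\dots,k_n=0,1,\dots\}$ equals $D_\alpha(\mathbb B_n)$. For $N\in\mathbb N$, $P_N^n$ is the space of polynomials of the form $\sum_{k_1=0}^N\cdots\sum_{k_n=0}^N a_{k_1,\dots,k_n}z_1^{k_1}\cdots z_n^{k_n}$, and $\mathrm{dist}_{D_\alpha(\mathbb B_n)}(1,f\cdot P_N^n)=\inf\{\|1-pf\|_\alpha: p\in P_N^n\}$. Put $\mu(m):=\dfrac{(M_1+\dots+M_m)^{M_1+\dots+M_m}}{M_1^{M_1}\cdots M_m^{M_m}}$ (with $0^0=1$) and $\mathbb D(\rho)=\{z\in\mathbb C:|z|<\rho\}$; one has $\mu(m)^{1/2}|z_1|^{M_1}\cdots|z_m|^{M_m}\le 1$ on $\mathbb B_n$. For $\beta\in\mathbb R$, $d_\beta$ is the space of holomorphic functions $\tilde f(z)=\sum_{l\ge0}a_lz^l$ on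 $\mathbb D(\mu(m)^{-1/4})$ with $\|\tilde f\|_{d_\beta}^2:=\sum_{l=0}^\infty \mu(m)^{-l/2}(l+1)^\beta|a_l|^2<\infty$. Set $\beta(\alpha):=\alpha-n+\frac{m+1}{2}$. The diagonal subspace is $$J_{\alpha,M,m}:=\{f\in D_\alpha(\mathbb B_n):\exists\,\tilde f\in d_{\beta(\alpha)},\ f(z)=\tilde f(\mu(m)^{1/4}z_1^{M_1}\cdots z_m^{M_m})\};$$ the function $\tilde f$ (unique by the identity principle) is called the corresponding one-variable function. The function $\phi_\beta:[0,\infty)\to[0,\infty)$ is $\phi_\beta(t)=t^{1-\beta}$ if $\beta<1$ and $\phi_1(t)=\log^+(t):=\max\{\log t,0\}$ if $\beta=1$.
   Formalization: The lower bound for the distance is claimed only when M_1,…,M_m are all positive (it fails otherwise, e.g. n=m=2, M=(1,0), α=3/2, f=1-z_1); the analytic continuation is taken to a larger concentric disc, and M_1=…=M_m=0 is excluded as f̃ is undefined at 1. *)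

(* Defs.v *)
From HB Require Import structures.
From mathcomp Require Import all_boot all_order all_algebra.
From mathcomp Require Import finmap complex.
From mathcomp Require Import all_classical all_reals all_analysis.
From mathcomp Require Import showcase.summability.

Set Implicit Arguments.
Unset Strict Implicit.
Unset Printing Implicit Defensive.

Import Order.TTheory GRing.Theory Num.Theory.
Import numFieldNormedType.Exports.

Local Open Scope classical_set_scope.
Local Open Scope ring_scope.
Local Open Scope complex_scope.

(** [R] is the field of real numbers.  Functions on the
    ball of C^n (or on a disc) are total functions of which only the values on
    the ball (disc) matter: every notion below depends on these values only. *)

(* [R[i]] packed as a [numFieldType], the key to its topology and norm. *)
Definition cfield (R : realType) : numFieldType := R[i].

(* The [R]-valued modulus; the norm [`|z|] of [R[i]] is valued in [R[i]]. *)
Definition modulus (R : realType) (z : cfield R) : R := Normc.normc z.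

Definition multi_index (n : nat) := {ffun 'I_n -> nat}.

Definition mdeg (n : nat) (k : multi_index n) : nat := (\sum_i k i)%N.

Definition mfact (n : nat) (k : multi_index n) : nat := (\prod_i (k i)`!)%N.

Definition monomial (R : realType) (n : nat) (k : multi_index n)
    (z : 'rV[cfield R]_n) : cfield R :=
  \prod_i z 0 i ^+ k i.

Definition unit_ball (R : realType) (n : nat) : set 'rV[cfield R]_n :=
  [set z | \sum_i modulus (z 0 i) ^+ 2 < 1].

Definition disc (R : realType) (rho : R) : set (cfield R) :=
  [set z | modulus z < rho].

Definition holomorphic_ball (R : realType) (n : nat)
    (f : 'rV[cfield R]_n -> cfield R) : Prop :=
  forall z, unit_ball z -> differentiable f z.

Definition holomorphic_disc (R : realType) (rho : R)
    (g : cfield R -> cfield R) : Prop :=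
  forall z, disc rho z -> derivable g z 1.

(* [f z = \sum_k a_k z^k] on the ball, the sum being unconditional, that is,
   along the finite sets of multi-indices ordered by inclusion.  Every
   holomorphic [f] has exactly one such [a]. *)
Definition expansion_ball (R : realType) (n : nat)
    (f : 'rV[cfield R]_n -> cfield R) (a : multi_index n -> cfield R) : Prop :=
  forall z, unit_ball z ->
    partial_sum (fun k : {ffun 'I_n -> nat} => a k * monomial k z) @ totally
      --> f z.

Definition expansion_disc (R : realType) (rho : R)
    (g : cfield R -> cfield R) (a : nat -> cfield R) : Prop :=
  forall z, disc rho z ->
    series (fun l : nat => a l * z ^+ l) @ \oo --> g z.

Definition taylor (R : realType) (n : nat)
    (f : 'rV[cfield R]_n -> cfield R) : multi_index n -> cfield R :=
  get [set a : multi_index n -> cfield R | expansion_ball f a].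

Definition D_weight (R : realType) (n : nat) (alpha : R)
    (k : multi_index n) : R :=
  ((n + mdeg k)%N%:R `^ alpha) *
  ((n.-1)`! * mfact k)%N%:R / ((n.-1 + mdeg k)`!)%N%:R.

(* The norm is extended-real valued; it is meant for functions having an
   expansion on the ball. *)
Definition D_norm (R : realType) (n : nat) (alpha : R)
    (f : 'rV[cfield R]_n -> cfield R) : \bar R :=
  sqrte (\esum_(k in [set: {ffun 'I_n -> nat}])
           (D_weight alpha k * modulus (taylor f k) ^+ 2)%:E).

Definition D_space (R : realType) (n : nat) (alpha : R) :
    set ('rV[cfield R]_n -> cfield R) :=
  [set f | [/\ holomorphic_ball f, exists a, expansion_ball f a
             & (D_norm alpha f < +oo)%E]].

Definition shift_span (R : realType) (n : nat)
    (f : 'rV[cfield R]_n -> cfield R) : set ('rV[cfield R]_n -> cfield R) :=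
  [set h | exists (A : {fset {ffun 'I_n -> nat}})
                  (c : multi_index n -> cfield R),
     h = fun z : 'rV[cfield R]_n => \sum_(k <- A) c k * (monomial k z * f z)].

Definition closed_shift_span (R : realType) (n : nat) (alpha : R)
    (f : 'rV[cfield R]_n -> cfield R) : set ('rV[cfield R]_n -> cfield R) :=
  [set g | D_space alpha g /\
     forall eps : R, 0 < eps -> exists2 h, shift_span f h &
       (D_norm alpha (fun z => (g z - h z)%R) < eps%:E)%E].

Definition cyclic_fun (R : realType) (n : nat) (alpha : R)
    (f : 'rV[cfield R]_n -> cfield R) : Prop :=
  closed_shift_span alpha f = D_space alpha.

(* [P_N^n]: degree at most [N] in each variable separately. *)
Definition box_poly (R : realType) (n N : nat) :
    set ('rV[cfield R]_n -> cfield R) :=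
  [set p | exists c : {ffun 'I_n -> 'I_N.+1} -> cfield R,
     p = fun z : 'rV[cfield R]_n => \sum_(k : {ffun 'I_n -> 'I_N.+1})
                    c k * \prod_i z 0 i ^+ k i].

Definition dist_one (R : realType) (n : nat) (alpha : R)
    (f : 'rV[cfield R]_n -> cfield R) (N : nat) : \bar R :=
  ereal_inf [set D_norm alpha (fun z => 1 - p z * f z)
            | p in @box_poly R n N].

(* The [m] distinguished indices 1..m are the [i : 'I_n] with [i < m]. *)
Definition mu (R : realType) (n m : nat) (M : multi_index n) : R :=
  let s := (\sum_(i < n | (i < m)%N) M i)%N in
  (s ^ s)%N%:R / (\prod_(i < n | (i < m)%N) M i ^ M i)%N%:R.

Definition diag_radius (R : realType) (n m : nat) (M : multi_index n) : R :=
  mu R m M `^ (- 4^-1).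

Definition diag_map (R : realType) (n m : nat) (M : multi_index n)
    (z : 'rV[cfield R]_n) : cfield R :=
  (mu R m M `^ 4^-1)%:C * \prod_(i < n | (i < m)%N) z 0 i ^+ M i.

Definition beta (R : realType) (n m : nat) (alpha : R) : R :=
  alpha - n%:R + (m%:R + 1) / 2.

Definition d_space (R : realType) (n m : nat) (M : multi_index n) (b : R) :
    set (cfield R -> cfield R) :=
  [set g | holomorphic_disc (diag_radius R m M) g /\
     exists2 a : nat -> cfield R, expansion_disc (diag_radius R m M) g a &
       (\esum_(l in [set: nat])
          (mu R m M `^ (- (l%:R / 2)) * (l%:R + 1) `^ b *
           modulus (a l) ^+ 2)%:E < +oo)%E].

(* [g] is a one-variable function of [f].  The argument of [g] has to lie in
   the domain of [g]; this is automatic unless [M_1 = ... = M_m = 0]. *)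
Definition one_variable_fun (R : realType) (n m : nat) (M : multi_index n)
    (alpha : R) (f : 'rV[cfield R]_n -> cfield R)
    (g : cfield R -> cfield R) : Prop :=
  d_space m M (beta n m alpha) g /\
  forall z, unit_ball z ->
    disc (diag_radius R m M) (diag_map m M z) /\ f z = g (diag_map m M z).

Definition J_space (R : realType) (n m : nat) (M : multi_index n) (alpha : R) :
    set ('rV[cfield R]_n -> cfield R) :=
  [set f | D_space alpha f /\ exists g, one_variable_fun m M alpha f g].

(* [h] is an analytic continuation of [g] from the disc of radius [r] to a
   strictly larger disc; in particular [h] lives on the closed disc, which is
   where boundary zeros of [g] are read. *)
Definition continuation (R : realType) (r : R)
    (g h : cfield R -> cfield R) : Prop :=
  exists2 rho : R, r < rho &
    [/\ holomorphic_disc rho h, exists a, expansion_disc rho h a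
      & forall z, disc r z -> h z = g z].

(* Only used for [b <= 1] and [0 <= t]; [ln 0 = 0] in the library. *)
Definition phi (R : realType) (b t : R) : R :=
  if b < 1 then t `^ (1 - b) else Num.max (ln t) 0.

(* Main.v *)
Require Import Defs.
From HB Require Import structures.
From mathcomp Require Import all_boot all_order all_algebra.
From mathcomp Require Import finmap complex.
From mathcomp Require Import all_classical all_reals all_analysis.
From mathcomp Require Import showcase.summability.
From mathcomp Require Import cyclic separable cyclotomic.
From mathcomp Require Import ring lra zify.
Import Order.TTheory GRing.Theory Num.Theory.
Import numFieldNormedType.Exports.
Set Implicit Arguments.
Unset Strict Implicit.
Unset Printing Implicit Defensive.
Local Open Scope classical_set_scope.
Local Open Scope ring_scope.

(** Put [tau = mu^(1/2)], so that [z |-> tau z^M] maps the ball into the unit disc.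
    After dilation of the one-variable function, [f] is the diagonal function
    [sum_l x_l (tau z^M)^l], where the power series [x] converges beyond the closed
    unit disc ([rescale_conv_beyond]), has no zeros in the open disc and has a zero
    on the circle.

    The monomials are orthogonal in the space, so the squared norm of a diagonal
    function is a weighted [l^2] norm of its one-variable coefficients.  Stirling's
    formula shows that the weight of degree [l] is comparable with [(l + 1)^beta]
    ([diag_weight_le], [diag_weight_ge]; the lower bound needs the exponents
    [M_1, ..., M_m] to be positive).  Moreover the diagonal part of [p f] is the
    product of the diagonal part of [p] with [x] ([box_conv_idx]), and diagonal
    polynomials do occur among the [p] ([box_conv_diag]).  So the distance from [1]
    to [f P_N] is, up to constants, the distance from [1] to the [q x] with [q] a
    one-variable polynomial of degree at most a multiple of [N], in the norm with
    weights [(l + 1)^beta].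

    In this norm the squared distance is comparable with [1 / L_N], where [L_N] is
    the sum of the [(l + 1)^(- beta)] for [l <= N].
    - Upper bound ([one_variable_upper]).  Write [x = prod_i (1 - c_i X) u] where
      [modulus c_i <= 1] and [u] has no zeros on a larger disc: the zeros are
      finitely many by Jensen's inequality ([factor_zeros]), and [1 / u] converges
      beyond the closed disc ([zero_free_inverse]).  The kernel
      [k = L_N^-1 sum_(l <= N) (l + 1)^(- beta) c^l X^l] has squared norm at most
      [1 / L_N], and [1 - k] is divisible by [1 - c X].  Multiplying the quotients
      for the various [c_i] with a truncation of [1 / u] gives [q]; the error
      [1 - q x] is a combination of products of kernels, which is as small as a
      single kernel because convolution preserves domination by the weights
      ([tameM]).
    - Lower bound ([one_variable_lower]).  At the zero on the circle, [1 - q x]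
      takes the value [1].  By the Cauchy-Schwarz inequality, a power series of
      degree at most a multiple of [N] taking a value bounded below there has
      squared norm at least a constant times [1 / L_N].  The part of [1 - q x] of
      higher degree is negligible, as the coefficients of [q] grow at most
      exponentially ([quotient_coef_le]).

    Comparing [L_N] with [phi_beta] ([wt_sum_phi]) gives the two-sided estimate.
    As [beta <= 1] the function [phi_beta] is unbounded, so [1] belongs to the
    closed span of the multiples of [f], hence so do all polynomials, and [f] is
    cyclic ([cyclic_of_approx]). *)

(** * The modulus of a complex number *)

Section Modulus.
Context {R : realType}.
Local Notation C := (cfield R).
Implicit Types z w : C.

Lemma normE z : `|z| = (modulus z)%:C%C.
Proof. by []. Qed.

Lemma modulus_ge0 z : 0 <= modulus z.
Proof. by case: z => a b; exact: sqrtr_ge0. Qed.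

Lemma modulus0 : modulus (0 : C) = 0.
Proof. exact: Normc.normc0. Qed.

Lemma modulus1 : modulus (1 : C) = 1.
Proof. exact: Normc.normc1. Qed.

Lemma modulusM z w : modulus (z * w) = modulus z * modulus w.
Proof. exact: Normc.normcM. Qed.

Lemma modulusN z : modulus (- z) = modulus z.
Proof. exact: normcN. Qed.

Lemma modulusV z : modulus z^-1 = (modulus z)^-1.
Proof. exact: Normc.normcV. Qed.

Lemma modulusX z n : modulus (z ^+ n) = modulus z ^+ n.
Proof. by elim: n => [|n IH]; rewrite ?modulus1 // !exprS modulusM IH. Qed.

Lemma modulus_eq0 z : (modulus z == 0) = (z == 0).
Proof.
apply/eqP/eqP => [|->]; last exact: modulus0.
exact: Normc.eq0_normc.
Qed.

Lemma modulus_gt0 z : (0 < modulus z) = (z != 0).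
Proof. by rewrite lt_def modulus_eq0 modulus_ge0 andbT. Qed.

Lemma ler_modulusD z w : modulus (z + w) <= modulus z + modulus w.
Proof. exact: le_normcD. Qed.

Lemma ler_modulusB z w : modulus (z - w) <= modulus z + modulus w.
Proof. by rewrite -(modulusN w) ler_modulusD. Qed.

Lemma modulus_distC z w : modulus (z - w) = modulus (w - z).
Proof. by rewrite -modulusN opprB. Qed.

Lemma modulus_real (x : R) : modulus (x%:C)%C = `|x|.
Proof. by rewrite /modulus /= expr0n /= addr0 sqrtr_sqr. Qed.

Lemma ler_modulus_sum I (r : seq I) (P : pred I) (F : I -> C) :
  modulus (\sum_(i <- r | P i) F i) <= \sum_(i <- r | P i) modulus (F i).
Proof.
elim/big_ind2: _ => [|x a y b xa yb|//]; first by rewrite modulus0.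
exact: le_trans (ler_modulusD _ _) (lerD xa yb).
Qed.

Lemma Re_le_modulus z : `|complex.Re z| <= modulus z.
Proof.
case: z => a b; rewrite /modulus /= -sqrtr_sqr ler_wsqrtr // lerDl; exact: sqr_ge0.
Qed.

Lemma Im_le_modulus z : `|complex.Im z| <= modulus z.
Proof.
case: z => a b; rewrite /modulus /= -sqrtr_sqr ler_wsqrtr // lerDr; exact: sqr_ge0.
Qed.

Lemma modulus_le_ReIm z : modulus z <= `|complex.Re z| + `|complex.Im z|.
Proof.
case: z => a b; rewrite /modulus /= -[leRHS]ger0_norm ?addr_ge0 //.
rewrite -sqrtr_sqr ler_wsqrtr // sqrrD !real_normK ?num_real //.
by rewrite lerD2r lerDl mulrn_wge0 // mulr_ge0.
Qed.

(** For [z] and [w] consecutive coefficients this compares multiplication by a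
    linear factor with multiplication by the reflected factor; the right-hand
    side telescopes along the coefficients, see [jensen]. *)
Lemma modulus_sqr_swap z w d :
  modulus (z - d * w) ^+ 2 - modulus ((d^*)%C * z - w) ^+ 2 =
  (1 - modulus d ^+ 2) * (modulus z ^+ 2 - modulus w ^+ 2).
Proof.
case: z w d => [a b] [c e] [p q]; rewrite /modulus /=.
rewrite !sqr_sqrtr ?addr_ge0 ?sqr_ge0 //=; ring.
Qed.

Lemma modulus_conj z : modulus (z^*)%C = modulus z.
Proof. by case: z => a b; rewrite /modulus /= sqrrN. Qed.

End Modulus.
#[global] Arguments modulus : simpl never.

(** * Geometric series *)

Section RealBounds.
Context {R : realType}.
Implicit Types x y : R.

Lemma geo_sum_le x n : 0 <= x -> x < 1 -> \sum_(l < n) x ^+ l <= (1 - x)^-1.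
Proof.
move=> x0 x1; have y0 : 0 < 1 - x by rewrite subr_gt0.
rewrite -[leRHS]mul1r ler_pdivlMr // mulrC.
suff -> : (1 - x) * \sum_(l < n) x ^+ l = 1 - x ^+ n by rewrite gerBl exprn_ge0.
have := subrX1 x n; rewrite -opprB => /(congr1 -%R); rewrite opprK => ->.
by rewrite -mulNr opprB.
Qed.

Lemma geo_tail_le x n m : 0 <= x -> x < 1 ->
  \sum_(n <= l < m) x ^+ l <= x ^+ n / (1 - x).
Proof.
move=> x0 x1; have [mn|nm] := leqP m n.
  by rewrite big_geq // divr_ge0 ?exprn_ge0 // subr_ge0 ltW.
rewrite -{1}[n]add0n big_addn big_mkord.
under eq_bigr do rewrite exprD.
by rewrite -mulr_suml mulrC ler_wpM2l ?exprn_ge0 // geo_sum_le.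
Qed.

Lemma mul_geo_le x n : 0 <= x -> x < 1 -> n.+1%:R * x ^+ n <= (1 - x)^-1.
Proof.
move=> x0 x1; apply: le_trans (geo_sum_le n.+1 x0 x1).
rewrite -[n.+1 in leLHS]card_ord -sumr_const mulr_suml.
apply: ler_sum => i _; rewrite mul1r ler_wiXn2l ?(ltW x1) //.
by rewrite -ltnS ltn_ord.
Qed.

(** Split [x] into [a + 1] equal factors [y]: each of the [a] factors [n + 1]
    is absorbed by a power of [y], and one power of [y] is left. *)
Lemma poly_geo_le x a : 0 <= x -> x < 1 -> exists K y,
  [/\ 0 <= K, 0 <= y, y < 1 & forall n, n.+1%:R ^+ a * x ^+ n <= K * y ^+ n].
Proof.
move=> x0 x1; pose y := x `^ (a.+1%:R)^-1.
have y0 : 0 <= y by exact: powR_ge0.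
have yX : y ^+ a.+1 = x.
  by rewrite -powR_mulrn // -powRrM mulVf ?powRr1 // pnatr_eq0.
have y1 : y < 1 by rewrite -(expr_lt1 (n := a.+1)) // yX.
exists ((1 - y)^-1 ^+ a), y; split=> //.
  by rewrite exprn_ge0 // invr_ge0 subr_ge0 ltW.
move=> n; rewrite -yX exprAC exprSr mulrA -exprMn.
rewrite ler_wpM2r ?exprn_ge0 // lerXn2r ?nnegrE ?mulr_ge0 ?exprn_ge0 //.
  by rewrite invr_ge0 subr_ge0 ltW.
exact: mul_geo_le.
Qed.

Lemma geo_lt_eps x K eps : 0 <= x -> x < 1 -> 0 < eps ->
  exists n0, forall n, (n0 <= n)%N -> K * x ^+ n < eps.
Proof.
move=> x0 x1 eps0.
have K1 : 0 < `|K| + 1 by rewrite ltr_wpDl.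
have /cvgrPdist_lt /(_ _ (divr_gt0 eps0 K1)) [n0 _ Hn0] :
    x ^+ n @[n --> \oo] --> (0 : R) by apply: cvg_expr; rewrite ger0_norm.
exists n0 => n /Hn0 /=; rewrite sub0r normrN ger0_norm ?exprn_ge0 //.
rewrite ltr_pdivlMr // mulrC => /(le_lt_trans _); apply.
by rewrite ler_wpM2r ?exprn_ge0 // (le_trans (ler_norm K)) // lerDl.
Qed.

End RealBounds.

(** * Formal power series *)

(** A separate name, so that the convolution product can be declared without
    clashing with the pointwise operations on functions. *)
Definition fps (R : realType) := nat -> cfield R.
HB.instance Definition _ (R : realType) :=
  GRing.Zmodule.copy (fps R) (nat -> cfield R).

Section FpsRing.
Context {R : realType}.
Local Notation C := (cfield R).
Implicit Types a b c : fps R.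

Definition fps_mul a b : fps R := fun l => \sum_(i < l.+1) a i * b (l - i)%N.
Definition fps_one : fps R := fun l => (l == 0)%:R.

(** A coefficient of a product depends only on truncations of the factors, so
    that the ring laws are inherited from polynomials. *)
Lemma fps_mul_poly a b n l : (l < n)%N ->
  fps_mul a b l = ((\poly_(i < n) a i) * (\poly_(i < n) b i))`_l.
Proof.
move=> ln; rewrite coefM; apply: eq_bigr => i _.
rewrite !coef_poly (leq_ltn_trans _ ln) ?(leq_ltn_trans (leq_subr i l) ln) //.
by rewrite -ltnS.
Qed.

Lemma fps_mulC : commutative fps_mul.
Proof.
by move=> a b; apply: funext => l; rewrite !(@fps_mul_poly _ _ l.+1) // mulrC.
Qed.

Lemma coef_trunc_fps_mul a b n i : (i < n)%N ->
  (\poly_(j < n) fps_mul a b j)`_i =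
  ((\poly_(j < n) a j) * (\poly_(j < n) b j))`_i.
Proof. by move=> i_n; rewrite coef_poly i_n (@fps_mul_poly _ _ n). Qed.

Lemma fps_mulA : associative fps_mul.
Proof.
move=> a b c; apply: funext => l; rewrite !(@fps_mul_poly _ _ l.+1) //.
transitivity ((\poly_(i < l.+1) a i * (\poly_(i < l.+1) b i *
   \poly_(i < l.+1) c i)))`_l.
  rewrite !coefM; apply: eq_bigr => i _.
  by rewrite coef_trunc_fps_mul // ltnS leq_subr.
rewrite mulrA !coefM; apply: eq_bigr => i _.
by rewrite coef_trunc_fps_mul.
Qed.

Lemma fps_mul1 : left_id fps_one fps_mul.
Proof.
move=> a; apply: funext => l.
rewrite /fps_mul big_ord_recl subn0 mul1r big1 ?addr0 // => i _.
by rewrite mul0r.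
Qed.

Lemma fps_mulDl : left_distributive fps_mul +%R.
Proof.
move=> a b c; apply: funext => l.
transitivity (fps_mul a c l + fps_mul b c l) => //.
rewrite /fps_mul -big_split /=; apply: eq_bigr => i _; exact: mulrDl.
Qed.

Lemma fps_one_neq0 : fps_one != 0.
Proof.
apply/eqP => /(congr1 (fun a : fps R => a 0)) /= /eqP.
by rewrite (_ : fps_one 0 = 1) // oner_eq0.
Qed.

HB.instance Definition _ := GRing.Zmodule_isComNzRing.Build (fps R)
  fps_mulA fps_mulC fps_mul1 fps_mulDl fps_one_neq0.

Lemma fpsD a b l : (a + b) l = a l + b l. Proof. by []. Qed.
Lemma fpsN a l : (- a) l = - a l. Proof. by []. Qed.
Lemma fpsB a b l : (a - b) l = a l - b l. Proof. by []. Qed.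
Lemma fps0 l : (0 : fps R) l = 0. Proof. by []. Qed.
Lemma fps1 l : (1 : fps R) l = (l == 0)%:R. Proof. by []. Qed.
Lemma fpsM a b l : (a * b) l = \sum_(i < l.+1) a i * b (l - i)%N.
Proof. by []. Qed.

Lemma fps_sum I (r : seq I) (P : pred I) (F : I -> fps R) l :
  (\sum_(i <- r | P i) F i) l = \sum_(i <- r | P i) F i l.
Proof. by elim/big_rec2: _ => // i x y _ <-. Qed.

Lemma fps_coef0M a b : (a * b) 0 = a 0 * b 0.
Proof. by rewrite fpsM big_ord_recl big_ord0 addr0. Qed.

Lemma fps_expr_coef_eq0 a k l : a 0 = 0 -> (l < k)%N -> (a ^+ k) l = 0.
Proof.
move=> a0; elim: k l => // k IH l lk.
rewrite exprS fpsM big_ord_recl a0 mul0r add0r big1 // => i _.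
rewrite IH ?mulr0 //= /bump /= add1n.
by have := ltn_ord i; lia.
Qed.

Definition fps_of_poly (p : {poly C}) : fps R := fun l => p`_l.

Lemma fps_of_polyM p q : fps_of_poly (p * q) = fps_of_poly p * fps_of_poly q.
Proof. by apply: funext => l; rewrite /fps_of_poly coefM. Qed.

(** [fps_lin c] is [1 - c z] and [fps_geo c] its inverse. *)
Definition fps_lin (c : C) : fps R :=
  fun l => if l is l'.+1 then (if l' is _.+1 then 0 else - c) else 1.
Definition fps_geo (c : C) : fps R := fun l => c ^+ l.

Lemma fps_linM (c : C) a l :
  (fps_lin c * a) l = a l - (if l is l'.+1 then c * a l' else 0).
Proof.
case: l => [|l]; first by rewrite fps_coef0M mul1r subr0.
rewrite fpsM !big_ord_recl /= mul1r /bump /= subn0 subn1 /= big1 ?addr0 ?mulNr //.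
by move=> i _; rewrite mul0r.
Qed.

Lemma fps_linK (c : C) : fps_lin c * fps_geo c = 1.
Proof.
apply: funext => -[|l]; rewrite fps_linM /fps_geo; first by rewrite subr0.
by rewrite exprS subrr.
Qed.

Definition deg_le N a := forall l, (N < l)%N -> a l = 0.

Lemma deg_leM N M a b : deg_le N a -> deg_le M b -> deg_le (N + M) (a * b).
Proof.
move=> aN bM l lNM; rewrite fpsM big1 // => i _.
have [iN|Ni] := leqP i N; last by rewrite aN ?mul0r.
rewrite bM ?mulr0 //; lia.
Qed.

Lemma deg_le1 : deg_le 0 1.
Proof. by case. Qed.

End FpsRing.

(** * Convergent power series *)

Section Sums.
Context {R : realType}.
Local Notation C := (cfield R).
Implicit Types (a b u : fps R) (s t z : C).

(** The limit of the partial sums, with real tolerances; [cvg_sums_to] relates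
    it to the topology of the complex numbers, whose norm is complex-valued. *)
Definition sums_to (v : nat -> C) s := forall eps : R, 0 < eps ->
  exists n0, forall n, (n0 <= n)%N -> modulus (\sum_(l < n) v l - s) < eps.

Lemma sums_to_unique v s t : sums_to v s -> sums_to v t -> s = t.
Proof.
move=> vs vt; apply/eqP; rewrite -subr_eq0 -modulus_eq0.
rewrite eq_le modulus_ge0 andbT leNgt; apply/negP => d0.
have d20 : 0 < modulus (s - t) / 2 by rewrite divr_gt0.
have [n Hn] := vs _ d20; have [m Hm] := vt _ d20.
have := Hn (maxn n m) (leq_maxl _ _); have := Hm (maxn n m) (leq_maxr _ _).
set S := \sum_(_ < _) _ => h1 h2.
suff : modulus (s - t) < modulus (s - t) by rewrite ltxx.
rewrite [ltRHS]splitr; apply: le_lt_trans (ltrD h2 h1).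
rewrite (modulus_distC S) (_ : s - t = (s - S) + (S - t)) ?ler_modulusD //.
by rewrite addrA subrK.
Qed.

Lemma eq_sums_to v w s : v =1 w -> sums_to v s -> sums_to w s.
Proof. by move=> /funext ->. Qed.

Lemma sums_to_le v s B : sums_to v s ->
  (forall n, modulus (\sum_(l < n) v l) <= B) -> modulus s <= B.
Proof.
move=> vs vB; apply/ler_addgt0Pr => e e0.
have [n Hn] := vs _ e0; have := Hn n (leqnn n) => /ltW.
have := vB n; set S := \sum_(_ < _) _ => h1 h2.
rewrite (_ : s = S - (S - s)); last by rewrite opprB addrC subrK.
exact: le_trans (ler_modulusB _ _) (lerD h1 h2).
Qed.

Lemma sums_toD v w s t : sums_to v s -> sums_to w t ->
  sums_to (fun l => v l + w l) (s + t).
Proof.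
move=> vs wt e e0; have e20 : 0 < e / 2 by rewrite divr_gt0.
have [n Hn] := vs _ e20; have [m Hm] := wt _ e20.
exists (maxn n m) => k; rewrite geq_max => /andP[nk mk].
rewrite big_split /= opprD addrACA [ltRHS]splitr.
exact: le_lt_trans (ler_modulusD _ _) (ltrD (Hn _ nk) (Hm _ mk)).
Qed.

Lemma sums_toN v s : sums_to v s -> sums_to (fun l => - v l) (- s).
Proof.
move=> vs e e0; have [n Hn] := vs _ e0; exists n => k /Hn.
by rewrite sumrN -opprD modulusN.
Qed.

Lemma sums_toB v w s t : sums_to v s -> sums_to w t ->
  sums_to (fun l => v l - w l) (s - t).
Proof. by move=> vs /sums_toN; apply: sums_toD. Qed.

(** For [0 <= x] this says that the radius of convergence is at least [1/x],
    with a bound on the circle. *)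
Definition decay (x : R) a :=
  exists2 K, 0 <= K & forall l, modulus (a l) <= K * x ^+ l.

Definition at_pt a z : nat -> C := fun l => a l * z ^+ l.

Lemma at_ptD a b z : at_pt (a + b) z = fun l => at_pt a z l + at_pt b z l.
Proof. by apply: funext => l; rewrite /at_pt fpsD mulrDl. Qed.

Lemma at_ptN a z : at_pt (- a) z = fun l => - at_pt a z l.
Proof. by apply: funext => l; rewrite /at_pt fpsN mulNr. Qed.

(** The real and imaginary parts are dominated by a geometric series. *)
Lemma decay_sum_exists a x z : 0 <= x -> decay x a -> x * modulus z < 1 ->
  exists s, sums_to (at_pt a z) s.
Proof.
move=> x0 [K K0 aK] xz; set y := x * modulus z in xz.
have y0 : 0 <= y by rewrite mulr_ge0 // modulus_ge0.
have bnd l : modulus (at_pt a z l) <= K * y ^+ l.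
  rewrite /at_pt modulusM modulusX exprMn mulrA ler_wpM2r ?exprn_ge0 //.
  exact: modulus_ge0.
have cv (F : C -> R) : (forall w, `|F w| <= modulus w) ->
    cvgn (series (fun l => F (at_pt a z l))).
  move=> Fle; apply: normed_cvg; apply: (series_le_cvg (v_ := geometric K y)).
  - by move=> n; rewrite /=.
  - by move=> n; rewrite /geometric /= mulr_ge0 ?exprn_ge0.
  - by move=> n; rewrite /geometric /=; apply: le_trans (Fle _) (bnd n).
  - by apply: is_cvg_geometric_series; rewrite ger0_norm.
have cr := cv _ (@Re_le_modulus R); have ci := cv _ (@Im_le_modulus R).
exists (Complex (limn (series (fun l => complex.Re (at_pt a z l))))
                (limn (series (fun l => complex.Im (at_pt a z l))))).
move=> e e0; have e20 : 0 < e / 2 by rewrite divr_gt0.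
have /cvgrPdist_lt/(_ _ e20)[n _ Hn] := cr.
have /cvgrPdist_lt/(_ _ e20)[m _ Hm] := ci.
exists (maxn n m) => k; rewrite geq_max => /andP[nk mk].
apply: le_lt_trans (modulus_le_ReIm _) _; rewrite [ltRHS]splitr.
have ReS : complex.Re (\sum_(l < k) at_pt a z l) =
    series (fun l => complex.Re (at_pt a z l)) k.
  rewrite seriesEord /=; elim: k {nk mk} => [|k IH]; rewrite ?big_ord0 //.
  by rewrite !big_ord_recr /= -IH; case: (\sum_(_ < _) _) (at_pt a z k) => ? ? [].
have ImS : complex.Im (\sum_(l < k) at_pt a z l) =
    series (fun l => complex.Im (at_pt a z l)) k.
  rewrite seriesEord /=; elim: k {nk mk ReS} => [|k IH]; rewrite ?big_ord0 //.
  by rewrite !big_ord_recr /= -IH; case: (\sum_(_ < _) _) (at_pt a z k) => ? ? [].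
move: (Hn k nk) (Hm k mk) ReS ImS => /=.
case: (\sum_(_ < _) _) => p q /= h1 h2 -> ->.
by rewrite ltrD // distrC.
Qed.

End Sums.

Section Decay.
Context {R : realType}.
Local Notation C := (cfield R).
Implicit Types (a b u : fps R) (s t z : C) (x y r : R).

Lemma decayW x y a : 0 <= x -> x <= y -> decay x a -> decay y a.
Proof.
move=> x0 xy [K K0 aK]; exists K => // l; apply: le_trans (aK l) _.
by rewrite ler_wpM2l // lerXn2r ?nnegrE // (le_trans x0).
Qed.

Lemma decayD x a b : decay x a -> decay x b -> decay x (a + b).
Proof.
move=> [K K0 aK] [L L0 bL]; exists (K + L); first exact: addr_ge0.
by move=> l; rewrite mulrDl; apply: le_trans (ler_modulusD _ _) (lerD _ _).
Qed.

Lemma decayN x a : decay x a -> decay x (- a).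
Proof. by move=> [K K0 aK]; exists K => // l; rewrite fpsN modulusN. Qed.

Lemma decay_deg_le x N a : 0 < x -> deg_le N a -> decay x a.
Proof.
move=> x0 aN; exists (\sum_(l < N.+1) modulus (a l) / x ^+ l).
  by apply: sumr_ge0 => l _; rewrite divr_ge0 ?modulus_ge0 // exprn_ge0 // ltW.
move=> l; have [lN|Nl] := leqP l N; last first.
  rewrite aN // modulus0 mulr_ge0 //; last exact: exprn_ge0 (ltW x0).
  by apply: sumr_ge0 => i _; rewrite divr_ge0 ?modulus_ge0 // exprn_ge0 // ltW.
rewrite mulr_suml (bigD1 (Ordinal (lN : (l < N.+1)%N))) //= divfK; last first.
  by rewrite expf_neq0 // gt_eqF.
rewrite lerDl sumr_ge0 // => i _.
by rewrite mulr_ge0 ?divr_ge0 ?modulus_ge0 // exprn_ge0 // ltW.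
Qed.

(** The [l + 1] terms of the convolution are absorbed by passing from [x] to the
    larger rate [y]. *)
Lemma decayM x y a b : 0 <= x -> x < y -> decay x a -> decay x b ->
  decay y (a * b).
Proof.
move=> x0 xy [K K0 aK] [L L0 bL]; have y0 : 0 < y by apply: le_lt_trans xy.
have xy1 : x / y < 1 by rewrite ltr_pdivrMr // mul1r.
have xy0 : 0 <= x / y by rewrite divr_ge0 // ltW.
exists (K * L / (1 - x / y)).
  by rewrite !mulr_ge0 // invr_ge0 subr_ge0 ltW.
move=> l; rewrite fpsM; apply: le_trans (ler_modulus_sum _ _ _) _.
apply: (@le_trans _ _ (\sum_(i < l.+1) K * L * x ^+ l)).
  apply: ler_sum => i _; rewrite modulusM.
  rewrite -[l in x ^+ l](@subnKC i) -1?ltnS // exprD mulrACA.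
  by apply: ler_pM; rewrite ?modulus_ge0.
rewrite sumr_const card_ord -mulr_natl mulrCA -!mulrA.
rewrite !ler_wpM2l // -(@ler_pdivrMr _ (y ^+ l)) ?exprn_gt0 //.
by rewrite -mulrA -expr_div_n mul_geo_le.
Qed.

Lemma decay_scale x (c : C) a : decay x a -> decay x (fun l => c * a l).
Proof.
move=> [K K0 aK]; exists (modulus c * K); first by rewrite mulr_ge0 ?modulus_ge0.
by move=> l; rewrite modulusM -mulrA ler_wpM2l ?modulus_ge0.
Qed.

Lemma decay_geo (c : C) : decay (modulus c) (fps_geo c).
Proof. by exists 1 => // l; rewrite /fps_geo modulusX mul1r. Qed.

(** The power series converges on a neighbourhood of the closed disc of
    radius [r]. *)
Definition conv_beyond r a := exists x, [/\ 0 < x, x * r < 1 & decay x a].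

Lemma conv_beyond2 r a b : 0 <= r -> conv_beyond r a -> conv_beyond r b ->
  exists x, [/\ 0 < x, x * r < 1, decay x a & decay x b].
Proof.
move=> r0 [x [x0 xr xa]] [y [y0 yr yb]]; exists (Num.max x y); split.
- by rewrite lt_max x0.
- by rewrite maxr_pMl // gt_max xr yr.
- by apply: decayW xa; rewrite ?(ltW x0) // le_max lexx.
- by apply: decayW yb; rewrite ?(ltW y0) // le_max lexx orbT.
Qed.

Lemma conv_beyond_deg r N a : deg_le N a -> 0 <= r -> conv_beyond r a.
Proof.
move=> aN r0; have r1 : 0 < r + 1 by rewrite ltr_wpDl.
exists (r + 1)^-1; rewrite invr_gt0 r1; split => //.
  by rewrite mulrC ltr_pdivrMr // mul1r ltrDl.
by apply: decay_deg_le aN; rewrite invr_gt0.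
Qed.

Lemma conv_beyond1 r : 0 <= r -> conv_beyond r 1.
Proof. exact: conv_beyond_deg (@deg_le1 R). Qed.

Lemma conv_beyondD r a b : 0 <= r -> conv_beyond r a -> conv_beyond r b ->
  conv_beyond r (a + b).
Proof.
move=> r0 ra rb; have [x [x0 xr xa xb]] := conv_beyond2 r0 ra rb.
by exists x; split => //; apply: decayD.
Qed.

Lemma conv_beyondN r a : conv_beyond r a -> conv_beyond r (- a).
Proof. by move=> [x [x0 xr xa]]; exists x; split => //; apply: decayN. Qed.

Lemma conv_beyondM r a b : 0 < r -> conv_beyond r a -> conv_beyond r b ->
  conv_beyond r (a * b).
Proof.
move=> r0 ra rb; have [x [x0 xr xa xb]] := conv_beyond2 (ltW r0) ra rb.
have xr' : x < r^-1 by rewrite -[ltRHS]mul1r ltr_pdivlMr.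
exists ((x + r^-1) / 2); have [m1 m2] := midf_lt xr'; split.
- by rewrite divr_gt0 // addr_gt0 // invr_gt0.
- by rewrite -ltr_pdivlMr // mul1r.
- by apply: decayM m1 xa xb; exact: ltW.
Qed.

Lemma conv_beyondX r a k : 0 < r -> conv_beyond r a -> conv_beyond r (a ^+ k).
Proof.
move=> r0 ra; elim: k => [|k IH]; first exact: conv_beyond1 (ltW r0).
by rewrite exprS; apply: conv_beyondM.
Qed.

Lemma conv_beyond_sum r a z : modulus z <= r -> conv_beyond r a ->
  exists s, sums_to (at_pt a z) s.
Proof.
move=> zr [x [x0 xr xa]]; apply: decay_sum_exists (ltW x0) xa _.
by apply: le_lt_trans xr; rewrite ler_wpM2l // ltW.
Qed.

Lemma sum_triangle (V : nmodType) (F : nat -> nat -> V) n :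
  \sum_(l < n) \sum_(i < l.+1) F i (l - i)%N =
  \sum_(i < n) \sum_(j < n - i) F i j.
Proof.
elim: n => [|n IH]; first by rewrite !big_ord0.
rewrite big_ord_recr /= IH [RHS]big_ord_recr /= subSn // subnn big_ord1.
rewrite big_ord_recr /= subnn addrA; congr (_ + _).
rewrite -big_split /=; apply: eq_bigr => i _.
by rewrite subSn ?big_ord_recr // ltnW.
Qed.

(** The partial sum of the product and the product of the partial sums, both of
    length [n], differ by [O(n y ^ n)] with [y < 1]. *)
Lemma sums_toM_decay x a b z s t : 0 <= x -> x * modulus z < 1 ->
  decay x a -> decay x b ->
  sums_to (at_pt a z) s -> sums_to (at_pt b z) t ->
  sums_to (at_pt (a * b) z) (s * t).
Proof.
move=> x0; set y := x * modulus z => y1 [K K0 aK] [L L0 bL] sa tb e e0.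
have y0 : 0 <= y by rewrite mulr_ge0 // modulus_ge0.
have bnd (c : fps R) M (cM : forall l, modulus (c l) <= M * x ^+ l) l :
    modulus (at_pt c z l) <= M * y ^+ l.
  rewrite modulusM modulusX exprMn mulrA ler_wpM2r // exprn_ge0 //.
  exact: modulus_ge0.
have e30 : 0 < e / 3 by rewrite divr_gt0.
have T0 : 0 < modulus t + 1 by rewrite ltr_wpDl ?modulus_ge0.
have S0 : 0 < modulus s + 1 by rewrite ltr_wpDl ?modulus_ge0.
have [n1 H1] := sa _ (divr_gt0 e30 T0).
have [n2 H2] := tb _ (divr_gt0 e30 S0).
have [n3 H3] := tb _ ltr01.
have [M [v [M0 v0 v1 Hv]]] := poly_geo_le 1 y0 y1.
have [n4 H4] := geo_lt_eps (K * L / (1 - y) * M) v0 v1 e30.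
exists (maxn (maxn n1 n2) (maxn n3 n4)) => n.
rewrite !geq_max => /andP[/andP[/H1 h1 /H2 h2] /andP[/H3 h3 /H4 h4]].
set A := \sum_(l < n) at_pt a z l in h1.
set B := \sum_(l < n) at_pt b z l in h2 h3.
set P := \sum_(l < n) _.
have BT : modulus B <= modulus t + 1.
  rewrite (_ : B = t + (B - t)); last by rewrite addrC subrK.
  by apply: le_trans (ler_modulusD _ _) _; rewrite lerD2l ltW.
have PE : P = \sum_(i < n) \sum_(j < n - i) at_pt a z i * at_pt b z j.
  rewrite -(@sum_triangle C (fun i j => at_pt a z i * at_pt b z j)).
  apply: eq_bigr => l _; rewrite /at_pt fpsM mulr_suml; apply: eq_bigr => i _.
  by rewrite mulrACA -exprD subnKC // -ltnS.
have PAB : modulus (A * B - P) <= K * L / (1 - y) * (n%:R * y ^+ n).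
  rewrite PE /A mulr_suml -sumrB.
  apply: le_trans (ler_modulus_sum _ _ _) _.
  apply: (@le_trans _ _ (\sum_(i < n) K * L / (1 - y) * y ^+ n)); last first.
    by rewrite sumr_const card_ord -mulrnAr mulr_natl.
  apply: ler_sum => i _.
  rewrite -mulr_sumr -mulrBr modulusM.
  have -> : B - \sum_(j < n - i) at_pt b z j =
      \sum_(n - i <= j < n) at_pt b z j.
    rewrite /B -!(big_mkord xpredT (at_pt b z)).
    by rewrite (@big_cat_nat _ _ _ (n - i)) ?leq_subr //= addrC addrK.
  apply: (@le_trans _ _ (K * y ^+ i * (L * (y ^+ (n - i) / (1 - y))))).
    apply: ler_pM; rewrite ?modulus_ge0 ?bnd //.
    apply: le_trans (ler_modulus_sum _ _ _) _.
    apply: (@le_trans _ _ (\sum_(n - i <= j < n) L * y ^+ j)).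
      by apply: ler_sum => j _; exact: bnd.
    by rewrite -mulr_sumr ler_wpM2l // geo_tail_le.
  rewrite [leLHS](_ : _ = K * L / (1 - y) * (y ^+ i * y ^+ (n - i))).
    by rewrite -exprD subnKC // ltnW.
  by ring.
have -> : P - s * t = - (A * B - P) + (A - s) * B + s * (B - t) by ring.
rewrite (_ : e = e / 3 + e / 3 + e / 3); last by field.
apply: le_lt_trans (ler_modulusD _ _) _; apply: ltrD; last first.
  rewrite modulusM; apply: (@le_lt_trans _ _ ((modulus s + 1) * modulus (B - t))).
    by rewrite ler_wpM2r ?modulus_ge0 // lerDl.
  by rewrite mulrC -ltr_pdivlMr.
apply: le_lt_trans (ler_modulusD _ _) _; apply: ltrD; last first.
  rewrite modulusM; apply: (@le_lt_trans _ _ (modulus (A - s) * (modulus t + 1))).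
    by rewrite ler_wpM2l ?modulus_ge0.
  by rewrite -ltr_pdivlMr.
rewrite modulusN; apply: le_lt_trans PAB (le_lt_trans _ h4).
rewrite -[leRHS]mulrA ler_wpM2l ?mulr_ge0 // ?invr_ge0 ?subr_ge0 ?(ltW y1) //.
apply: le_trans (Hv n); rewrite expr1 ler_wpM2r ?exprn_ge0 //.
by rewrite ler_nat.
Qed.

Lemma sums_toM r a b z s t : modulus z <= r -> 0 <= r ->
  conv_beyond r a -> conv_beyond r b ->
  sums_to (at_pt a z) s -> sums_to (at_pt b z) t ->
  sums_to (at_pt (a * b) z) (s * t).
Proof.
move=> zr r0 ra rb; have [x [x0 xr xa xb]] := conv_beyond2 r0 ra rb.
apply: sums_toM_decay xa xb => //; first exact: ltW.
by apply: le_lt_trans xr; rewrite ler_wpM2l // ltW.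
Qed.

Lemma sums_to1 z : sums_to (at_pt 1 z) 1.
Proof.
move=> e e0; exists 1%N => -[//|n] _; rewrite big_ord_recl /= big1 => [|i _].
  by rewrite /at_pt mulr1 addr0 subrr modulus0.
by rewrite /at_pt fps1 mul0r.
Qed.

Lemma sums_toX r a z s k : modulus z <= r -> 0 < r -> conv_beyond r a ->
  sums_to (at_pt a z) s -> sums_to (at_pt (a ^+ k) z) (s ^+ k).
Proof.
move=> zr r0 ra sa; elim: k => [|k IH]; first exact: sums_to1.
rewrite !exprS; apply: (sums_toM zr) => //; first exact: ltW.
exact: conv_beyondX.
Qed.

Lemma sums_to_poly (p : {poly C}) z : sums_to (at_pt (fps_of_poly p) z) p.[z].
Proof.
move=> e e0; exists (size p) => n pn.
rewrite (horner_coef_wide _ pn) (_ : \sum_(l < n) _ = \sum_(i < n) p`_i * z ^+ i) //.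
by rewrite subrr modulus0.
Qed.

Lemma deg_le_poly (p : {poly C}) : deg_le (size p) (fps_of_poly p).
Proof. by move=> l pl; rewrite /fps_of_poly nth_default // ltnW. Qed.

End Decay.

(** * Cauchy's estimate and Jensen's inequality *)

Section CauchyEstimate.
Context {R : realType}.
Local Notation C := (cfield R).
Implicit Types (a b u : fps R) (s t z : C) (x y r : R).

Lemma prim_root_exists n : (0 < n)%N -> exists z : C, n.-primitive_root z.
Proof.
move=> n_gt0; pose p : {poly R[i]} := 'X^n - 1.
have [rs Dp] := closed_field_poly_normal p.
rewrite (monicP _) ?monicXnsubC // scale1r in Dp.
have rn1 : all n.-unity_root rs.
  by apply/allP => z; rewrite -root_prod_XsubC -Dp.
have sz_r : (n < (size rs).+1)%N.
  by rewrite -(size_prod_XsubC rs id) -Dp size_XnsubC.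
have [|z _ Hz] := hasP (has_prim_root n_gt0 rn1 _ sz_r); last by exists z.
by rewrite -separable_prod_XsubC -Dp separable_Xn_sub_1 // pnatr_eq0 -lt0n.
Qed.

Lemma modulus_nat n : modulus (n%:R : C) = n%:R.
Proof.
by rewrite (_ : n%:R = (n%:R%:C)%C) ?modulus_real ?normr_nat // rmorph_nat.
Qed.

Lemma modulus_unity z n : (0 < n)%N -> z ^+ n = 1 -> modulus z = 1.
Proof.
move=> n0 zn; apply/eqP; rewrite -(@pexpr_eq1 _ _ n) ?modulus_ge0 //.
by rewrite -modulusX zn modulus1.
Qed.

Lemma sums_to_tail_le v s n B : sums_to v s ->
  (forall m, modulus (\sum_(n <= l < m) v l) <= B) ->
  modulus (s - \sum_(l < n) v l) <= B.
Proof.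
move=> vs vB; apply/ler_addgt0Pr => e e0; have [m Hm] := vs _ e0.
have h1 := vB (maxn n m); have := Hm (maxn n m) (leq_maxr _ _).
rewrite -!(big_mkord xpredT v) (@big_cat_nat _ _ _ n) ?leq_maxl //=.
move: h1; set T := \sum_(n <= _ < _) _; set S := \sum_(0 <= _ < _) _ => h1 h2.
rewrite (_ : s - S = T - (S + T - s)); last by ring.
apply: le_trans (ler_modulusB _ _) _; exact: lerD h1 (ltW h2).
Qed.

Lemma decay_tail_le x K a z n m : 0 <= x -> x * modulus z < 1 -> 0 <= K ->
  (forall l, modulus (a l) <= K * x ^+ l) ->
  modulus (\sum_(n <= l < m) at_pt a z l)
    <= K * (x * modulus z) ^+ n / (1 - x * modulus z).
Proof.
move=> x0 xz K0 aK; apply: le_trans (ler_modulus_sum _ _ _) _.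
apply: (@le_trans _ _ (\sum_(n <= l < m) K * (x * modulus z) ^+ l)).
  apply: ler_sum => l _; rewrite modulusM modulusX exprMn mulrA.
  by rewrite ler_wpM2r ?exprn_ge0 ?modulus_ge0.
by rewrite -mulr_sumr -mulrA ler_wpM2l // geo_tail_le // mulr_ge0 ?modulus_ge0.
Qed.

(** The average over the circle is replaced by the average over the [N]-th roots
    of unity; it is exact for polynomials of degree below [N], and the part of
    the series beyond [N] is negligible for large [N]. *)
Lemma cauchy_estimate r a S : 0 < r -> conv_beyond r a ->
  (forall z s, modulus z = r -> sums_to (at_pt a z) s -> modulus s <= S) ->
  forall l, modulus (a l) * r ^+ l <= S.
Proof.
move=> r0 ra aS l; apply/ler_addgt0Pr => e e0.
have [x [x0 xr [K K0 aK]]] := ra.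
have xr0 : 0 <= x * r by rewrite mulr_ge0 // ltW.
have [n0 Hn0] := geo_lt_eps (K / (1 - x * r)) xr0 xr e0.
pose N := (n0 + l.+1)%N; have lN : (l < N)%N by rewrite /N; lia.
have N0 : (0 < N)%N by apply: leq_ltn_trans lN.
have [w wN] := prim_root_exists N0.
have w1 : modulus w = 1 by apply: modulus_unity N0 (prim_expr_order wN).
have w0 : w != 0 by rewrite -modulus_gt0 w1.
pose rc : C := (r%:C)%C.
have rcE : modulus rc = r by rewrite modulus_real gtr0_norm.
pose f k := \sum_(j < N) at_pt a (rc * w ^+ k) j.
have fS k : modulus (f k) <= S + e.
  have zr : modulus (rc * w ^+ k) = r.
    by rewrite modulusM modulusX w1 expr1n mulr1.
  have zr' : modulus (rc * w ^+ k) <= r by rewrite zr.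
  have [s Hs] := conv_beyond_sum zr' ra.
  rewrite (_ : f k = s - (s - f k)); last by ring.
  apply: le_trans (ler_modulusB _ _) (lerD (aS _ _ zr Hs) _).
  apply: sums_to_tail_le Hs _ => m.
  apply: le_trans (decay_tail_le _ _ _ _ K0 aK) _; rewrite ?zr ?(ltW x0) //.
  by rewrite mulrAC ltW // Hn0 // /N leq_addr.
have key : \sum_(k < N) w ^- (k * l) * f k = N%:R * (a l * rc ^+ l).
  under eq_bigr do rewrite /f mulr_sumr.
  rewrite exchange_big /= (bigD1 (Ordinal lN)) //= [X in _ + X]big1 ?addr0.
    rewrite (eq_bigr (fun=> a l * rc ^+ l)).
      by rewrite sumr_const card_ord mulr_natl.
    move=> k _; rewrite /at_pt exprMn -exprM.
    have W0 : w ^+ (k * l) != 0 by rewrite expf_neq0.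
    by field.
  move=> j jl; pose t := w ^+ j / w ^+ l.
  have tN : t ^+ N = 1.
    by rewrite exprMn exprVn !(exprAC w _ N) (prim_expr_order wN) !expr1n divr1.
  have t1 : t - 1 != 0.
    rewrite subr_eq0 /t; apply: contra jl => /eqP tE.
    have /eqP : w ^+ j = w ^+ l.
      by rewrite -[RHS]mul1r -tE divfK // expf_neq0.
    rewrite (eq_prim_root_expr wN) !modn_small //.
  have sumt : \sum_(k < N) t ^+ k = 0.
    by apply: (mulfI t1); rewrite mulr0 -subrX1 tN subrr.
  rewrite (eq_bigr (fun k : 'I_N => a j * rc ^+ j * t ^+ k)).
    by rewrite -mulr_sumr sumt mulr0.
  move=> k _; rewrite /at_pt /t !exprMn exprVn -!exprM [(k * l)%N]mulnC [(k * j)%N]mulnC.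
  rewrite [(j * k)%N]mulnC -exprVn; ring.
have : N%:R * (modulus (a l) * r ^+ l) <= N%:R * (S + e).
  rewrite -{1}rcE -modulusX -modulusM -modulus_nat -modulusM -key.
  apply: le_trans (ler_modulus_sum _ _ _) _.
  rewrite modulus_nat -[N in N%:R]card_ord mulr_natl -sumr_const.
  apply: ler_sum => k _; rewrite modulusM modulusV modulusX w1 expr1n invr1 mul1r.
  exact: fS.
by rewrite ler_pM2l // ltr0n.
Qed.

(** As the series vanishes at [z], the coefficients of its quotient by
    [1 - X / z] are, up to the factor [- z ^- l], its tails at [z]: they decay
    at the same rate. *)
Lemma zero_division x a z : 0 < x -> x * modulus z < 1 -> z != 0 ->
  decay x a -> sums_to (at_pt a z) 0 -> decay x (fps_geo z^-1 * a).
Proof.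
move=> x0 y1 z0 [K K0 aK] a0; set y := x * modulus z in y1.
have y0 : 0 <= y by rewrite mulr_ge0 ?modulus_ge0 ?ltW.
exists (K * y / (1 - y)).
  by rewrite divr_ge0 ?(mulr_ge0 K0) // subr_ge0 ltW.
move=> l; rewrite mulrC fpsM.
have -> : \sum_(i < l.+1) a i * fps_geo z^-1 (l - i)%N =
    - (z ^- l * (0 - \sum_(i < l.+1) at_pt a z i)).
  rewrite sub0r mulrN opprK mulr_sumr; apply: eq_bigr => i _.
  have il : (i <= l)%N by rewrite -ltnS.
  rewrite /fps_geo /at_pt exprVn mulrCA; congr (_ * _).
  move: (nat_of_ord i) il => j jl.
  by rewrite -[in RHS](subnK jl) exprD invfM mulfVK // expf_neq0.
rewrite modulusN modulusM modulusV modulusX.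
apply: (@le_trans _ _ ((modulus z ^+ l)^-1 * (K * y ^+ l.+1 / (1 - y)))).
  rewrite ler_wpM2l ?invr_ge0 ?exprn_ge0 ?modulus_ge0 //.
  by apply: sums_to_tail_le a0 _ => m; apply: decay_tail_le => //; exact: ltW.
rewrite exprS {2}/y exprMn le_eqVlt; apply/orP; left; apply/eqP.
have zl : modulus z ^+ l != 0 by rewrite expf_neq0 // modulus_eq0.
have y1' : 1 - y != 0 by rewrite subr_eq0 gt_eqF.
by field; rewrite zl y1'.
Qed.

(** Jensen's inequality for the [H^2] norm of the disc of radius [r0].  The
    factor [1 - c X], with zero in the disc of radius [r], may be replaced by
    [d (1 - c' X)] where [1 / c'] is the reflection of [1 / c] in the circle of
    radius [r0] and [modulus d = modulus c * r0]: the two have the same modulus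
    on this circle, hence the norm is unchanged, while the value at the origin
    is multiplied by [d], of modulus at least [r0 / r]. *)
Lemma jensen r0 r cs u B : 0 < r -> r < r0 -> conv_beyond r0 u ->
  (forall c : C, c \in cs -> 1 <= modulus c * r) ->
  (forall n, \sum_(l < n)
     modulus ((\prod_(c <- cs) fps_lin c * u) l) ^+ 2 * (r0 ^+ l) ^+ 2 <= B) ->
  modulus (u 0) ^+ 2 * ((r0 / r) ^+ 2) ^+ size cs <= B.
Proof.
move=> r_gt0 rr0; have r00 : 0 < r0 by apply: lt_trans rr0.
elim: cs u B => [|c cs IH] u B ru cs1 HB.
  have := HB 1%N; rewrite big_nil mul1r big_ord1 /= !expr1n !mulr1; exact.
have c1 : 1 <= modulus c * r by apply: cs1; rewrite mem_head.
have c0 : 0 < modulus c by rewrite -(pmulr_lgt0 _ r_gt0) (lt_le_trans _ c1).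
have cn0 : c != 0 by rewrite -modulus_gt0.
pose rc : C := (r0%:C)%C.
have rcE : modulus rc = r0 by rewrite modulus_real gtr0_norm.
have rcn0 : rc != 0 by rewrite -modulus_gt0 rcE.
pose d : C := c * rc.
have dE : modulus d = modulus c * r0 by rewrite modulusM rcE.
have dr : r0 / r <= modulus d by rewrite dE ler_pdivrMr // mulrAC ler_peMl // ltW.
have rr1 : 1 < r0 / r by rewrite ltr_pdivlMr // mul1r.
have d1 : 1 < modulus d by apply: lt_le_trans dr.
have d0 : 0 < modulus d by apply: lt_trans d1.
pose cd : C := (d^*)%C.
have cdn0 : cd != 0 by rewrite -modulus_gt0 modulus_conj.
pose c' : C := (rc * cd)^-1.
pose v := \prod_(c <- cs) fps_lin c * u.
have rv : conv_beyond r0 v.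
  rewrite /v; elim: (cs) => [|e es IHs]; first by rewrite big_nil mul1r.
  rewrite big_cons -mulrA; apply: conv_beyondM => //.
  by apply: (@conv_beyond_deg _ _ 1) (ltW r00) => -[|[|l]].
pose t l := v l * rc ^+ l.
have t_to0 e : 0 < e -> exists n, forall l, (n <= l)%N -> modulus (t l) < e.
  move=> e0; have [x [x0 xr [K K0 vK]]] := rv.
  have [n Hn] := geo_lt_eps K (mulr_ge0 (ltW x0) (ltW r00)) xr e0.
  exists n => l /Hn; apply: le_lt_trans.
  by rewrite modulusM modulusX rcE exprMn mulrA ler_wpM2r // exprn_ge0 // ltW.
(* The two norms agree up to the boundary term [t n], which tends to [0]. *)
have swap n : modulus d ^+ 2 * (\sum_(l < n.+1)
      modulus ((fps_lin c' * v) l) ^+ 2 * (r0 ^+ l) ^+ 2) =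
    \sum_(l < n.+1) modulus ((fps_lin c * v) l) ^+ 2 * (r0 ^+ l) ^+ 2 +
    (modulus d ^+ 2 - 1) * modulus (t n) ^+ 2.
  have coefE l : modulus ((fps_lin c * v) l) ^+ 2 * (r0 ^+ l) ^+ 2 -
      modulus d ^+ 2 * (modulus ((fps_lin c' * v) l) ^+ 2 * (r0 ^+ l) ^+ 2) =
      (1 - modulus d ^+ 2) * (modulus (t l) ^+ 2 -
         modulus (if l is l'.+1 then t l' else 0) ^+ 2).
    rewrite -modulus_sqr_swap -[modulus d]modulus_conj -rcE -(modulusX rc l) -!exprMn.
    rewrite -!modulusM; congr (_ ^+ 2 - _ ^+ 2); congr modulus.
      rewrite fps_linM; case: l => [|l]; rewrite /t ?mulr0 ?subr0 //.
      by rewrite mulrBl /d exprS; congr (_ - _); ring.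
    rewrite fps_linM -/cd; case: l => [|l]; rewrite /t ?subr0; first by ring.
    rewrite mulrBl mulrBr mulrA; congr (_ - _).
    by rewrite /c' exprS; field; rewrite rcn0 cdn0.
  rewrite mulr_sumr; apply/eqP; rewrite -subr_eq0 opprD addrA -sumrB subr_eq0.
  elim: n => [|n /eqP IHn].
    have := coefE 0; rewrite !big_ord1 => /= h; apply/eqP.
    rewrite -opprB h modulus0; ring.
  rewrite big_ord_recr /= IHn -opprB coefE /=; apply/eqP; ring.
have IHu : modulus ((fps_lin c' * u) 0) ^+ 2 * ((r0 / r) ^+ 2) ^+ size cs
    <= B / modulus d ^+ 2.
  apply: IH.
  - apply: conv_beyondM => //.
    by apply: (@conv_beyond_deg _ _ 1) (ltW r00) => -[|[|l]].
  - by move=> e es; apply: cs1; rewrite inE es orbT.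
  move=> n; rewrite ler_pdivlMr ?exprn_gt0 // mulrC.
  rewrite mulrCA -/v; apply/ler_addgt0Pr => e e0.
  have dd : 0 < modulus d ^+ 2 by rewrite exprn_gt0.
  have e1 : 0 < Num.min 1 (e / modulus d ^+ 2) by rewrite lt_min ltr01 divr_gt0.
  have [m Hm] := t_to0 _ e1.
  apply: (@le_trans _ _ (modulus d ^+ 2 * (\sum_(l < (maxn n m).+1)
      modulus ((fps_lin c' * v) l) ^+ 2 * (r0 ^+ l) ^+ 2))).
    rewrite ler_pM2l // -!(big_mkord xpredT
      (fun l => modulus ((fps_lin c' * v) l) ^+ 2 * (r0 ^+ l) ^+ 2)).
    rewrite [leRHS](@big_cat_nat _ _ _ n) //=; last by rewrite ltnW // ltnS leq_maxl.
    by rewrite lerDl sumr_ge0 // => l _; rewrite mulr_ge0 ?sqr_ge0.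
  rewrite swap lerD //.
    by have := HB (maxn n m).+1; rewrite big_cons -mulrA.
  have := Hm _ (leq_maxr n m); rewrite lt_min => /andP[t1 te].
  apply: (@le_trans _ _ (modulus d ^+ 2 * modulus (t (maxn n m)))).
    apply: ler_pM; rewrite ?sqr_ge0 // ?subr_ge0 ?exprn_ege1 ?(ltW d1) //.
      by rewrite gerBl.
    by rewrite expr2 ler_piMl ?modulus_ge0 // ltW.
  by rewrite mulrC -ler_pdivlMr // ltW.
rewrite fps_coef0M mul1r in IHu; rewrite /= [_ ^+ (size cs).+1]exprS mulrCA.
apply: le_trans (ler_wpM2l _ IHu) _; first exact: sqr_ge0.
rewrite mulrCA ler_piMr //; last first.
  rewrite ler_pdivrMr ?exprn_gt0 // mul1r lerXn2r ?nnegrE //; last exact: ltW.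
  by rewrite divr_ge0 // ltW.
by have := HB 0%N; rewrite big_ord0.
Qed.

End CauchyEstimate.

(** * Power series without zeros on a closed disc *)

Section ZeroFreeInverse.
Context {R : realType}.
Local Notation C := (cfield R).
Implicit Types (a b u : fps R) (s t z : C) (x y r : R).

Definition zero_free r u :=
  forall z, modulus z <= r -> ~ sums_to (at_pt u z) 0.

Lemma sums_to_0 u : sums_to (at_pt u 0) (u 0%N).
Proof.
move=> e e0; exists 1%N => -[//|n] _; rewrite big_ord_recl /= big1 => [|i _].
  by rewrite /at_pt mulr1 addr0 subrr modulus0.
by rewrite /at_pt exprS mul0r mulr0.
Qed.

Lemma prod_lin_coef0 (cs : seq C) u :
  (\prod_(c <- cs) fps_lin c * u) 0%N = u 0%N.
Proof.
elim: cs => [|c cs IH]; first by rewrite big_nil mul1r.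
by rewrite big_cons -mulrA fps_coef0M IH mul1r.
Qed.

Lemma conv_beyond_prod_lin r (cs : seq C) : 0 < r ->
  conv_beyond r (\prod_(c <- cs) fps_lin c).
Proof.
move=> r0; elim: cs => [|c cs IH].
  by rewrite big_nil; apply: conv_beyond1; exact: ltW.
rewrite big_cons; apply: conv_beyondM => //.
by apply: (@conv_beyond_deg _ _ 1) (ltW r0) => -[|[|l]].
Qed.

(** Zeros in the disc of radius [r] are divided out one at a time; if this never
    ended, the value at the origin would vanish by Jensen's inequality on a
    slightly larger disc. *)
Lemma factor_zeros a : conv_beyond 1 a ->
  (forall z, modulus z < 1 -> ~ sums_to (at_pt a z) 0) ->
  exists r (cs : seq C) u, [/\ 1 < r, conv_beyond r u,
    a = \prod_(c <- cs) fps_lin c * u,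
    forall c, c \in cs -> modulus c <= 1 & zero_free r u].
Proof.
move=> [x [x0]]; rewrite mulr1 => x1 xa az.
have x'1 : 1 < x^-1 by rewrite invf_gt1.
pose r0 := (1 + x^-1) / 2; pose r := (1 + r0) / 2.
have [r01 r0x] := midf_lt x'1; rewrite -/r0 in r01 r0x.
have [r1 rr0] := midf_lt r01; rewrite -/r in r1 rr0.
have r_gt0 : 0 < r by apply: lt_trans r1.
have r0_gt0 : 0 < r0 by apply: lt_trans rr0.
have xr0 : x * r0 < 1 by rewrite mulrC -ltr_pdivlMr // mul1r.
have xr : x * r < 1 by apply: lt_trans xr0; rewrite ltr_pM2l.
have a0 : a 0%N != 0.
  apply/eqP => a0; apply: (az 0); first by rewrite modulus0.
  by have := sums_to_0 a; rewrite a0.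
apply: contrapT => noz.
have step k : exists (cs : seq C) u, [/\ size cs = k, decay x u,
    a = \prod_(c <- cs) fps_lin c * u &
    forall c, c \in cs -> modulus c <= 1 /\ 1 <= modulus c * r].
  elim: k => [|k [cs [u [sz xu aE csP]]]].
    by exists [::], a; split => //; rewrite big_nil mul1r.
  have ru : conv_beyond r u by exists x.
  have [z [zr uz]] : exists z, modulus z <= r /\ sums_to (at_pt u z) 0.
    apply: contrapT => H; apply: noz; exists r, cs, u; split => //.
      by move=> c /csP[].
    by move=> z zr uz; apply: H; exists z.
  have z0 : z != 0.
    apply: contra_neq a0 => z0; rewrite aE prod_lin_coef0.
    by move: uz; rewrite z0 => /(sums_to_unique (sums_to_0 u)).
  have z1 : 1 <= modulus z.
    rewrite leNgt; apply/negP => z1; apply: (az z z1).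
    have rp := conv_beyond_prod_lin cs r_gt0.
    have [s Hs] := conv_beyond_sum zr rp.
    by rewrite aE -(mulr0 s); apply: (sums_toM zr (ltW r_gt0)).
  have zm : 0 < modulus z by apply: lt_le_trans z1.
  exists (z^-1 :: cs), (fps_geo z^-1 * u); split.
  - by rewrite /= sz.
  - apply: zero_division => //; apply: le_lt_trans xr.
    by rewrite ler_pM2l.
  - rewrite big_cons aE mulrACA fps_linK.
    by rewrite mul1r.
  move=> c; rewrite inE => /orP[/eqP -> |/csP //].
  by rewrite modulusV invf_le1 // ler_pdivlMl // mulr1.
have [K K0 aK] := xa.
pose y := x * r0; have y0 : 0 <= y by rewrite mulr_ge0 // ltW.
pose B := K ^+ 2 / (1 - y ^+ 2).
have y21 : y ^+ 2 < 1 by rewrite expr_lt1.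
have HB n : \sum_(l < n) modulus (a l) ^+ 2 * (r0 ^+ l) ^+ 2 <= B.
  apply: (@le_trans _ _ (\sum_(l < n) K ^+ 2 * (y ^+ 2) ^+ l)).
    apply: ler_sum => l _; rewrite [(y ^+ 2) ^+ l]exprAC -!exprMn.
    have r0l : 0 <= r0 ^+ l by rewrite exprn_ge0 // ltW.
    have xl : 0 <= x ^+ l by rewrite exprn_ge0 // ltW.
    rewrite lerXn2r ?nnegrE ?mulr_ge0 ?modulus_ge0 //; first by rewrite exprn_ge0.
    by apply: le_trans (ler_wpM2r r0l (aK l)) _; rewrite -mulrA -exprMn.
  by rewrite -mulr_sumr ler_wpM2l ?sqr_ge0 // geo_sum_le ?sqr_ge0.
have a02 : 0 < modulus (a 0%N) ^+ 2 by rewrite exprn_gt0 // modulus_gt0.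
pose q := (r0 / r) ^+ 2.
have q1 : 1 < q by rewrite exprn_egt1 // ltr_pdivlMr // mul1r.
have q0 : 0 < q by apply: lt_trans q1.
have q'0 : 0 <= q^-1 by rewrite invr_ge0 ltW.
have q'1 : q^-1 < 1 by rewrite invf_lt1.
have [k Hk] := geo_lt_eps B q'0 q'1 a02.
have [cs [u [sz xu aE csP]]] := step k.
have := Hk k (leqnn k); apply/negP; rewrite -leNgt.
have qk : 0 < q ^+ k by rewrite exprn_gt0.
rewrite exprVn (ler_pdivlMr _ _ qk).
have -> : a 0%N = u 0%N by rewrite aE prod_lin_coef0.
rewrite -[X in q ^+ X]sz; apply: jensen r_gt0 rr0 _ _ _.
- by exists x.
- by move=> c /csP[].
- by move=> n; rewrite -aE.
Qed.

(** The inverse is a product of geometric series, one for each root. *)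
Lemma poly_inverse r (p : {poly C}) : 0 < r -> p != 0 ->
  (forall z, modulus z <= r -> p.[z] != 0) ->
  exists2 b, fps_of_poly p * b = 1 & conv_beyond r b.
Proof.
move=> r0; have [rs Dp] := closed_field_poly_normal (p : {poly R[i]}).
move=> p0; rewrite Dp; move: p0; rewrite -lead_coef_eq0.
move: (lead_coef _) => k k0 {Dp}.
elim: rs => [|w rs IH] pz.
  exists (fun l => k^-1 * (1 : fps R) l).
    apply: funext => l; rewrite big_nil fpsM big_ord_recl big1 ?addr0.
      by rewrite /fps_of_poly alg_polyC coefC /= subn0 mulrA mulfV // mul1r.
    by move=> i _; rewrite /fps_of_poly alg_polyC coefC /= mul0r.
  have [x [x0 xr x1]] := conv_beyond1 (ltW r0).
  by exists x; split => //; exact: decay_scale.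
have [|b pb rb] := IH.
  move=> z zr; have := pz z zr; rewrite big_cons scalerAr hornerM mulf_eq0.
  by rewrite negb_or => /andP[].
have wr : r < modulus w.
  rewrite ltNge; apply/negP => wr; have := pz w wr.
  by rewrite big_cons scalerAr hornerM hornerXsubC subrr mul0r eqxx.
have w0 : w != 0 by rewrite -modulus_gt0 (lt_trans r0).
pose g : fps R := fun l => - w^-1 * fps_geo w^-1 l.
have wg : fps_of_poly ('X - w%:P) * g = 1.
  pose h : fps R := fun l => - w * fps_lin w^-1 l.
  have -> : fps_of_poly ('X - w%:P) = h.
    apply: funext => l; rewrite /h /fps_of_poly coefB coefX coefC.
    case: l => [|[|l]] /=; rewrite ?sub0r ?mulr1 ?subr0 ?mulr0 ?oppr0 //.
    by rewrite mulrNN mulfV.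
  apply: funext => l; rewrite -(fps_linK w^-1) !fpsM; apply: eq_bigr => i _.
  by rewrite /g /h mulrACA mulrNN mulfV // mul1r.
exists (g * b).
  by rewrite big_cons scalerAr fps_of_polyM mulrACA wg mul1r.
apply: conv_beyondM => //; exists (modulus w^-1); split.
- by rewrite modulus_gt0 invr_eq0.
- by rewrite modulusV mulrC ltr_pdivrMr ?mul1r // (lt_trans r0).
- exact: decay_scale (decay_geo _).
Qed.

Lemma lipschitz_continuous (A : set (R * R)) (F : R * R -> R) L :
  (forall p q, A p -> A q -> `|F p - F q| <= L * (`|p.1 - q.1| + `|p.2 - q.2|)) ->
  {within A, continuous F}.
Proof.
move=> FL; apply/subspace_continuousP => p Ap; apply/cvgrPdist_lt => e e0.
have L0 : 0 < `|L| + 1 by rewrite ltr_wpDl.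
have d0 : 0 < e / (`|L| + 1) / 2 by rewrite !divr_gt0.
rewrite near_withinE; apply/nbhs_ballP; exists (e / (`|L| + 1) / 2) => //.
move=> q [b1 b2] Aq; apply: le_lt_trans (FL _ _ Ap Aq) _.
apply: (@le_lt_trans _ _ ((`|L| + 1) * (`|p.1 - q.1| + `|p.2 - q.2|))).
  by rewrite ler_wpM2r ?addr_ge0 // (le_trans (ler_norm L)) // lerDl.
rewrite mulrC -ltr_pdivlMr // [ltRHS]splitr; exact: ltrD.
Qed.

Lemma modulus_lip z w : `|modulus z - modulus w| <= modulus (z - w).
Proof.
have h (p q : C) : modulus p - modulus q <= modulus (p - q).
  by rewrite lerBlDr -{1}(subrK q p) ler_modulusD.
by rewrite ler_norml h andbT lerNl opprB modulus_distC h.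
Qed.

(** The sum as a function of the point, needed to speak of its continuity. *)
Definition val_at u z : C := get (sums_to (at_pt u z)).

Lemma val_atP r u z : conv_beyond r u -> modulus z <= r ->
  sums_to (at_pt u z) (val_at u z).
Proof. by move=> ru zr; apply: getPex; exact: conv_beyond_sum zr ru. Qed.

Lemma val_at_lip r u : 0 < r -> conv_beyond r u -> exists L, forall z w,
  modulus z <= r -> modulus w <= r ->
  modulus (val_at u z - val_at u w) <= L * modulus (z - w).
Proof.
move=> r0 ru; have [x [x0 xr [K K0 uK]]] := ru.
have xr0 : 0 <= x * r by rewrite mulr_ge0 // ltW.
have [M [v [M0 v0 v1 Hv]]] := poly_geo_le 1 xr0 xr.
exists (K / r * M / (1 - v)) => z w zr wr.
have := sums_toB (val_atP ru zr) (val_atP ru wr) => /sums_to_le; apply => n.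
apply: le_trans (ler_modulus_sum _ _ _) _.
apply: (@le_trans _ _ (\sum_(l < n) K / r * M * modulus (z - w) * v ^+ l)).
  apply: ler_sum => l _; rewrite /at_pt -mulrBr modulusM.
  have zw : modulus (z ^+ l - w ^+ l) <= modulus (z - w) / r * (l.+1%:R * r ^+ l).
    rewrite subrXX modulusM -mulrA ler_wpM2l ?modulus_ge0 // ler_pdivlMl //.
    apply: le_trans (ler_wpM2l (ltW r0) (ler_modulus_sum _ _ _)) _.
    apply: (@le_trans _ _ (r * \sum_(i < l) r ^+ l.-1)).
      rewrite ler_pM2l //; apply: ler_sum => i _.
      rewrite modulusM !modulusX -[in leRHS](_ : (l - i.+1) + i = l.-1)%N; last first.
        by have := ltn_ord i; lia.
      rewrite exprD; apply: ler_pM; rewrite ?exprn_ge0 ?modulus_ge0 //.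
        rewrite (_ : (l.-1 - i = l - i.+1)%N); last by lia.
        by rewrite lerXn2r ?nnegrE ?modulus_ge0 // ltW.
      by rewrite lerXn2r ?nnegrE ?modulus_ge0 // ltW.
    rewrite sumr_const card_ord; move: (nat_of_ord l) => [|k].
      by rewrite mulr0n mulr0 mul1r.
    rewrite mulrnAr -exprS -mulr_natl ler_wpM2r ?exprn_ge0 ?(ltW r0) //.
    by rewrite ler_nat.
  apply: le_trans (ler_pM (modulus_ge0 _) (modulus_ge0 _) (uK l) zw) _.
  rewrite [leLHS](_ : _ = K / r * modulus (z - w) * (l.+1%:R ^+ 1 * (x * r) ^+ l)).
    rewrite [leRHS](_ : _ = K / r * modulus (z - w) * (M * v ^+ l)); last by ring.
    by rewrite ler_wpM2l // !mulr_ge0 ?modulus_ge0 // invr_ge0 ltW.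
  by rewrite exprMn; ring.
rewrite -mulr_sumr [leRHS](_ : _ = K / r * M * modulus (z - w) * (1 - v)^-1); last by ring.
rewrite ler_wpM2l ?geo_sum_le // !mulr_ge0 ?modulus_ge0 //.
by rewrite invr_ge0 ltW.
Qed.

Lemma modulus_pair (p : R * R) (q : R * R) :
  modulus (Complex p.1 p.2 - Complex q.1 q.2 : C) <= `|p.1 - q.1| + `|p.2 - q.2|.
Proof. exact: modulus_le_ReIm. Qed.

(** The modulus of the sum is Lipschitz on the closed disc, a compact subset of
    the plane, and therefore attains its minimum. *)
Lemma min_modulus r u : 0 < r -> conv_beyond r u -> zero_free r u ->
  exists2 d, 0 < d & forall z s, modulus z <= r -> sums_to (at_pt u z) s ->
    d <= modulus s.
Proof.
move=> r0 ru uz; have [L HL] := val_at_lip r0 ru.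
pose cpx (p : R * R) : C := Complex p.1 p.2.
pose F p := modulus (val_at u (cpx p)).
pose A := [set p : R * R | modulus (cpx p) <= r].
have cA : compact A.
  apply: (@subclosed_compact _ _ (`[- r, r]%classic `*` `[- r, r]%classic)).
  - have -> : A = (fun p => modulus (cpx p)) @^-1` [set y : R | y <= r] by [].
    apply: closed_comp; last exact: closed_le.
    move=> p _.
    have /subspace_continuousP : {within [set: R * R],
        continuous (fun p => modulus (cpx p))}.
      apply: (@lipschitz_continuous _ _ 1) => p' q _ _; rewrite mul1r.
      exact: le_trans (modulus_lip _ _) (modulus_pair _ _).
    move=> /(_ p I) H B /H; rewrite /= /within /=.
    by apply: (@filterS _ (nbhs p)) => q; apply.
  - by apply: compact_setX; exact: segment_compact.
  - move=> p Ap; split; rewrite /= in_itv /= -ler_norml.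
      exact: le_trans (Re_le_modulus (cpx p)) Ap.
    exact: le_trans (Im_le_modulus (cpx p)) Ap.
have A0 : A !=set0.
  by exists (0, 0); rewrite /A /= /cpx (_ : Complex 0 0 = 0 :> C) // modulus0 ltW.
have cF : {within A, continuous F}.
  apply: (@lipschitz_continuous _ _ `|L|) => p q Ap Aq.
  apply: le_trans (modulus_lip _ _) _; apply: le_trans (HL _ _ Ap Aq) _.
  apply: le_trans (ler_wpM2l (normr_ge0 L) (modulus_pair p q)).
  by rewrite ler_wpM2r ?modulus_ge0 // ler_norm.
have [p pA pmin] := compact_EVT_min A0 cA cF; rewrite inE in pA.
exists (F p).
  rewrite /F modulus_gt0; apply/eqP => F0; apply: (uz (cpx p) pA).
  by rewrite -F0; exact: val_atP ru pA.
move=> z s zr us.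
have zE : cpx (complex.Re z, complex.Im z) = z by case: (z).
have := pmin (complex.Re z, complex.Im z); rewrite inE /A /= zE => /(_ zr).
rewrite /F zE (_ : val_at u z = s) //.
exact: sums_to_unique (val_atP ru zr) us.
Qed.

(** Let [p] be a truncation of [u] so long that the remainder is small compared
    with the minimum of the modulus.  Then [p] has no zeros, it is inverted by
    factorization, and [u = p (1 - e)] where [e] is at most [1 / 3] on the circle
    of radius [r].  Cauchy's estimate for the powers of [e] makes the Neumann
    series of [1 - e] converge. *)
Lemma zero_free_inverse r r' u : 0 < r' -> r' < r ->
  conv_beyond r u -> zero_free r u ->
  exists2 v, u * v = 1 & conv_beyond r' v.
Proof.
move=> r'0 r'r ru uz; have r0 : 0 < r by apply: lt_trans r'r.
have [d d0 Hd] := min_modulus r0 ru uz.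
have [x [x0 xr [K K0 uK]]] := ru.
have xr0 : 0 <= x * r by rewrite mulr_ge0 // ltW.
have d40 : 0 < d / 4 by rewrite divr_gt0.
have [n Hn] := geo_lt_eps (K / (1 - x * r)) xr0 xr d40.
pose p : {poly C} := \poly_(i < n.+1) u i.
have pu z s : modulus z <= r -> sums_to (at_pt u z) s ->
    modulus (s - p.[z]) <= d / 4.
  move=> zr us; rewrite horner_poly.
  apply: sums_to_tail_le us _ => m.
  apply: le_trans (decay_tail_le _ _ (ltW x0) _ K0 uK) _.
    by apply: le_lt_trans xr; rewrite ler_pM2l.
  apply: (@le_trans _ _ (K / (1 - x * r) * (x * r) ^+ n.+1)); last first.
    by rewrite ltW // Hn.
  have xz : x * modulus z <= x * r by rewrite ler_pM2l.
  rewrite mulrAC; apply: ler_pM.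
  - by rewrite divr_ge0 // subr_ge0 (le_trans xz) // ltW.
  - by rewrite exprn_ge0 // mulr_ge0 ?modulus_ge0 // ltW.
  - rewrite ler_wpM2l // lef_pV2 ?posrE ?subr_gt0 // ?(le_lt_trans xz) //.
    by rewrite lerB.
  - by rewrite lerXn2r ?nnegrE // mulr_ge0 ?modulus_ge0 // ltW.
have plow z : modulus z <= r -> 3 * (d / 4) <= modulus p.[z].
  move=> zr; have [s us] := conv_beyond_sum zr ru.
  have := Hd z s zr us; have := pu z s zr us.
  have := ler_modulusD (s - p.[z]) p.[z]; rewrite subrK; lra.
have p_neq0 z : modulus z <= r -> p.[z] != 0.
  by move=> zr; rewrite -modulus_gt0 (lt_le_trans _ (plow z zr)) // mulr_gt0.
have p0 : p != 0.
  apply/eqP => p0; have := p_neq0 0; rewrite p0 horner0 eqxx modulus0.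
  by move=> /(_ (ltW r0)).
have [b pb rb] := poly_inverse r0 p0 p_neq0.
have rp : conv_beyond r (fps_of_poly p) := conv_beyond_deg (@deg_le_poly _ p) (ltW r0).
have rpu : conv_beyond r (fps_of_poly p - u).
  by apply: conv_beyondD => //; [exact: ltW|exact: conv_beyondN].
pose e := b * (fps_of_poly p - u).
have re : conv_beyond r e by apply: conv_beyondM.
have uE : u = fps_of_poly p * (1 - e).
  by rewrite /e mulrBr mulr1 mulrA pb mul1r opprB addrC subrK.
have e0 : e 0%N = 0.
  rewrite /e fps_coef0M fpsB (_ : fps_of_poly p 0%N = u 0%N) ?subrr ?mulr0 //.
  by rewrite /fps_of_poly coef_poly.
have e_small z s : modulus z = r -> sums_to (at_pt e z) s -> modulus s <= 1 / 3.
  move=> zr es; have zr' : modulus z <= r by rewrite zr.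
  have [t ut] := conv_beyond_sum zr' ru.
  have h1 := sums_toM zr' (ltW r0) rp re (@sums_to_poly _ p z) es.
  have h2 : sums_to (at_pt (fps_of_poly p - u) z) (p.[z] - t).
    by rewrite at_ptD at_ptN; apply: sums_toB (@sums_to_poly _ p z) ut.
  rewrite /e mulrA pb mul1r in h1.
  have -> : s = (p.[z] - t) / p.[z].
    by rewrite -(sums_to_unique h1 h2) mulrAC mulfV ?mul1r ?p_neq0.
  rewrite modulusM modulusV ler_pdivrMr ?modulus_gt0 ?p_neq0 //.
  rewrite modulus_distC; have := pu z t zr' ut; have := plow z zr'.
  by lra.
have eX k l : modulus ((e ^+ k) l) * r ^+ l <= (1 / 3) ^+ k.
  apply: (cauchy_estimate r0 (conv_beyondX k r0 re)) => z s zr es.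
  have zr' : modulus z <= r by rewrite zr.
  have [t et] := conv_beyond_sum zr' re.
  rewrite (sums_to_unique es (sums_toX k zr' r0 re et)) modulusX.
  by rewrite lerXn2r ?nnegrE ?modulus_ge0 // ?divr_ge0 // (e_small z).
(* the Neumann series of 1 - e; it is a finite sum in each degree *)
pose w : fps R := fun l => (\sum_(k < l.+1) e ^+ k) l.
have wE l m : (l < m)%N -> w l = (\sum_(k < m) e ^+ k) l.
  move=> lm; rewrite /w -!(big_mkord xpredT (fun k => e ^+ k)).
  rewrite [in RHS](@big_cat_nat _ _ _ l.+1) //= fpsD [X in _ + X]fps_sum.
  rewrite [X in _ + X]big_nat_cond [X in _ + X]big1 ?addr0 //.
  by move=> k /andP[/andP[lk _] _]; exact: fps_expr_coef_eq0.
have ew : (1 - e) * w = 1.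
  apply: funext => l; rewrite fpsM.
  have -> : \sum_(i < l.+1) (1 - e) i * w (l - i)%N =
      ((1 - e) * \sum_(k < l.+1) e ^+ k) l.
    rewrite fpsM; apply: eq_bigr => i _; rewrite -wE // ltnS; exact: leq_subr.
  rewrite -[1 - e]opprB mulNr -subrX1 opprB fpsB fps_expr_coef_eq0 //.
  by rewrite subr0.
have w_dec : decay r^-1 w.
  exists (1 - 1 / 3)^-1; first by rewrite invr_ge0; lra.
  move=> l; rewrite exprVn ler_pdivlMr ?exprn_gt0 // /w fps_sum.
  apply: le_trans (ler_wpM2r _ (ler_modulus_sum _ _ _)) _.
    by rewrite exprn_ge0 // ltW.
  rewrite mulr_suml; apply: le_trans (geo_sum_le l.+1 _ _); [|lra..].
  by apply: ler_sum => k _; exact: eX.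
exists (b * w).
  by rewrite {1}uE mulrACA pb ew mulr1.
apply: conv_beyondM => //.
  have [y [y0 yr yb]] := rb; exists y; split => //.
  by apply: lt_trans yr; rewrite ltr_pM2l.
exists r^-1; rewrite invr_gt0; split => //.
by rewrite mulrC ltr_pdivrMr // mul1r.
Qed.

End ZeroFreeInverse.

(** * Power weights and their partial sums *)

Section PowerWeights.
Context {R : realType}.
Implicit Types (x y c b : R).

(** Comparable numbers have comparable powers, whatever the sign of the
    exponent. *)
Lemma powR_ratio_le x y c b : 0 < x -> 0 < y -> 1 <= c ->
  x <= c * y -> y <= c * x -> x `^ b <= c `^ `|b| * y `^ b.
Proof.
move=> x0 y0 c1 xy yx; have c0 : 0 < c by apply: lt_le_trans c1.
have [b0|b0] := leP 0 b.
  rewrite ger0_norm // -powRM ?(ltW c0) ?(ltW y0) // ge0_ler_powR // ?nnegrE.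
    exact: ltW.
  by rewrite mulr_ge0 // ltW.
rewrite ltr0_norm // -[b in x `^ b]opprK -[b in y `^ b]opprK.
rewrite powRN [y `^ - - b]powRN.
rewrite ler_pdivlMr ?powR_gt0 // ler_pdivrMl ?powR_gt0 //.
rewrite mulrC -powRM ?(ltW c0) ?(ltW x0) // ge0_ler_powR ?nnegrE //.
- by rewrite oppr_ge0 ltW.
- exact: ltW.
- by rewrite mulr_ge0 // ltW.
Qed.

Lemma sum_ord_const n x : \sum_(i < n) x = n%:R * x.
Proof. by rewrite sumr_const card_ord mulr_natl. Qed.

Definition wt b (l : nat) : R := l.+1%:R `^ b.
Definition wt_sum b N : R := \sum_(l < N.+1) wt (- b) l.

Lemma wt_gt0 b l : 0 < wt b l. Proof. by rewrite powR_gt0. Qed.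
Lemma wt_ge0 b l : 0 <= wt b l. Proof. exact: ltW (wt_gt0 b l). Qed.

Lemma wtNK b l : wt b l * wt (- b) l = 1.
Proof. by rewrite /wt powRN mulfV // gt_eqF // powR_gt0. Qed.

Lemma wt_ratio_le b c i l : 1 <= c -> i.+1%:R <= c * l.+1%:R :> R ->
  l.+1%:R <= c * i.+1%:R :> R -> wt b i <= c `^ `|b| * wt b l.
Proof. exact: powR_ratio_le. Qed.

Lemma exists_nat_ge x : exists a : nat, x <= a%:R.
Proof.
exists (Num.bound `|x|); apply: le_trans (ler_norm x) _.
by rewrite ltW // archi_boundP.
Qed.

Lemma wt_le_expn b a l : `|b| <= a%:R -> wt b l <= l.+1%:R ^+ a.
Proof.
move=> ba; rewrite -powR_mulrn // ler_powR ?ler1n //.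
exact: le_trans (ler_norm b) ba.
Qed.

Lemma wt_sum_ge1 b N : 1 <= wt_sum b N.
Proof.
rewrite /wt_sum big_ord_recl {1}/wt powR1 lerDl sumr_ge0 // => i _.
exact: wt_ge0.
Qed.

Lemma wt_sum_gt0 b N : 0 < wt_sum b N.
Proof. exact: lt_le_trans (wt_sum_ge1 b N). Qed.

Lemma wt_sum_homo b N M : (N <= M)%N -> wt_sum b N <= wt_sum b M.
Proof.
move=> NM; rewrite /wt_sum -!(big_mkord xpredT (fun l => wt (- b) l)).
rewrite [leRHS](@big_cat_nat _ _ _ N.+1) //= lerDl sumr_ge0 // => i _.
exact: wt_ge0.
Qed.

Lemma wt_sum_le_expn b a N : `|b| <= a%:R -> wt_sum b N <= N.+1%:R ^+ a.+1.
Proof.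
move=> ba; rewrite exprS /wt_sum.
rewrite -sum_ord_const; apply: ler_sum => l _.
apply: le_trans (@wt_le_expn _ a _ _) _; first by rewrite normrN.
by rewrite lerXn2r ?nnegrE // ler_nat.
Qed.

(** Each block of [k] consecutive weights is comparable with one weight. *)
Lemma wt_sum_dilate b k : (0 < k)%N -> exists2 K, 0 < K &
  forall j, \sum_(l < k * j) wt (- b) l <= K * \sum_(l < j) wt (- b) l.
Proof.
move=> k0; pose K : R := k%:R * k%:R `^ `|- b|.
have K0 : 0 < K by rewrite mulr_gt0 ?powR_gt0 // ltr0n.
exists K => //; elim=> [|j IH]; first by rewrite muln0 !big_ord0 mulr0.
rewrite mulnSr big_split_ord /= big_ord_recr /= mulrDr lerD //.
rewrite /K -mulrA -sum_ord_const.
apply: ler_sum => i _; apply: wt_ratio_le; first by rewrite ler1n.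
  by rewrite -natrM ler_nat; have := ltn_ord i; lia.
rewrite -natrM ler_nat; apply: leq_trans (leq_pmull _ k0).
by rewrite ltnS; apply: leq_trans (leq_pmull j k0) (leq_addr _ _).
Qed.

End PowerWeights.

(** * The approximation problem in one variable *)

Section OneVariable.
Context {R : realType}.
Local Notation C := (cfield R).
Variable b : R.
Implicit Types (x y r B : R) (z : C) (q f g u : fps R) (N : nat).

Local Notation w := (wt (- b)).
Local Notation L := (wt_sum b).

(** The errors that are dealt with: bounded in [l^1], and dominated by the
    coefficients of the extremal kernel.  These two bounds together give the
    right energy, and they survive multiplication, which an energy bound does
    not as the weighted spaces are not algebras for [b <= 1]. *)
Definition tame N B f := [/\ 0 <= B,
  forall n, \sum_(l < n) modulus (f l) <= B &
  forall l, modulus (f l) <= B * (w l / L N)].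

Lemma tame_energy N B f n : tame N B f ->
  \sum_(l < n) wt b l * modulus (f l) ^+ 2 <= B ^+ 2 / L N.
Proof.
move=> [B0 f1 fw].
apply: (@le_trans _ _ (\sum_(l < n) B / L N * modulus (f l))).
  apply: ler_sum => l _; rewrite expr2 mulrA ler_wpM2r ?modulus_ge0 //.
  apply: le_trans (ler_wpM2l (wt_ge0 b l) (fw l)) _.
  by rewrite mulrCA [wt b l * _]mulrA wtNK mul1r.
rewrite -mulr_sumr expr2 [leRHS]mulrAC ler_wpM2l //.
by rewrite divr_ge0 // ltW // wt_sum_gt0.
Qed.

Lemma w_div_ge0 N l : 0 <= w l / L N.
Proof. by rewrite divr_ge0 ?wt_ge0 // ltW // wt_sum_gt0. Qed.

Lemma tameD N B B' f g : tame N B f -> tame N B' g -> tame N (B + B') (f + g).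
Proof.
move=> [B0 f1 fw] [B0' g1 gw]; split => [|n|l]; first exact: addr_ge0.
  apply: (@le_trans _ _ (\sum_(l < n) (modulus (f l) + modulus (g l)))).
    by apply: ler_sum => l _; rewrite ler_modulusD.
  by rewrite big_split /= lerD ?f1 ?g1.
by rewrite mulrDl; apply: le_trans (ler_modulusD _ _) (lerD (fw l) (gw l)).
Qed.

Lemma tameN N B f : tame N B f -> tame N B (- f).
Proof.
move=> [B0 f1 fw]; split => // [n|l]; last by rewrite fpsN modulusN.
by under eq_bigr do rewrite fpsN modulusN.
Qed.

Lemma tame0 N : tame N 0 0.
Proof.
split => // [n|l]; last by rewrite fps0 modulus0 mul0r.
by rewrite big1 // => l _; rewrite fps0 modulus0.
Qed.

Definition conv_const : R := 2 * 2 `^ `|- b|.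

Lemma conv_const_ge1 : 1 <= conv_const.
Proof.
rewrite /conv_const; have : 1 <= 2 `^ `|- b| :> R.
  by rewrite -[leLHS](powRr0 2) ler_powR // ler1n.
by lra.
Qed.

(** In a product one of the two indices is at least half of their sum, where
    the weight has the same size. *)
Lemma tameM N B B' f g : tame N B f -> tame N B' g ->
  tame N (conv_const * (B * B')) (f * g).
Proof.
move=> [B0 f1 fw] [B0' g1 gw].
have c1 := conv_const_ge1; have c0 : 0 <= conv_const by apply: le_trans c1.
have BB0 : 0 <= B * B' by rewrite mulr_ge0.
split => [|n|l]; first by rewrite mulr_ge0.
  apply: (@le_trans _ _ (B * B')); last by rewrite ler_peMl.
  apply: (@le_trans _ _ (\sum_(l < n) \sum_(i < l.+1)
      modulus (f i) * modulus (g (l - i)%N))).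
    apply: ler_sum => l _; rewrite fpsM; apply: le_trans (ler_modulus_sum _ _ _) _.
    by apply: ler_sum => i _; rewrite modulusM.
  rewrite (@sum_triangle R (fun i j => modulus (f i) * modulus (g j))).
  apply: (@le_trans _ _ (\sum_(i < n) modulus (f i) * B')).
    apply: ler_sum => i _; rewrite -mulr_sumr ler_wpM2l ?modulus_ge0 //.
  by rewrite -mulr_suml ler_wpM2r.
pose D : R := 2 `^ `|- b|; pose v := w l / L N.
have v0 : 0 <= v by exact: w_div_ge0.
have D0 : 0 <= D by exact: powR_ge0.
have Dv0 : 0 <= D * v by rewrite mulr_ge0.
have half i : (i <= l)%N -> (l <= i.*2)%N -> w i / L N <= D * v.
  move=> il li; rewrite mulrA ler_wpM2r ?invr_ge0 ?(ltW (wt_sum_gt0 b N)) //.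
  apply: wt_ratio_le; first by rewrite ler1n.
    by rewrite -natrM ler_nat; lia.
  by rewrite -natrM ler_nat; lia.
rewrite fpsM; apply: le_trans (ler_modulus_sum _ _ _) _.
apply: (@le_trans _ _ (\sum_(i < l.+1)
    (D * v) * (B * modulus (g (l - i)%N) + B' * modulus (f i)))).
  apply: ler_sum => i _; rewrite modulusM.
  have il : (i <= l)%N by rewrite -ltnS.
  have [li|li] := leqP l i.*2.
    apply: (@le_trans _ _ (D * v * (B * modulus (g (l - i)%N)))); last first.
      by apply: (ler_wpM2l Dv0); rewrite lerDl mulr_ge0 ?modulus_ge0.
    rewrite mulrA ler_wpM2r ?modulus_ge0 // mulrC; apply: le_trans (fw i) _.
    by rewrite ler_wpM2l // half.
  apply: (@le_trans _ _ (D * v * (B' * modulus (f i)))); last first.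
    by apply: (ler_wpM2l Dv0); rewrite lerDr mulr_ge0 ?modulus_ge0.
  rewrite mulrC mulrA ler_wpM2r ?modulus_ge0 // mulrC.
  apply: le_trans (gw (l - i)%N) _; rewrite ler_wpM2l // half ?leq_subr //.
  by move: li; lia.
rewrite -mulr_sumr /conv_const -/D -/v.
rewrite [leRHS](_ : _ = D * v * (B * B' + B' * B)); last by ring.
apply: (ler_wpM2l Dv0); rewrite big_split /= -!mulr_sumr.
apply: lerD; rewrite ler_wpM2l //; last exact: f1.
rewrite (reindex_inj rev_ord_inj) /=; apply: le_trans (g1 l.+1).
by apply: ler_sum => i _; rewrite subSS subKn // -ltnS.
Qed.

(** The extremal kernel for the functional [f |-> f 1] among polynomials of
    degree [N], dilated by [c]. *)
Definition kernel N (c : C) : fps R := fun l =>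
  if (l <= N)%N then ((w l / L N)%:C)%C * c ^+ l else 0.

Lemma modulus_kernel N c l : modulus c <= 1 ->
  modulus (kernel N c l) <= if (l <= N)%N then w l / L N else 0.
Proof.
move=> c1; rewrite /kernel; case: leqP => lN; last by rewrite modulus0.
rewrite modulusM modulusX modulus_real ger0_norm ?w_div_ge0 //.
by rewrite ler_piMr ?w_div_ge0 // exprn_ile1 ?modulus_ge0.
Qed.

Lemma sum_kernel_weights N n : (N < n)%N ->
  \sum_(l < n) (if (l <= N)%N then w l / L N else 0) = 1.
Proof.
move=> Nn; rewrite -(big_mkord xpredT (fun l => if (l <= N)%N then _ l / _ else 0)).
rewrite (@big_cat_nat _ _ _ N.+1) //= [X in _ + X]big_nat_cond [X in _ + X]big1.
  rewrite addr0 big_mkord (eq_bigr (fun l : 'I_N.+1 => w l / L N)).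
    by rewrite -mulr_suml mulfV // gt_eqF // wt_sum_gt0.
  by move=> l _; rewrite -ltnS ltn_ord.
by move=> l /andP[/andP[Nl _] _]; rewrite leqNgt Nl.
Qed.

Lemma tame_kernel N c : modulus c <= 1 -> tame N 1 (kernel N c).
Proof.
move=> c1; split => // [n|l]; last first.
  apply: le_trans (modulus_kernel _ _ c1) _; rewrite mul1r.
  by case: ifP => // _; rewrite w_div_ge0.
rewrite -[leRHS](sum_kernel_weights (leq_maxl N.+1 n)).
apply: (@le_trans _ _ (\sum_(l < n) (if (l <= N)%N then w l / L N else 0))).
  by apply: ler_sum => l _; exact: modulus_kernel.
rewrite -!(big_mkord xpredT (fun l => if (l <= N)%N then w l / L N else 0)).
rewrite [leRHS](@big_cat_nat _ _ _ n) ?leq_maxr //= lerDl sumr_ge0 // => l _.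
by case: ifP => // _; rewrite w_div_ge0.
Qed.

(** The weights in the kernel sum to [1], so [1 - kernel N c] vanishes at [1 / c]
    and is divisible by [1 - c X]. *)
Lemma kernel_divisible N c :
  exists2 q, deg_le N q & fps_lin c * q = 1 - kernel N c.
Proof.
exists (fps_geo c * (1 - kernel N c)); last by rewrite mulrA fps_linK mul1r.
move=> l Nl; rewrite mulrC fpsM.
rewrite (eq_bigr (fun i : 'I_l.+1 => c ^+ l * ((i == 0%N :> nat)%:R -
   (if (i <= N)%N then w i / L N else 0)%:C%C))).
  rewrite -mulr_sumr sumrB big_ord_recl /= big1 // addr0.
  rewrite -rmorph_sum /= sum_kernel_weights ?rmorph1 ?subrr ?mulr0 //.
  exact: ltnW.
move=> i _; rewrite fpsB fps1 /kernel /fps_geo.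
have il : (i <= l)%N by rewrite -ltnS.
have cl : c ^+ l = c ^+ i * c ^+ (l - i) by rewrite -exprD subnKC.
rewrite cl; have [i0|i0] := eqVneq (i : nat) 0%N.
  by rewrite i0 /= expr0 !mulr1 mul1r subn0 mulrC.
case: ifP => _ /=; last by rewrite rmorph0 !subrr mul0r mulr0.
by rewrite !sub0r; ring.
Qed.

(** Errors of approximate inverses combine by
    [(1 - f) (1 - k) = 1 - (f + k - f k)]. *)
Lemma prod_lin_approx (cs : seq C) : (forall c, c \in cs -> modulus c <= 1) ->
  exists B, forall N, exists q f, [/\ deg_le (size cs * N) q, tame N B f &
    \prod_(c <- cs) fps_lin c * q = 1 - f].
Proof.
elim: cs => [|c cs IH] cs1.
  exists 0 => N; exists 1, 0; split; first exact: deg_le1.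
    exact: tame0.
  by rewrite big_nil mulr1 subr0.
have [|B HB] := IH; first by move=> e es; apply: cs1; rewrite inE es orbT.
exists (B + 1 + conv_const * (B * 1)) => N.
have [q [f [qN fB qf]]] := HB N; have [k kN kE] := kernel_divisible N c.
have kt : tame N 1 (kernel N c) by apply: tame_kernel; apply: cs1; exact: mem_head.
exists (k * q), (f + kernel N c - f * kernel N c); split.
- by rewrite /= mulSn; apply: deg_leM.
- by apply: tameD; [apply: tameD|apply: tameN; apply: tameM].
by rewrite big_cons mulrACA kE qf; ring.
Qed.

Definition trunc N f : fps R := fun l => if (l <= N)%N then f l else 0.

(** The error starts in degree [N + 1] and decays geometrically from there, so it
    is dominated by any negative power of the degree. *)
Lemma inverse_approx u v : u * v = 1 -> conv_beyond 1 u -> conv_beyond 1 v ->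
  exists B, forall N, tame N B (1 - trunc N v * u).
Proof.
move=> uv ru rv; have [x [x0 x1 [K K0 uK] [K' K'0 vK]]] := conv_beyond2 ler01 ru rv.
rewrite mulr1 in x1.
have [a ba] := exists_nat_ge `|b|.
have [M [y [M0 y0 y1 HM]]] := poly_geo_le (a + a.+1).+1 (ltW x0) x1.
have KK0 : 0 <= K' * K by rewrite mulr_ge0.
have c0 : 0 <= K' * K * M by rewrite mulr_ge0.
have y11 : 1 <= (1 - y)^-1 by rewrite invf_ge1 ?subr_gt0 // gerBl.
exists (K' * K * M / (1 - y)) => N.
have -> : 1 - trunc N v * u = (v - trunc N v) * u.
  by rewrite mulrBl [v * u]mulrC uv.
have E0 l : (l <= N)%N -> ((v - trunc N v) * u) l = 0.
  move=> lN; rewrite fpsM big1 // => i _; rewrite fpsB /trunc.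
  by rewrite (leq_trans _ lN) ?subrr ?mul0r // -ltnS.
have El l : modulus (((v - trunc N v) * u) l) <= K' * K * (l.+1%:R * x ^+ l).
  rewrite fpsM; apply: le_trans (ler_modulus_sum _ _ _) _.
  rewrite mulrCA -sum_ord_const.
  apply: ler_sum => i _; rewrite modulusM.
  have il : (i <= l)%N by rewrite -ltnS.
  have -> : K' * K * x ^+ l = (K' * x ^+ i) * (K * x ^+ (l - i)).
    by rewrite mulrACA -exprD subnKC.
  apply: ler_pM; rewrite ?modulus_ge0 //; apply: le_trans (vK i).
  rewrite fpsB /trunc; case: ifP => _; last by rewrite subr0.
  by rewrite subrr modulus0 modulus_ge0.
have El' l : modulus (((v - trunc N v) * u) l) <= K' * K * M * y ^+ l.
  apply: le_trans (El l) _; rewrite -[leRHS]mulrA; apply: (ler_wpM2l KK0).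
  apply: le_trans (HM l); rewrite ler_wpM2r ?exprn_ge0 ?(ltW x0) //.
  by rewrite exprS ler_peMr // exprn_ege1 // ler1n.
split => [|n|l].
- by rewrite mulr_ge0 // (le_trans _ y11).
- apply: (@le_trans _ _ (\sum_(l < n) K' * K * M * y ^+ l)).
    by apply: ler_sum => l _; exact: El'.
  by rewrite -mulr_sumr ler_wpM2l // geo_sum_le.
have [lN|Nl] := leqP l N.
  by rewrite E0 // modulus0 mulr_ge0 ?w_div_ge0 // mulr_ge0 // (le_trans _ y11).
apply: (@le_trans _ _ (K' * K * M * (w l / L N))); last first.
  by rewrite ler_wpM2r ?w_div_ge0 // ler_peMr.
apply: le_trans (El l) _; rewrite -[leRHS]mulrA; apply: (ler_wpM2l KK0).
rewrite mulrA ler_pdivlMr ?wt_sum_gt0 // -ler_pdivrMr ?wt_gt0 //.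
have -> : (w l)^-1 = wt b l by rewrite /wt powRN invrK.
apply: (@le_trans _ _ (l.+1%:R * x ^+ l * l.+1%:R ^+ a.+1 * l.+1%:R ^+ a)).
  rewrite ler_pM ?wt_ge0 //.
  - by rewrite !mulr_ge0 ?exprn_ge0 ?ltW ?wt_sum_gt0 // ltW.
  - rewrite ler_wpM2l ?mulr_ge0 ?exprn_ge0 ?(ltW x0) //.
    apply: le_trans (wt_sum_homo b (ltnW Nl)) _; exact: wt_sum_le_expn.
  - exact: wt_le_expn.
apply: le_trans (_ : M * y ^+ l <= M); last by rewrite ler_piMr // exprn_ile1 // ltW.
apply: le_trans (HM l); rewrite le_eqVlt; apply/orP; left; apply/eqP.
by rewrite [_ ^+ (a + a.+1).+1]exprS exprD; ring.
Qed.

(** The linear factors carrying the zeros are inverted approximately by means of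
    the kernels, the zero-free factor by truncating its inverse. *)
Lemma one_variable_upper f : conv_beyond 1 f ->
  (forall z, modulus z < 1 -> ~ sums_to (at_pt f z) 0) ->
  exists B k, forall N, exists2 q, deg_le (k * N) q &
    forall n, \sum_(l < n) wt b l * modulus ((1 - q * f) l) ^+ 2 <= B / L N.
Proof.
move=> rf fz; have [r [cs [u [r1 ru fE cs1 uz]]]] := factor_zeros rf fz.
have [v uv rv] := zero_free_inverse ltr01 r1 ru uz.
have ru1 : conv_beyond 1 u.
  have [x [x0 xr xu]] := ru; exists x; split => //; apply: lt_trans xr.
  by rewrite ltr_pM2l.
have [B HB] := prod_lin_approx cs1.
have [B' HB'] := inverse_approx uv ru1 rv.
exists ((B + B' + conv_const * (B * B')) ^+ 2), (size cs).+1 => N.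
have [q [e [qN eB qE]]] := HB N; have eB' := HB' N.
set e' := 1 - trunc N v * u in eB'.
exists (trunc N v * q).
  by rewrite mulSn; apply: deg_leM => // l Nl; rewrite /trunc leqNgt Nl.
move=> n; have -> : 1 - trunc N v * q * f = e + e' - e * e'.
  rewrite fE (_ : trunc N v * q * _ = (\prod_(c <- cs) fps_lin c * q) *
    (trunc N v * u)); last by ring.
  by rewrite qE (_ : trunc N v * u = 1 - e') /e'; ring.
by apply: tame_energy; apply: tameD; [apply: tameD|apply: tameN; apply: tameM].
Qed.

(** The relation [f 0 * q l = (q f) l - \sum_(i < l) q i * f (l - i)] bounds the
    coefficients of [q] by induction, with constants independent of [q]. *)
Lemma quotient_coef_le f q A K h : 1 <= A -> 0 < h -> 0 < K ->
  h <= modulus (f 0%N) -> (forall l, modulus (f l) <= K * A ^+ l) ->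
  (forall l, modulus ((q * f) l) <= 2 * A ^+ l) ->
  forall l, modulus (q l) <= 4 / h * (A * (1 + 2 * K / h)) ^+ l.
Proof.
move=> A1 h0 K0 hf fK qfA; pose lam := 2 * K / h.
have lam0 : 0 < lam by rewrite !mulr_gt0 // invr_gt0.
have A0 : 0 < A by apply: lt_le_trans A1.
set G := A * _; have AG : A <= G by rewrite /G ler_peMr ?(ltW A0) // lerDl ltW.
have G0 : 0 < G by apply: lt_le_trans AG.
elim/ltn_ind => l IH.
have qE : q l * f 0%N = (q * f) l - \sum_(i < l) q i * f (l - i)%N.
  by rewrite fpsM big_ord_recr /= subnn addrAC subrr add0r.
have D0 : 0 <= 4 / h by rewrite divr_ge0 // ltW.
suff qfl : modulus (q l) * h <= 4 * G ^+ l.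
  by rewrite mulrAC ler_pdivlMr.
apply: (@le_trans _ _ (modulus (q l * f 0%N))).
  by rewrite modulusM ler_wpM2l ?modulus_ge0.
rewrite qE; apply: le_trans (ler_modulusB _ _) _.
rewrite (_ : 4 * G ^+ l = 2 * G ^+ l + 2 * G ^+ l); last by ring.
apply: lerD.
  apply: le_trans (qfA l) _; rewrite ler_wpM2l //.
  by rewrite lerXn2r ?nnegrE // ltW.
apply: le_trans (ler_modulus_sum _ _ _) _.
apply: (@le_trans _ _ (\sum_(i < l) 4 / h * K * A ^+ l * (1 + lam) ^+ i)).
  apply: ler_sum => i _; rewrite modulusM.
  apply: le_trans (ler_pM (modulus_ge0 _) (modulus_ge0 _) (IH i (ltn_ord i)) (fK _)) _.
  have -> : A ^+ l = A ^+ i * A ^+ (l - i) by rewrite -exprD subnKC // ltnW.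
  by rewrite exprMn -/lam le_eqVlt; apply/orP; left; apply/eqP; ring.
rewrite -mulr_sumr; have := subrX1 (1 + lam) l.
rewrite addrAC subrr add0r => E.
have lamn0 : lam != 0 by rewrite gt_eqF.
have -> : \sum_(i < l) (1 + lam) ^+ i = ((1 + lam) ^+ l - 1) / lam.
  by rewrite E mulrAC mulfV // mul1r.
have -> : 4 / h * K * A ^+ l * (((1 + lam) ^+ l - 1) / lam) =
    2 * A ^+ l * ((1 + lam) ^+ l - 1).
  by rewrite /lam; field; rewrite !gt_eqF.
rewrite -mulrA ler_wpM2l // /G exprMn ler_wpM2l ?exprn_ge0 ?(ltW A0) //.
by rewrite gerBl.
Qed.

(** At the zero [z] of [f] on the unit circle, [F = 1 - q f] takes the value [1].
    If [F] were a polynomial of degree comparable with [N], then the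
    Cauchy-Schwarz inequality would give [1 <= L N * T] up to a constant.  In
    general, when [T < 1] the coefficients of [q] are at most [D * G ^ l] for
    some constants [D] and [G]; since [deg q <= N] and [f] decays geometrically, the terms of [F]
    of degree above [k N], with [k] large, contribute at most [1 / 2]. *)
Lemma one_variable_lower f z : conv_beyond 1 f -> f 0%N != 0 ->
  modulus z = 1 -> sums_to (at_pt f z) 0 ->
  exists2 c, 0 < c & forall N q T, (1 <= N)%N -> deg_le N q ->
    (forall n, \sum_(l < n) wt b l * modulus ((1 - q * f) l) ^+ 2 <= T) ->
    c / L N <= T.
Proof.
move=> rf f0 z1 fz; have [x [x0]] := rf; rewrite mulr1 => x1 [K0 K00 fK0].
pose K := K0 + 1; have K_gt0 : 0 < K by rewrite ltr_wpDl.
have fK l : modulus (f l) <= K * x ^+ l.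
  apply: le_trans (fK0 l) _; rewrite ler_wpM2r ?exprn_ge0 ?(ltW x0) //.
  by rewrite lerDl.
pose h := modulus (f 0%N); have h0 : 0 < h by rewrite modulus_gt0.
have [a ba] := exists_nat_ge `|b|.
pose A : R := 2 ^+ a; have A1 : 1 <= A by rewrite exprn_ege1 // ler1n.
pose G := A * (1 + 2 * K / h); pose D := 4 / h.
have D0 : 0 < D by rewrite divr_gt0.
have DK0 : 0 <= D * K := mulr_ge0 (ltW D0) (ltW K_gt0).
have A0 : 0 < A by apply: lt_le_trans A1.
have G1 : 1 <= G.
  apply: le_trans A1 _; rewrite /G ler_peMr ?(ltW A0) // lerDl.
  by rewrite !mulr_ge0 ?(ltW K_gt0) // invr_ge0 ltW.
have G0 : 0 < G by apply: lt_le_trans G1.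
pose Y := 2 * G / x; have Y0 : 0 < Y by rewrite divr_gt0 // mulr_gt0.
pose M := D * K / (1 - x).
have M0 : 0 < M by rewrite divr_gt0 ?subr_gt0 // mulr_gt0.
have half0 : 0 < (2 : R)^-1 by rewrite invr_gt0.
have [k0 Hk0] := geo_lt_eps ((M + 1) * Y) (ltW x0) x1 half0.
pose k := k0.+1; have Hk : (M + 1) * Y * x ^+ k < 2^-1 by exact: Hk0.
have Yk0 : 0 <= Y * x ^+ k by rewrite mulr_ge0 ?exprn_ge0 ?ltW.
have Yk1 : Y * x ^+ k <= 1.
  have : (Y * x ^+ k) <= (M + 1) * Y * x ^+ k.
    by rewrite -mulrA ler_peMl // lerDr ltW.
  by move: Hk; lra.
have MYk : M * (Y * x ^+ k) <= 2^-1.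
  apply: le_trans (ltW Hk); rewrite -[leRHS]mulrA ler_wpM2r //.
  by rewrite lerDl.
have [Ck Ck0 HCk] := wt_sum_dilate b (isT : (0 < k)%N).
pose c := Num.min 1 (4 * Ck)^-1.
have c0 : 0 < c by rewrite lt_min ltr01 invr_gt0 mulr_gt0.
exists c => // N q T N1 qN HT.
have L0 := wt_sum_gt0 b N; have L1 := wt_sum_ge1 b N.
have [T1|T1] := leP 1 T.
  apply: le_trans T1; rewrite ler_pdivrMr // mul1r; apply: le_trans L1.
  by rewrite ge_min lexx.
set F := 1 - q * f in HT.
have FA l : modulus (F l) <= A ^+ l.
  have AX1 : 1 <= A ^+ l by exact: exprn_ege1.
  have F2 : modulus (F l) ^+ 2 <= A ^+ l.
    have : wt b l * modulus (F l) ^+ 2 <= 1.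
      apply: le_trans (ltW T1); apply: le_trans (HT l.+1).
      by rewrite big_ord_recr /= lerDr sumr_ge0 // => i _; rewrite mulr_ge0 ?wt_ge0 ?sqr_ge0.
    rewrite mulrC -ler_pdivlMr ?wt_gt0 // mul1r /wt -powRN => /le_trans; apply.
    apply: le_trans (@wt_le_expn _ (- b) a l _) _; first by rewrite normrN.
    rewrite /A exprAC lerXn2r ?nnegrE ?exprn_ge0 //.
    by rewrite -natrX ler_nat ltn_expl.
  rewrite -(@ler_pXn2r _ 2) ?nnegrE ?modulus_ge0 ?(le_trans _ AX1) //.
  by apply: le_trans F2 _; rewrite ler_eXnr.
have qfA l : modulus ((q * f) l) <= 2 * A ^+ l.
  have -> : (q * f) l = (1 : fps R) l - F l by rewrite /F fpsB opprB addrC subrK.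
  apply: le_trans (ler_modulusB _ _) _; rewrite mulr2n mulrDl mul1r lerD //.
  rewrite fps1; apply: le_trans (exprn_ege1 l A1).
  by case: (l == 0)%N; rewrite ?modulus1 ?modulus0.
have fKA l : modulus (f l) <= K * A ^+ l.
  apply: le_trans (fK l) _; rewrite ler_wpM2l ?(ltW K_gt0) //.
  by rewrite lerXn2r ?nnegrE ?(ltW x0) ?(ltW A0) // (le_trans (ltW x1)).
have qG := quotient_coef_le A1 h0 K_gt0 (lexx _) fKA qfA.
rewrite -/G -/D in qG.
have F_tail l : (N < l)%N -> modulus (F l) <= D * K * Y ^+ N * x ^+ l.
  move=> Nl; rewrite /F fpsB fps1 gtn_eqF ?(leq_ltn_trans _ Nl) // sub0r modulusN.
  rewrite fpsM; apply: le_trans (ler_modulus_sum _ _ _) _.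
  have -> : \sum_(i < l.+1) modulus (q i * f (l - i)%N) =
      \sum_(i < N.+1) modulus (q i * f (l - i)%N).
    rewrite -!(big_mkord xpredT (fun i => modulus (q i * f (l - i)%N))).
    rewrite (@big_cat_nat _ _ _ N.+1) //=; last by rewrite ltnW.
    rewrite [X in _ + X]big_nat_cond [X in _ + X]big1 ?addr0 // => i.
    by move=> /andP[/andP[Ni _] _]; rewrite qN // mul0r modulus0.
  apply: (@le_trans _ _ (\sum_(i < N.+1) D * K * G ^+ N * (x ^+ l / x ^+ N))).
    apply: ler_sum => i _; rewrite modulusM.
    have iN : (i <= N)%N by rewrite -ltnS.
    apply: le_trans (ler_pM (modulus_ge0 _) (modulus_ge0 _) (qG i) (fK _)) _.
    rewrite mulrACA -[leRHS]mulrA; apply: (ler_wpM2l DK0).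
    apply: ler_pM; rewrite ?exprn_ge0 ?(ltW x0) ?(ltW G0) //.
      by rewrite ler_weXn2l.
    rewrite ler_pdivlMr ?exprn_gt0 // -exprD ler_wiXn2l ?(ltW x0) ?(ltW x1) //.
    apply: leq_trans (leq_add (leqnn _) iN); rewrite subnK //.
    exact: ltnW (leq_ltn_trans iN Nl).
  have YE : Y ^+ N = 2 ^+ N * G ^+ N / x ^+ N.
    by rewrite /Y [(2 * G / x) ^+ N]exprMn [(2 * G) ^+ N]exprMn exprVn.
  rewrite sum_ord_const YE.
  rewrite [leRHS](_ : _ = 2 ^+ N * (D * K * G ^+ N * (x ^+ l / x ^+ N))); last by ring.
  rewrite ler_wpM2r //; last by rewrite -natrX ler_nat ltn_expl.
  by rewrite mulr_ge0 ?divr_ge0 ?(mulr_ge0 DK0) ?exprn_ge0 ?(ltW x0) ?(ltW G0).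
pose m := (k * N.+1)%N.
have Nm : (N < m)%N by rewrite /m mulSn leq_addr.
have Fz : sums_to (at_pt F z) 1.
  have zr : modulus z <= 1 by rewrite z1.
  have rq : conv_beyond 1 q := conv_beyond_deg qN ler01.
  have [s qs] := conv_beyond_sum zr rq.
  have := sums_toM zr ler01 rq rf qs fz; rewrite mulr0 => qf0.
  rewrite /F at_ptD at_ptN; have := sums_toB (@sums_to1 _ z) qf0.
  by rewrite subr0.
have tail : modulus (1 - \sum_(l < m) at_pt F z l) <= 2^-1.
  apply: sums_to_tail_le Fz _ => p.
  apply: le_trans (ler_modulus_sum _ _ _) _.
  apply: (@le_trans _ _ (\sum_(m <= l < p) D * K * Y ^+ N * x ^+ l)).
    rewrite !big_nat; apply: ler_sum => l /andP[ml _].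
    rewrite modulusM modulusX z1 expr1n mulr1; apply: F_tail.
    exact: leq_trans ml.
  rewrite -mulr_sumr; apply: (@le_trans _ _ (D * K * Y ^+ N * (x ^+ m / (1 - x)))).
    rewrite ler_wpM2l ?geo_tail_le ?(ltW x0) //.
    by rewrite (mulr_ge0 DK0) // exprn_ge0 // ltW.
  apply: le_trans MYk.
  rewrite [leLHS](_ : _ = M * (Y ^+ N * x ^+ m)); last by rewrite /M; ring.
  rewrite ler_wpM2l ?(ltW M0) //.
  apply: (@le_trans _ _ ((Y * x ^+ k) ^+ N)).
    rewrite [(Y * x ^+ k) ^+ N]exprMn -exprM ler_wpM2l ?exprn_ge0 ?(ltW Y0) //.
    by rewrite ler_wiXn2l ?(ltW x0) ?(ltW x1) // /m leq_mul2l leqnSn orbT.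
  by rewrite -[leRHS]expr1 ler_wiXn2l.
have low : 2^-1 <= \sum_(l < m) modulus (F l).
  have S1 : modulus (\sum_(l < m) at_pt F z l) <= \sum_(l < m) modulus (F l).
    apply: le_trans (ler_modulus_sum _ _ _) _; apply: ler_sum => l _.
    by rewrite modulusM modulusX z1 expr1n mulr1.
  have := ler_modulusD (1 - \sum_(l < m) at_pt F z l) (\sum_(l < m) at_pt F z l).
  by rewrite subrK modulus1; move: tail S1; lra.
pose Lm := \sum_(l < m) w l.
have Lm0 : 0 < Lm by apply: lt_le_trans (wt_sum_gt0 b N) (wt_sum_homo b _).
have LmL : Lm <= Ck * L N by exact: HCk.
(* Summing this inequality replaces the Cauchy-Schwarz inequality; the factor
   [Lm] balances the two sums. *)
have amgm l : modulus (F l) <=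
    w l / (4 * Lm) + Lm * (wt b l * modulus (F l) ^+ 2).
  have := sqr_ge0 (w l / (2 * Lm) - modulus (F l)).
  have wl : 0 < w l by exact: wt_gt0.
  have -> : wt b l = (w l)^-1 by rewrite /wt powRN invrK.
  move=> sq; rewrite -(ler_pM2r (divr_gt0 wl Lm0)) -subr_ge0.
  rewrite (_ : _ - _ = (w l / (2 * Lm) - modulus (F l)) ^+ 2) //.
  by field; rewrite !gt_eqF.
have : 2^-1 <= 4^-1 + Lm * T.
  apply: le_trans low _; apply: (@le_trans _ _ (\sum_(l < m)
      (w l / (4 * Lm) + Lm * (wt b l * modulus (F l) ^+ 2)))).
    by apply: ler_sum => l _; exact: amgm.
  rewrite big_split /= -mulr_suml -mulr_sumr lerD //.
    by rewrite -/Lm invfM mulrCA mulfV ?mulr1 // gt_eqF.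
  by rewrite ler_wpM2l ?HT // ltW.
move=> key; rewrite ler_pdivrMr //.
apply: (@le_trans _ _ (4 * Ck)^-1); first by rewrite ge_min lexx orbT.
rewrite -[leLHS]mul1r ler_pdivrMr ?mulr_gt0 //.
have T0 : 0 <= T.
  by have := HT 0%N; rewrite big_ord0.
have : Lm * T <= Ck * L N * T by rewrite ler_wpM2r.
by move: key; lra.
Qed.

End OneVariable.

(** * Stirling's approximation *)

Section LogBounds.
Context {R : realType}.
Implicit Types (x y t : R).

Lemma is_derive_ndecr_from1 (f df : R -> R) y : 1 <= y ->
  (forall x, 1 <= x -> is_derive x 1 f (df x)) ->
  (forall x, 1 <= x -> 0 <= df x) -> f 1 <= f y.
Proof.
move=> y1 fd d0; move: y1; rewrite le_eqVlt => /predU1P[<- //|y1].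
have [||c] := @MVT R f df 1 y y1.
- by move=> x; rewrite in_itv /= => /andP[/ltW x1 _]; exact: fd.
- apply: derivable_within_continuous => x; rewrite in_itv /= => /andP[x1 _].
  by apply: ex_derive; exact: fd.
rewrite in_itv /= => /andP[/ltW c1 _] E.
by rewrite -subr_ge0 E mulr_ge0 ?d0 // subr_ge0 ltW.
Qed.

(** The next two bounds for [ln] agree with it up to an error of third order at [1]:
    evaluated at [(l + 1) / l], they give the increments in Stirling's approximation up to a
    summable error. *)
Lemma ln_ge_pade y : 1 <= y -> 2 - 4 / (y + 1) <= ln y.
Proof.
move=> y1; pose f (x : R) := ln x + 4 * (x + 1)^-1.
have fd x : 1 <= x -> is_derive x 1 f (x^-1 + 4 * (- (x + 1) ^- 2)).
  move=> x1; have x0 : 0 < x by apply: lt_le_trans x1.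
  have x10 : x + 1 != 0 by rewrite gt_eqF // addr_gt0.
  have h1 := is_derive1_ln x0.
  have h2 : is_derive x 1 (fun x : R => (x + 1)^-1) (- (x + 1) ^- 2).
    have h3 : is_derive x 1 (fun x : R => x + 1) 1.
      have := is_deriveD (is_derive_id x (1 : R)) (is_derive_cst (1 : R) x 1).
      by move=> /is_derive_eq; apply; rewrite addr0.
    apply: (is_derive_eq (@is_deriveV R (fun x => x + 1) x 1 1 x10 h3)).
    exact: mulr1.
  exact: is_deriveD.
have := is_derive_ndecr_from1 y1 fd; rewrite /f ln1.
rewrite (_ : 4 * (1 + 1)^-1 = 2 :> R) ?add0r; last by field.
move=> H; rewrite lerBlDr; apply: H => x x1.
have x0 : 0 < x by apply: lt_le_trans x1.
rewrite (_ : _ + _ = (x - 1) ^+ 2 / (x * (x + 1) ^+ 2)).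
  by rewrite divr_ge0 ?sqr_ge0 // mulr_ge0 ?sqr_ge0 ?ltW.
by field; rewrite !gt_eqF // addr_gt0.
Qed.

Lemma ln_le_trapezoid y : 1 <= y -> ln y <= (y - y^-1) / 2.
Proof.
move=> y1; pose f (x : R) := 2^-1 * (x - x^-1) - ln x.
have fd x : 1 <= x -> is_derive x 1 f (2^-1 * (1 - (- x ^- 2)) - x^-1).
  move=> x1; have x0 : 0 < x by apply: lt_le_trans x1.
  have xn0 : x != 0 by rewrite gt_eqF.
  have h1 := is_derive1_ln x0.
  have h2 : is_derive x 1 (fun x : R => x^-1) (- x ^- 2).
    apply: (is_derive_eq (@is_deriveV R id x 1 1 xn0 (is_derive_id x 1))).
    exact: mulr1.
  exact: is_deriveB.
have := is_derive_ndecr_from1 y1 fd; rewrite /f ln1 invr1 subrr mulr0 subrr.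
move=> H; rewrite mulrC -subr_ge0; apply: H => x x1.
have x0 : 0 < x by apply: lt_le_trans x1.
rewrite (_ : _ - _ = (1 - x^-1) ^+ 2 / 2).
  by rewrite divr_ge0 ?sqr_ge0.
by field; rewrite gt_eqF.
Qed.

(** Up to a bounded error, [ln l`!]; the last term is [ln l.+1] and not [ln l] in
    order to cover [l = 0]. *)
Definition stirling l : R := l%:R * ln l%:R - l%:R + ln l.+1%:R / 2.

(** The sequence [a l] below decreases by the lower bound for [ln], whereas
    [a l - 1 / (4 (l + 1))] increases by the upper bound. *)
Lemma ln_fact_stirling : exists C : R, forall l, `|ln l`!%:R - stirling l| <= C.
Proof.
pose a l : R := ln l.+1`!%:R + l.+1%:R - (l.+1%:R + 2^-1) * ln l.+1%:R.
have aS l : a l.+1 = a l + 1 - (l.+1%:R + 2^-1) * ln (l.+2%:R / l.+1%:R).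
  rewrite /a factS natrM lnM ?posrE ?ltr0n ?fact_gt0 //.
  rewrite ln_div ?posrE ?ltr0n // -[l.+2%:R]natr1.
  by ring.
have a_bnd l : 3 / 4 + (4 * l.+1%:R)^-1 <= a l <= 1.
  elim: l => [|l /andP[IH1 IH2]].
    have -> : a 0%N = 1 by rewrite /a factS fact0 ln1 mulr0 subr0 add0r.
    by rewrite lexx andbT; lra.
  have l0 : 0 < l.+1%:R :> R by rewrite ltr0n.
  set y : R := l.+2%:R / l.+1%:R.
  have y1 : 1 <= y by rewrite ler_pdivlMr // mul1r ler_nat.
  have yE : y = (l.+1%:R + 1) / l.+1%:R by rewrite natr1.
  have lo := ln_ge_pade y1; have up := ln_le_trapezoid y1.
  have h0 : 0 <= l.+1%:R + 2^-1 :> R by rewrite addr_ge0.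
  rewrite aS; apply/andP; split; last first.
    have := ler_wpM2l h0 lo.
    have -> : (l.+1%:R + 2^-1) * (2 - 4 / (y + 1)) = 1.
      rewrite yE; field; rewrite !gt_eqF //; lra.
    by move: IH2; lra.
  have := ler_wpM2l h0 up.
  have -> : (l.+1%:R + 2^-1) * ((y - y^-1) / 2) =
      1 + (4 * l.+1%:R)^-1 - (4 * (l.+1%:R + 1))^-1.
    by rewrite yE; field; rewrite !gt_eqF //; lra.
  rewrite -/y natr1; move: (4 * _)^-1 (4 * _)^-1 (_ * ln y) IH1 => p q t IH1.
  by move: IH1; lra.
exists 2 => -[|l].
  rewrite (_ : _ - _ = 0) ?normr0 // /stirling fact0 ln1; ring.
have ln2 : `|ln l.+2%:R - ln l.+1%:R| <= 1 :> R.
  rewrite -ln_div ?posrE ?ltr0n // ger0_norm; last first.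
    by rewrite ln_ge0 // ler_pdivlMr ?ltr0n // mul1r ler_nat.
  rewrite -natr1 mulrDl mulfV ?pnatr_eq0 // mul1r.
  apply: le_trans (le_ln1Dx _) _; first by rewrite (lt_trans (ltrN10 R)) // invr_gt0 ltr0n.
  by rewrite invf_le1 ?ltr0n // ler1n.
have /andP[a1 a2] := a_bnd l.
have a0 : 0 <= (4 * l.+1%:R)^-1 :> R by rewrite invr_ge0 mulr_ge0.
rewrite (_ : _ - _ = a l - (ln l.+2%:R - ln l.+1%:R) / 2); last first.
  by rewrite /a /stirling; field.
have {a0 a1}a1 : 3 / 4 <= a l by apply: le_trans a1; rewrite lerDl.
move: ln2; rewrite ler_norml; move: (ln _ - ln _) => t /andP[n1 n2].
by rewrite ler_norml; apply/andP; split; lra.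
Qed.

Lemma ln_nat_comparable (p : nat -> nat) K : (forall l, (l < p l)%N) ->
  (forall l, (p l <= K * l.+1)%N) -> (0 < K)%N ->
  forall l, 0 <= ln ((p l)%:R : R) - ln l.+1%:R <= ln K%:R.
Proof.
move=> p1 pK K0 l; have pl : (0 < p l)%N by apply: leq_trans (p1 l).
rewrite subr_ge0 ler_ln ?posrE ?ltr0n // ler_nat p1 /=.
rewrite lerBlDr -lnM ?posrE ?ltr0n // ler_ln ?posrE ?mulr_gt0 ?ltr0n //.
by rewrite -natrM ler_nat.
Qed.

Lemma ln_fact_mul (M : nat) : (0 < M)%N -> exists C : R, forall l,
  `|ln (l * M)`!%:R - (l%:R * M%:R * (ln l%:R + ln M%:R - 1) + ln l.+1%:R / 2)|
    <= C.
Proof.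
move=> M0; have [C HC] := ln_fact_stirling.
exists (C + ln M.+1%:R) => l.
have l1 : 0 <= ln ((l * M).+1%:R : R) - ln l.+1%:R <= ln M.+1%:R.
  apply: (ln_nat_comparable (p := fun l => (l * M).+1)) => // k.
    by rewrite ltnS leq_pmulr.
  by rewrite mulSn mulnS; nia.
have -> : ln (l * M)`!%:R -
    (l%:R * M%:R * (ln l%:R + ln M%:R - 1) + ln l.+1%:R / 2) =
    (ln (l * M)`!%:R - stirling (l * M)) +
    (ln (l * M).+1%:R - ln l.+1%:R) / 2 :> R.
  rewrite /stirling; case: l {l1} => [|l].
    by rewrite mul0n !mul0r; ring.
  by rewrite natrM lnM ?posrE ?ltr0n //; ring.
apply: le_trans (ler_normD _ _) _; apply: lerD (HC _) _.
by rewrite ger0_norm; move/andP: l1 => [h1 h2]; lra.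
Qed.

End LogBounds.

(** * Growth of the partial sums of the weights *)

Section PhiAsymptotics.
Context {R : realType}.
Implicit Types (b u g : R).

Lemma bernoulli_nat u a : 0 <= u -> u <= 1 -> 1 - a%:R * u <= (1 - u) ^+ a.
Proof.
move=> u0 u1; elim: a => [|a IH]; first by rewrite mul0r subr0.
rewrite exprS -natr1; apply: le_trans (ler_wpM2l _ IH); last by rewrite subr_ge0.
rewrite (_ : (1 - u) * _ = 1 - (a%:R + 1) * u + a%:R * u ^+ 2); last by ring.
by rewrite lerDl mulr_ge0 ?sqr_ge0.
Qed.

(** With [u = 1 / (l + 1)] and [g = 1 - b], the increments of [l ^ (1 - b)] are
    comparable with [(l + 1) ^ (- b)]; see [wt_sum_powR]. *)
Lemma powR_increment g : 0 < g -> exists c C, [/\ 0 < c, 0 < C &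
  forall u, 0 <= u -> u <= 1 -> c * u <= 1 - (1 - u) `^ g <= C * u].
Proof.
move=> g0; have [a ga] := exists_nat_ge g.
exists (Num.min 1 (g / 2)), (1 + a%:R); split.
- by rewrite lt_min ltr01 divr_gt0.
- by rewrite ltr_wpDr.
move=> u u0; have c1 : Num.min 1 (g / 2) <= 1 by rewrite ge_min lexx.
have cg : Num.min 1 (g / 2) <= g / 2 by rewrite ge_min lexx orbT.
have a0 : 0 <= a%:R :> R by [].
rewrite le_eqVlt => /predU1P[->|u1].
  by rewrite subrr powR0 ?gt_eqF // subr0 !mulr1 c1 lerDl.
have u10 : 0 < 1 - u <= 1 by rewrite subr_gt0 u1 gerBl.
have [g1|g1] := leP 1 g.
  have lo := ge1r_powR u10 g1; have := ger_powR u10 ga.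
  rewrite powR_mulrn; last by case/andP: u10 => /ltW.
  have := bernoulli_nat a u0 (ltW u1); have := ler_wpM2r u0 c1.
  by move=> h1 h2 h3; apply/andP; split; lra.
have up := ger1_powR u10 (ltW g1).
apply/andP; split; last by have := mulr_ge0 a0 u0; lra.
have h1 := ler_wpM2r u0 cg.
have gu0 : 0 <= g * u by rewrite mulr_ge0 // ltW.
have gu1 : g * u <= 1.
  by apply: le_trans (ltW g1); rewrite ler_piMr ?(ltW g0) ?(ltW u1).
suff : (1 - u) `^ g <= 1 - g * u / 2 by lra.
have /andP[u1' _] := u10.
rewrite /powR gt_eqF //.
apply: (@le_trans _ _ (expR (- (g * u)))).
  rewrite ler_expR -mulrN ler_wpM2l ?(ltW g0) //.
  by apply: le_ln1Dx; rewrite ltrN2.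
rewrite expRN; apply: (@le_trans _ _ (1 + g * u)^-1).
  by rewrite lef_pV2 ?posrE ?expR_gt0 ?expR_ge1Dx // ltr_wpDr.
rewrite -[leLHS]mul1r ler_pdivrMr; last by rewrite ltr_wpDr.
rewrite [leRHS](_ : _ = 1 + g * u / 2 * (1 - g * u)); last by field.
by rewrite lerDl mulr_ge0 ?divr_ge0 // subr_ge0.
Qed.

Lemma telescope_from0 (F : nat -> R) n :
  \sum_(l < n) (F l.+1 - F l) = F n - F 0%N.
Proof. by rewrite -(big_mkord xpredT (fun l => F l.+1 - F l)) telescope_sumr. Qed.

Lemma wt_sum_powR b : b < 1 -> exists c C, [/\ 0 < c, 0 < C &
  forall N, c * (N%:R + 1) `^ (1 - b) <= wt_sum b N <= C * (N%:R + 1) `^ (1 - b)].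
Proof.
move=> b1; have g0 : 0 < 1 - b by rewrite subr_gt0.
have [c [C [c0 C0 H]]] := powR_increment g0.
exists C^-1, c^-1; split; rewrite ?invr_gt0 // => N.
pose F l : R := l%:R `^ (1 - b).
have FN : (N%:R + 1) `^ (1 - b) = \sum_(l < N.+1) (F l.+1 - F l).
  by rewrite telescope_from0 /F powR0 ?gt_eqF // subr0 natr1.
have step l : c * wt (- b) l <= F l.+1 - F l <= C * wt (- b) l.
  have l0 : 0 < l.+1%:R :> R by rewrite ltr0n.
  have u0 : 0 <= l.+1%:R^-1 :> R by rewrite invr_ge0.
  have u1 : l.+1%:R^-1 <= 1 :> R by rewrite invf_le1 // ler1n.
  have lE : l%:R = l.+1%:R * (1 - l.+1%:R^-1) :> R.
    by rewrite mulrBr mulr1 mulfV ?gt_eqF // -natr1 addrK.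
  have -> : F l.+1 - F l = l.+1%:R `^ (1 - b) * (1 - (1 - l.+1%:R^-1) `^ (1 - b)).
    by rewrite mulrBr mulr1 /F [in l%:R `^ _]lE powRM ?subr_ge0 // ltW.
  have -> : wt (- b) l = l.+1%:R `^ (1 - b) * l.+1%:R^-1.
    rewrite /wt -powR_inv1 ?ltW // -powRD; last by apply/implyP => _; rewrite gt_eqF.
    by congr (_ `^ _); ring.
  have p0 : 0 <= l.+1%:R `^ (1 - b) :> R by exact: powR_ge0.
  have /andP[h1 h2] := H _ u0 u1.
  by rewrite !(mulrCA _ (l.+1%:R `^ _)) !ler_wpM2l.
rewrite FN /wt_sum ler_pdivrMl // ler_pdivlMl // !mulr_sumr.
by apply/andP; split; apply: ler_sum => l _; have /andP[] := step l.
Qed.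

Lemma wt_sum_harmonic N : (1 <= N)%N ->
  ln (N%:R + 1) <= wt_sum (1 : R) N <= ((ln 2)^-1 + 1) * ln (N%:R + 1).
Proof.
move=> N1; have wE l : wt (- 1) l = l.+1%:R^-1 :> R by rewrite /wt powR_inv1.
have ln20 : 0 < ln 2 :> R by rewrite ln_gt0 // ltr1n.
apply/andP; split.
  rewrite natr1 /wt_sum.
  have -> : ln N.+1%:R = \sum_(l < N) (ln l.+2%:R - ln l.+1%:R) :> R.
    by rewrite (telescope_from0 (fun l => ln l.+1%:R)) ln1 subr0.
  rewrite big_ord_recr /=; apply: le_trans (_ : _ <= \sum_(l < N) wt (- 1) l) _.
    apply: ler_sum => l _; rewrite wE -ln_div ?posrE ?ltr0n //.
    rewrite -[l.+2%:R]natr1 mulrDl mulfV ?pnatr_eq0 // mul1r.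
    by apply: le_ln1Dx; rewrite (lt_trans (ltrN10 R)) // invr_gt0 ltr0n.
  by rewrite lerDl wt_ge0.
rewrite mulrDl mul1r /wt_sum big_ord_recl /=; apply: lerD.
  rewrite /wt powR1 ler_pdivlMl // mulr1 ler_ln ?posrE ?ltr_wpDl //.
  by rewrite natr1 ler_nat ltnS.
have -> : ln (N%:R + 1) = \sum_(l < N) (ln l.+2%:R - ln l.+1%:R) :> R.
  by rewrite (telescope_from0 (fun l => ln l.+1%:R)) ln1 subr0 natr1.
apply: ler_sum => l _; rewrite wE /bump /= add1n.
rewrite -[_ - _]opprB lerNr -ln_div ?posrE ?ltr0n //.
rewrite (_ : l.+1%:R / l.+2%:R = 1 + - l.+2%:R^-1 :> R); last first.
  by rewrite -[l.+2%:R]natr1; field; rewrite gt_eqF // ltr_wpDl.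
apply: le_ln1Dx; rewrite ltrN2 invf_lt1 ?ltr0n //.
by rewrite ltr1n.
Qed.

Lemma wt_sum_phi b : b <= 1 -> exists c C, [/\ 0 < c, 0 < C &
  forall N, (1 <= N)%N -> [/\ 0 < phi b (N%:R + 1),
    c * phi b (N%:R + 1) <= wt_sum b N & wt_sum b N <= C * phi b (N%:R + 1)]].
Proof.
rewrite /phi le_eqVlt => /predU1P[->|b1]; last first.
  have [c [C [c0 C0 H]]] := wt_sum_powR b1.
  exists c, C; split => // N N1; rewrite b1; have /andP[h1 h2] := H N.
  by split => //; rewrite powR_gt0 // ltr_wpDl.
exists 1, ((ln 2)^-1 + 1); split => //.
  by rewrite ltr_wpDl // invr_ge0 ln_ge0 // ler1n.
move=> N N1; rewrite ltxx; have lnN : 0 < ln (N%:R + 1 : R).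
  by rewrite ln_gt0 // natr1 ltr1n ltnS.
rewrite max_l ?(ltW lnN) // mul1r.
by have /andP[] := wt_sum_harmonic N1.
Qed.

End PhiAsymptotics.

(** * Unconditional sums *)

Section Convergence.
Context {R : realType}.
Local Notation C := (cfield R).

Lemma cfield_gt0 (e : C) : 0 < e -> exists2 d : R, 0 < d & e = (d%:C)%C.
Proof.
case: e => a b; rewrite ltcE /= => /andP[/eqP -> a0].
by exists a.
Qed.

Lemma cvg_modulus (T : Type) (F : set_system T) (FF : Filter F) (f : T -> C) s :
  f @ F --> s <->
  (forall e : R, 0 < e -> \forall t \near F, modulus (f t - s) < e).
Proof.
split=> [/cvgrPdist_lt H e e0|H].
  have ec : 0 < ((e%:C)%C : C) by rewrite ltcR.
  by apply: filterS (H _ ec) => t; rewrite normE ltcR modulus_distC.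
apply/cvgrPdist_lt => e /cfield_gt0[d d0 ->].
by apply: filterS (H d d0) => t; rewrite normE ltcR modulus_distC.
Qed.

Lemma cvg_sums_to (v : nat -> C) s : series v @ \oo --> s <-> sums_to v s.
Proof.
rewrite cvg_modulus; split=> H e e0.
  have [n _ Hn] := H e e0; exists n => k nk; have := Hn k nk.
  by rewrite /series /= big_mkord.
have [n Hn] := H e e0; exists n => // k nk; have := Hn k nk.
by rewrite /series /= big_mkord.
Qed.

(** Unconditional summation, along finite sets ordered by inclusion. *)
Definition msums (I : choiceType) (F : I -> C) s := forall e : R, 0 < e ->
  exists A0 : {fset I}, forall A : {fset I}, fsubset A0 A ->
    modulus (\sum_(k <- A) F k - s) < e.

Lemma cvg_msums (I : choiceType) (F : I -> C) s :
  partial_sum F @ totally --> s <-> msums F s.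
Proof.
have E (A : {fset I}) : partial_sum F A = \sum_(k <- A) F k.
  by rewrite /partial_sum [RHS]big_seq_fsetE.
have FF : Filter (@totally I) by case: (@totally_filter I).
rewrite cvg_modulus; split=> H e e0.
  have [A0 _ HA] := H e e0; exists A0 => A A0A; have := HA A A0A.
  by rewrite /= E.
have [A0 HA] := H e e0; exists A0 => // A A0A; have := HA A A0A.
by rewrite /= E.
Qed.

Lemma msums_bounded (I : choiceType) (F : I -> C) s : msums F s ->
  exists2 B : R, 0 <= B & forall k, modulus (F k) <= B.
Proof.
move=> /(_ 1 ltr01)[A0 HA].
exists (\sum_(k <- A0) modulus (F k) + 2).
  by rewrite addr_ge0 // sumr_ge0 // => k _; exact: modulus_ge0.
move=> k; have [kA|kA] := boolP (k \in A0).
  rewrite (big_fsetD1 k) //= -addrA lerDl addr_ge0 // sumr_ge0 // => i _.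
  exact: modulus_ge0.
have h0 := HA A0 (fsubset_refl A0).
have h1 : modulus (\sum_(i <- fsetU [fset k]%fset A0) F i - s) < 1.
  by apply: HA; rewrite fsubsetU // fsubset_refl orbT.
rewrite big_fsetU1 //= in h1.
have -> : F k = (F k + \sum_(i <- A0) F i - s) - (\sum_(i <- A0) F i - s).
  by ring.
apply: le_trans (ler_modulusB _ _) _.
have : 0 <= \sum_(i <- A0) modulus (F i).
  by rewrite sumr_ge0 // => i _; exact: modulus_ge0.
by move: h0 h1; lra.
Qed.

Lemma msumsD (I : choiceType) (F G : I -> C) s t :
  msums F s -> msums G t -> msums (fun k => F k + G k) (s + t).
Proof.
move=> Fs Gt e e0; have e20 : 0 < e / 2 by rewrite divr_gt0.
have [A HA] := Fs _ e20; have [B HB] := Gt _ e20.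
exists (fsetU A B) => D; rewrite fsubUset => /andP[AD BD].
rewrite big_split /= opprD addrACA [ltRHS]splitr.
exact: le_lt_trans (ler_modulusD _ _) (ltrD (HA _ AD) (HB _ BD)).
Qed.

Lemma msumsZ (I : choiceType) (F : I -> C) s c :
  msums F s -> msums (fun k => c * F k) (c * s).
Proof.
move=> Fs e e0; have [->|c0] := eqVneq c 0.
  exists fset0 => A _; rewrite big1 => [|k _]; last by rewrite mul0r.
  by rewrite mul0r subrr modulus0.
have cm : 0 < modulus c by rewrite modulus_gt0.
have [A HA] := Fs _ (divr_gt0 e0 cm); exists A => B /HA.
by rewrite -mulr_sumr -mulrBr modulusM ltr_pdivlMr // mulrC.
Qed.

Lemma msums0 (I : choiceType) : msums (fun _ : I => 0 : C) 0.
Proof.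
by move=> e e0; exists fset0 => A _; rewrite big1 // subrr modulus0.
Qed.

Lemma eq_msums (I : choiceType) (F G : I -> C) s :
  F =1 G -> msums F s -> msums G s.
Proof. by move=> /funext ->. Qed.

Lemma msums_single (I : choiceType) (k0 : I) (F : I -> C) :
  (forall k, k != k0 -> F k = 0) -> msums F (F k0).
Proof.
move=> F0 e e0; exists [fset k0]%fset => A; rewrite fsub1set => kA.
rewrite (big_fsetD1 k0) //= big_seq_cond big1 ?addr0 ?subrr ?modulus0 //.
by move=> k; rewrite in_fsetD1 andbT => /andP[kk _]; exact: F0.
Qed.

(** The inverse image of a large finite set is large, and the terms outside the
    image of [h] vanish. *)
Lemma msums_image (I J : choiceType) (h : I -> J) (F : I -> C) (G : J -> C) s :
  injective h -> (forall i, G (h i) = F i) ->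
  (forall j, (forall i, j <> h i) -> G j = 0) -> msums F s -> msums G s.
Proof.
move=> h_inj GF G0 Fs e e0; have [A HA] := Fs e e0.
exists [fset h i | i in A]%fset => B AB.
have hB : forall j, j \in B -> G j != 0 -> exists i, j = h i.
  move=> j _ Gj; apply: contrapT => H; move/eqP: Gj; apply.
  by apply: G0 => i ji; apply: H; exists i.
pose inv j : option I := if pselect (exists i, j = h i) is left H
  then Some (projT1 (cid H)) else None.
have invh i : inv (h i) = Some i.
  rewrite /inv; case: pselect => [H|[]]; last by exists i.
  by congr Some; apply: h_inj; rewrite -(projT2 (cid H)).
have invP j i : inv j = Some i -> j = h i.
  by rewrite /inv; case: pselect => // H [<-]; exact: (projT2 (cid H)).
pose D := [fset i | i in pmap inv B]%fset.
have DP i : (i \in D) = (h i \in B).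
  apply/imfsetP/idP => [[i' /= + ->]|hiB].
    by rewrite mem_pmap => /mapP[j jB] /esym/invP <-.
  by exists i => //=; rewrite mem_pmap; apply/mapP; exists (h i).
have -> : \sum_(j <- B) G j = \sum_(i <- D) F i.
  rewrite (bigID (fun j => inv j != None)) /= [X in _ + X]big1 ?addr0; last first.
    move=> j; rewrite negbK => /eqP jN; apply: G0 => i ji.
    by rewrite ji invh in jN.
  under [RHS]eq_bigr do rewrite -GF.
  rewrite -big_filter -(big_map h xpredT G); apply: perm_big.
  apply: uniq_perm; first by rewrite filter_uniq ?fset_uniq.
    by rewrite map_inj_uniq ?fset_uniq.
  move=> j; rewrite mem_filter; apply/andP/mapP => [[]|[i iD ->]].
    case E : (inv j) => [i|] // _ jB; have ji := invP _ _ E.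
    by exists i => //; rewrite DP -ji.
  by rewrite invh -DP.
apply: HA; apply/fsubsetP => i iA; rewrite DP; apply: (fsubsetP AB).
by apply/imfsetP; exists i.
Qed.

End Convergence.

(** * Power series expansions on the ball *)

Section Expansions.
Context {R : realType} {n : nat}.
Local Notation C := (cfield R).
Local Notation MI := {ffun 'I_n -> nat}.
Implicit Types (f g : 'rV[C]_n -> C) (a b : MI -> C) (k : MI) (z : 'rV[C]_n).

Lemma expansion_ballP f a : expansion_ball f a <->
  (forall z, unit_ball z -> msums (fun k => a k * monomial k z) (f z)).
Proof. by split=> H z zB; apply/cvg_msums; exact: H. Qed.

Lemma eq_expansion_ball f g a : (forall z, unit_ball z -> f z = g z) ->
  expansion_ball f a -> expansion_ball g a.
Proof.
move=> fg /expansion_ballP H; apply/expansion_ballP => z zB; rewrite -fg //.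
exact: H.
Qed.

Lemma expansion_ballD f g a b : expansion_ball f a -> expansion_ball g b ->
  expansion_ball (fun z => f z + g z) (fun k => a k + b k).
Proof.
move=> /expansion_ballP fa /expansion_ballP gb; apply/expansion_ballP => z zB.
by apply: eq_msums (msumsD (fa z zB) (gb z zB)) => k; rewrite mulrDl.
Qed.

Lemma expansion_ballZ c f a : expansion_ball f a ->
  expansion_ball (fun z => c * f z) (fun k => c * a k).
Proof.
move=> /expansion_ballP fa; apply/expansion_ballP => z zB.
by apply: eq_msums (msumsZ c (fa z zB)) => k; rewrite mulrA.
Qed.

Lemma expansion_ball0 : expansion_ball (fun _ : 'rV[C]_n => 0) (fun=> 0).
Proof.
apply/expansion_ballP => z zB.
by apply: eq_msums (msums0 _) => k; rewrite mul0r.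
Qed.

Lemma expansion_ball_sum (J : Type) (r : seq J) (f : J -> 'rV[C]_n -> C)
    (a : J -> MI -> C) : (forall j, expansion_ball (f j) (a j)) ->
  expansion_ball (fun z => \sum_(j <- r) f j z) (fun k => \sum_(j <- r) a j k).
Proof.
move=> fa; elim: r => [|j r IH].
  rewrite (_ : (fun k => _) = fun=> 0); last first.
    by apply: funext => k; rewrite big_nil.
  by apply: eq_expansion_ball expansion_ball0 => z _; rewrite big_nil.
rewrite (_ : (fun k => _) = fun k => a j k + \sum_(j <- r) a j k); last first.
  by apply: funext => k; rewrite big_cons.
apply: eq_expansion_ball (expansion_ballD (fa j) IH) => z _.
by rewrite big_cons.
Qed.

Definition madd k0 k : MI := [ffun i => (k0 i + k i)%N].
Definition msub k k0 : MI := [ffun i => (k i - k0 i)%N].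
Definition mle k0 k : bool := [forall i, (k0 i <= k i)%N].
Definition mzero : MI := [ffun=> 0%N].

Lemma maddK k0 k : msub (madd k0 k) k0 = k.
Proof. by apply/ffunP => i; rewrite !ffunE addKn. Qed.

Lemma msubK k0 k : mle k0 k -> madd k0 (msub k k0) = k.
Proof. by move=> /forallP le; apply/ffunP => i; rewrite !ffunE subnKC. Qed.

Lemma mle_madd k0 k : mle k0 (madd k0 k).
Proof. by apply/forallP => i; rewrite ffunE leq_addr. Qed.

Lemma madd_inj k0 : injective (madd k0).
Proof. by move=> k k' E; rewrite -(maddK k0 k) E maddK. Qed.

Lemma monomialD k0 k z : monomial (madd k0 k) z = monomial k0 z * monomial k z.
Proof.
by rewrite /monomial -big_split /=; apply: eq_bigr => i _; rewrite ffunE exprD.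
Qed.

Lemma monomial0 z : monomial mzero z = 1.
Proof. by rewrite /monomial big1 // => i _; rewrite ffunE expr0. Qed.

Definition mshift k0 a : MI -> C := fun k => if mle k0 k then a (msub k k0) else 0.

Lemma expansion_ball_monomial k0 f a : expansion_ball f a ->
  expansion_ball (fun z => monomial k0 z * f z) (mshift k0 a).
Proof.
move=> /expansion_ballP fa; apply/expansion_ballP => z zB.
apply: (msums_image (@madd_inj k0)) (msumsZ (monomial k0 z) (fa z zB)).
  by move=> k; rewrite /mshift mle_madd maddK monomialD mulrCA.
move=> k kN; rewrite /mshift; case: ifP => [le|]; last by rewrite mul0r.
by case: (kN (msub k k0)); rewrite msubK.
Qed.

Definition mone : MI -> C := fun k => (k == mzero)%:R.

Lemma expansion_ball1 : expansion_ball (fun _ : 'rV[C]_n => 1) mone.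
Proof.
apply/expansion_ballP => z zB.
have := @msums_single R _ mzero (fun k => mone k * monomial k z).
rewrite monomial0 /mone eqxx mulr1; apply => k /negPf ->.
by rewrite mul0r.
Qed.

End Expansions.

(** * Uniqueness of the expansion on the ball *)

Section Uniqueness.
Context {R : realType} {n : nat}.
Local Notation C := (cfield R).
Local Notation MI := {ffun 'I_n -> nat}.
Implicit Types (f g : 'rV[C]_n -> C) (a b c : MI -> C) (k : MI) (z : 'rV[C]_n).

Lemma ler_sum_subset (I : eqType) (s1 s2 : seq I) (F : I -> R) :
  uniq s1 -> uniq s2 -> {subset s1 <= s2} -> (forall i, 0 <= F i) ->
  \sum_(i <- s1) F i <= \sum_(i <- s2) F i.
Proof.
move=> u1 u2 s12 F0; rewrite [leRHS](bigID (mem s1)) /=.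
rewrite -[X in _ <= X + _]big_filter.
rewrite [X in _ <= X + _](perm_big s1) /=; first by rewrite lerDl sumr_ge0.
apply: uniq_perm => //; first exact: filter_uniq.
move=> i; rewrite mem_filter /=; case is1 : (i \in s1) => //=.
by rewrite s12.
Qed.

Definition box N (x : {ffun 'I_n -> 'I_N}) : MI := [ffun i => x i : nat].

Lemma box_inj N : injective (@box N).
Proof.
move=> x y /ffunP E; apply/ffunP => i; apply: val_inj.
by have := E i; rewrite !ffunE.
Qed.

Lemma box_image N k : (forall i, k i < N)%N -> exists x, k = box (N := N) x.
Proof.
move=> kN; exists [ffun i => Ordinal (kN i)].
by apply/ffunP => i; rewrite !ffunE.
Qed.

Lemma sum_geo_multi_index (A : {fset MI}) :
  \sum_(k <- A) 2^-1 ^+ mdeg k <= (2 : R) ^+ n.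
Proof.
have [N HN] : exists N, forall k, k \in A -> forall i, (k i < N)%N.
  exists (\max_(k <- A) \max_i k i).+1 => k kA i.
  rewrite ltnS; apply: leq_trans (leq_bigmax i) _.
  by apply: (@leq_bigmax_seq _ _ xpredT (fun k : MI => \max_i k i)).
pose s := [seq box x | x <- enum {ffun 'I_n -> 'I_N}].
have us : uniq s by rewrite map_inj_uniq ?enum_uniq //; exact: box_inj.
apply: (@le_trans _ _ (\sum_(k <- s) 2^-1 ^+ mdeg k)).
  apply: (ler_sum_subset (fset_uniq A) us) => [k|k]; last first.
    by rewrite exprn_ge0 // invr_ge0.
  move=> /HN /box_image [x ->]; apply/mapP; exists x => //.
  by rewrite mem_enum.
rewrite big_map big_enum /=.
rewrite (eq_bigr (fun x : {ffun 'I_n -> 'I_N} =>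
    \prod_(i : 'I_n) (2^-1 : R) ^+ (x i : nat))); last first.
  by move=> x _; rewrite prodrXr /mdeg; congr (_ ^+ _);
    apply: eq_bigr => i _; rewrite ffunE.
rewrite -(bigA_distr_bigA (fun (_ : 'I_n) (j : 'I_N) => (2^-1 : R) ^+ (j : nat))).
rewrite prodr_const card_ord lerXn2r ?nnegrE //.
  by rewrite sumr_ge0 // => i _; rewrite exprn_ge0 // invr_ge0.
have h2 : 2^-1 < 1 :> R by lra.
apply: le_trans (geo_sum_le N _ h2) _; first by rewrite invr_ge0.
by rewrite (_ : (1 - 2^-1)^-1 = 2 :> R) //; field.
Qed.

Lemma digits_inj B p (u v : 'I_p -> nat) :
  (forall i, u i < B)%N -> (forall i, v i < B)%N ->
  (\sum_(i < p) u i * B ^ i = \sum_(i < p) v i * B ^ i)%N -> u =1 v.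
Proof.
elim: p u v => [u v _ _ _ []//|p IH] u v uB vB.
rewrite !big_ord_recl /= !expn0 !muln1.
have E (w : 'I_p.+1 -> nat) :
    (\sum_(i < p) w (lift ord0 i) * B ^ bump 0 i =
     (\sum_(i < p) w (lift ord0 i) * B ^ i) * B)%N.
  rewrite big_distrl /=; apply: eq_bigr => i _.
  by rewrite /bump /= add1n expnS -mulnA [(B * _)%N]mulnC.
rewrite !E => uv; have B0 : (0 < B)%N by apply: leq_ltn_trans (uB ord0).
have u0 : u ord0 = v ord0.
  move: uv => /(congr1 (modn^~ B)); rewrite !(addnC (_ ord0)) !modnMDl.
  by rewrite !modn_small.
move: uv; rewrite u0 => /addnI /eqP; rewrite eqn_pmul2r // => /eqP uv.
move=> i; case: (unliftP ord0 i) => [j ->|-> //].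
exact: (IH (fun j => u (lift ord0 j)) (fun j => v (lift ord0 j))).
Qed.

(** Along the curve [t |-> (t^(e i))_i], with exponents [e i] chosen to
    separate the multi-indices of minimal degree, one monomial dominates. *)
Lemma msums0_coef0 c : (forall z, unit_ball z ->
  msums (fun k => c k * monomial k z) 0) -> c = fun=> 0.
Proof.
move=> H; apply: funext => k1; apply: contrapT => /eqP ck1.
have ex_deg : exists d, `[< exists2 k, c k != 0 & mdeg k = d >].
  by exists (mdeg k1); apply/asboolP; exists k1.
case: (ex_minnP ex_deg) => d /asboolP[k0 ck0 dk0] dmin.
pose E (i : 'I_n) := (d.+1 ^ i)%N; pose D := (d * (\sum_i E i)).+1.
pose wgt k := (\sum_i k i * (D + E i))%N.
have wgtE k : wgt k = (mdeg k * D + \sum_i k i * E i)%N.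
  by rewrite /mdeg big_distrl -big_split /=; apply: eq_bigr => i _; rewrite mulnDr.
have deg_le_wgt k : (mdeg k <= wgt k)%N.
  by rewrite wgtE; apply: leq_trans (leq_addr _ _); rewrite leq_pmulr.
have ex_w : exists w, `[< exists2 k, c k != 0 & wgt k = w >].
  by exists (wgt k0); apply/asboolP; exists k0.
case: (ex_minnP ex_w) => W /asboolP[k ck Wk] Wmin.
have dmin' k' : c k' != 0 -> (d <= mdeg k')%N.
  by move=> ck'; apply: dmin; apply/asboolP; exists k'.
have digit k' i : mdeg k' = d -> (k' i < d.+1)%N.
  by move=> <-; rewrite ltnS /mdeg (bigD1 i) //= leq_addr.
have WD : (W < d.+1 * D)%N.
  have W0 : (W <= wgt k0)%N by apply: Wmin; apply/asboolP; exists k0.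
  apply: leq_ltn_trans W0 _; rewrite wgtE dk0 mulSn addnC ltn_add2r /D ltnS.
  rewrite big_distrr /=; apply: leq_sum => i _; rewrite leq_mul2r.
  by apply/orP; right; rewrite -ltnS digit.
have degW k' : c k' != 0 -> wgt k' = W -> mdeg k' = d.
  move=> ck' wk'; apply/eqP; rewrite eqn_leq dmin' // andbT -ltnS.
  rewrite -(ltn_pmul2r (isT : (0 < D)%N)); apply: leq_ltn_trans WD.
  by rewrite -wk' wgtE leq_addr.
have wgt_gt k' : c k' != 0 -> k' != k -> (W < wgt k')%N.
  move=> ck' kk; rewrite ltn_neqAle Wmin ?andbT; last first.
    by apply/asboolP; exists k'.
  apply: contra kk => /eqP wW; have dk := degW _ ck Wk.
  have dk' := degW _ ck' (esym wW).
  apply/eqP/ffunP; apply: (@digits_inj d.+1); first by move=> i; exact: digit.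
    by move=> i; exact: digit.
  move: wW; rewrite -{1}Wk !wgtE dk dk' => /addnI E'.
  by rewrite -/(E _) E'.
pose t0 : R := n.+1%:R^-1; have t0_gt0 : 0 < t0 by rewrite invr_gt0 ltr0n.
have t01 : t0 <= 1 by rewrite invf_le1 ?ltr0n // ler1n.
pose pt (t : R) : 'rV[C]_n := \row_i ((t0 * t ^+ (D + E i))%:C)%C.
have ptB t : 0 <= t -> t <= 1 -> unit_ball (pt t).
  move=> t_ge0 t1; rewrite /unit_ball /=.
  apply: (@le_lt_trans _ _ (\sum_(i < n) t0 ^+ 2)).
    apply: ler_sum => i _; rewrite mxE modulus_real ger0_norm; last first.
      by rewrite mulr_ge0 ?exprn_ge0 // ltW.
    rewrite lerXn2r ?nnegrE ?mulr_ge0 ?exprn_ge0 ?(ltW t0_gt0) //.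
    by rewrite ler_piMr ?(ltW t0_gt0) // exprn_ile1.
  rewrite sum_ord_const expr2 mulrA.
  apply: (@le_lt_trans _ _ (n%:R * t0)).
    by rewrite ler_piMr // mulr_ge0 // ltW.
  by rewrite ltr_pdivrMr ?ltr0n // mul1r ltr_nat.
have monE t k' : monomial k' (pt t) = ((t0 ^+ mdeg k' * t ^+ wgt k')%:C)%C.
  rewrite /monomial /wgt /mdeg !expr_sum -big_split rmorph_prod /=.
  apply: eq_bigr => i _; rewrite mxE -rmorphXn /=; congr (_%:C)%C.
  by rewrite exprMn -exprM mulnC.
have [B B0 cB] := msums_bounded (H _ (ptB 1 ler01 (lexx 1))).
have {}cB k' : modulus (c k') * t0 ^+ mdeg k' <= B.
  have := cB k'; rewrite monE expr1n mulr1 modulusM modulus_real ger0_norm //.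
  by rewrite exprn_ge0 // ltW.
pose K : R := B * 2 ^+ W.+1 * 2 ^+ n.
have K0 : 0 <= K by rewrite !mulr_ge0 ?exprn_ge0.
pose m : R := modulus (c k) * t0 ^+ mdeg k.
have m0 : 0 < m by rewrite mulr_gt0 ?exprn_gt0 // modulus_gt0.
have main t : 0 < t -> t <= 2^-1 -> m <= K * t.
  move=> t_gt0 t2; have t1 : t <= 1 by lra.
  rewrite -(ler_pM2r (exprn_gt0 W t_gt0)); apply/ler_addgt0Pr => e e0.
  have [A0 HA] := H _ (ptB t (ltW t_gt0) t1) e e0.
  pose A := fsetU [fset k]%fset A0.
  have := HA A; rewrite subr0 => /(_ (fsubsetUr _ _)).
  have kA : k \in A by rewrite in_fsetU in_fset1 eqxx.
  rewrite (big_fsetD1 k) //=; set S := \sum_(_ <- _) _ => S_lt.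
  have mE : m * t ^+ W = modulus (c k * monomial k (pt t)).
    rewrite monE Wk modulusM modulus_real ger0_norm ?mulr_ge0 ?exprn_ge0 ?(ltW t_gt0) ?(ltW t0_gt0) //.
    by rewrite mulrA.
  have S_le : modulus S <= K * t * t ^+ W.
    apply: le_trans (ler_modulus_sum _ _ _) _.
    apply: (@le_trans _ _ (\sum_(k' <- (A `\ k)%fset)
        B * (2 * t) ^+ W.+1 * 2^-1 ^+ mdeg k')).
      rewrite big_seq [leRHS]big_seq; apply: ler_sum => k'.
      rewrite in_fsetD1 => /andP[kk _].
      have rhs0 : 0 <= B * (2 * t) ^+ W.+1 * 2^-1 ^+ mdeg k'.
        by rewrite !mulr_ge0 ?exprn_ge0 ?mulr_ge0 ?invr_ge0 // ltW.
      have [c0|cn0] := eqVneq (c k') 0; first by rewrite c0 mul0r modulus0.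
      have Wk' := wgt_gt _ cn0 kk.
      rewrite monE modulusM modulus_real ger0_norm; last first.
        by rewrite mulr_ge0 ?exprn_ge0 // ltW.
      rewrite mulrA -mulrA [leRHS]mulrAC; apply: (@le_trans _ _ (B * t ^+ wgt k')).
        by rewrite mulrA ler_wpM2r ?exprn_ge0 ?(ltW t_gt0).
      rewrite -mulrA ler_wpM2l //.
      apply: (@le_trans _ _ (2^-1 ^+ wgt k' * (2 * t) ^+ W.+1)); last first.
        rewrite ler_wpM2r ?exprn_ge0 ?mulr_ge0 ?(ltW t_gt0) //.
        by rewrite ler_wiXn2l ?invr_ge0 // invf_le1 // ler1n.
      have -> : t ^+ wgt k' = t ^+ (wgt k' - W.+1) * t ^+ W.+1.
        by rewrite -exprD subnK.
      have -> : 2^-1 ^+ wgt k' = 2^-1 ^+ (wgt k' - W.+1) * 2^-1 ^+ W.+1 :> R.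
        by rewrite -exprD subnK.
      rewrite -mulrA -exprMn mulKf ?pnatr_eq0 //.
      rewrite ler_wpM2r ?exprn_ge0 ?(ltW t_gt0) //.
      by rewrite lerXn2r ?nnegrE ?invr_ge0 ?(ltW t_gt0).
    rewrite -mulr_sumr; apply: le_trans (ler_wpM2l _ (sum_geo_multi_index _)) _.
      by rewrite mulr_ge0 // exprn_ge0 // mulr_ge0 // ltW.
    rewrite /K exprMn [t ^+ W.+1]exprS le_eqVlt; apply/orP; left; apply/eqP.
    by ring.
  rewrite mE (_ : c k * _ = (c k * monomial k (pt t) + S) - S); last first.
    by rewrite addrK.
  apply: le_trans (ler_modulusB _ _) _; rewrite addrC.
  exact: lerD S_le (ltW S_lt).
pose t := Num.min 2^-1 (m / (2 * (K + 1))).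
have K1 : 0 < K + 1 by rewrite ltr_wpDl.
have t_gt0 : 0 < t by rewrite lt_min invr_gt0 ltr0n divr_gt0 // mulr_gt0.
have := main t t_gt0; rewrite ge_min lexx => /(_ isT).
have : t <= m / (2 * (K + 1)) by rewrite ge_min lexx orbT.
move=> /(ler_wpM2l K0) h1 h2.
have h3 : K * (m / (2 * (K + 1))) <= m / 2.
  have -> : K * (m / (2 * (K + 1))) = m / 2 * (K / (K + 1)).
    by field; rewrite gt_eqF.
  by rewrite ler_piMr ?divr_ge0 ?(ltW m0) // ler_pdivrMr // mul1r lerDl.
by move: h1 h2 h3 m0; lra.
Qed.

(** The coefficients being unique, the choice made by [taylor] is harmless. *)
Lemma taylorE f a : expansion_ball f a -> taylor f = a.
Proof.
move=> fa; apply: get_unique => // b fb.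
move: fa fb => /expansion_ballP fa /expansion_ballP fb.
have : (fun k => b k + -1 * a k) = fun=> 0.
  apply: msums0_coef0 => z zB.
  have := msumsD (fb z zB) (msumsZ (-1) (fa z zB)); rewrite mulN1r subrr.
  by apply: eq_msums => k; rewrite mulrDl mulrA.
move=> E; apply: funext => k; have := congr1 (fun F => F k) E.
by rewrite mulN1r => /subr0_eq.
Qed.

End Uniqueness.

(** * The norm of the space in terms of coefficients *)

Section Energy.
Context {R : realType} {n : nat}.
Variable alpha : R.
Local Notation C := (cfield R).
Local Notation MI := {ffun 'I_n -> nat}.
Implicit Types (f g : 'rV[C]_n -> C) (a b c : MI -> C) (k : MI) (z : 'rV[C]_n)
  (B : R).

Definition energy a k : R := D_weight alpha k * modulus (a k) ^+ 2.

(** A bound for the squared norm, stated for finite sums in order to compute with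
    real numbers; [D_norm_sqr_le] is the link with the norm. *)
Definition energy_le a B := forall A : {fset MI}, \sum_(k <- A) energy a k <= B.

Lemma D_weight_gt0 k : (0 < n)%N -> 0 < D_weight alpha k.
Proof.
move=> n0; rewrite /D_weight divr_gt0 ?mulr_gt0 ?ltr0n ?fact_gt0 //.
  by rewrite powR_gt0 // ltr0n addn_gt0 n0.
by rewrite muln_gt0 fact_gt0 prodn_gt0 // => i; exact: fact_gt0.
Qed.

Lemma D_weight_ge0 k : 0 <= D_weight alpha k.
Proof. by rewrite /D_weight !mulr_ge0 ?powR_ge0 ?invr_ge0. Qed.

Lemma energy_ge0 a k : 0 <= energy a k.
Proof. by rewrite mulr_ge0 ?D_weight_ge0 ?sqr_ge0. Qed.

Lemma energy_le_ge0 a B : energy_le a B -> 0 <= B.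
Proof. by move=> /(_ fset0); rewrite big_nil. Qed.

Lemma energy_le_seq a B (s : seq MI) : uniq s -> energy_le a B ->
  \sum_(k <- s) energy a k <= B.
Proof.
move=> us /(_ [fset k | k in s]%fset); apply: le_trans.
rewrite (perm_big [fset k | k in s]%fset) //=.
apply: uniq_perm => // k; apply/idP/imfsetP => [ks|[k' /= k's -> //]].
by exists k.
Qed.

Lemma D_norm_sqr_le f a B : expansion_ball f a ->
  (D_norm alpha f ^+ 2 <= B%:E)%E <-> energy_le a B.
Proof.
move=> fa; rewrite /D_norm (taylorE fa) sqr_sqrte; last first.
  by apply: esum_ge0 => k _; rewrite lee_fin energy_ge0.
have E (A : {fset MI}) : (\sum_(k \in [set` A])
    (D_weight alpha k * modulus (a k) ^+ 2)%:E = (\sum_(k <- A) energy a k)%:E)%E.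
  by rewrite fsbig_finite //= set_fsetK sumEFin.
split=> [H A|H].
  rewrite -lee_fin -E; apply: le_trans H; apply: esum_ge.
  by exists [set` A] => //; split.
apply: ge_ereal_sup => _ [X [Xfin _] <-].
by rewrite -(fset_setK Xfin) E lee_fin.
Qed.

Lemma energy_leD a b B B' : energy_le a B -> energy_le b B' ->
  energy_le (fun k => a k + b k) (2 * (B + B')).
Proof.
move=> aB bB A; apply: (@le_trans _ _
    (\sum_(k <- A) 2 * (energy a k + energy b k))).
  apply: ler_sum => k _; rewrite /energy -mulrDr [leRHS]mulrCA.
  apply: ler_wpM2l; first exact: D_weight_ge0.
  have h := ler_modulusD (a k) (b k).
  apply: (@le_trans _ _ ((modulus (a k) + modulus (b k)) ^+ 2)).
    by rewrite lerXn2r ?nnegrE ?addr_ge0 ?modulus_ge0.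
  rewrite -subr_ge0.
  rewrite (_ : _ - _ = (modulus (a k) - modulus (b k)) ^+ 2) ?sqr_ge0 //.
  by ring.
by rewrite -mulr_sumr big_split /= ler_wpM2l // lerD.
Qed.

Lemma energy_leZ (c : C) a B : energy_le a B ->
  energy_le (fun k => c * a k) (modulus c ^+ 2 * B).
Proof.
move=> aB A; apply: le_trans (ler_wpM2l (sqr_ge0 _) (aB A)).
rewrite mulr_sumr; apply: ler_sum => k _.
by rewrite /energy modulusM exprMn mulrCA.
Qed.

Lemma fact_ratio_le (a b e : nat) :
  ((a + e)`! * (a + b)`! <= a`! * (a + b + e)`!)%N.
Proof.
elim: e => [|e IH]; first by rewrite !addn0.
rewrite !addnS !factS -mulnA [leqRHS]mulnCA.
by apply: leq_mul => //; rewrite ltnS leq_add2r leq_addr.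
Qed.

(** The weight of a monomial is an inverse multinomial coefficient, which
    decreases when the multi-index increases.  The parameter [c] makes the
    induction on the list of variables possible. *)
Lemma prod_fact_ratio_le (r : seq 'I_n) k0 k (c : nat) :
  ((\prod_(i <- r) (k0 i + k i)`!) * (c + \sum_(i <- r) k i)`! <=
   (\prod_(i <- r) (k i)`!) * (c + \sum_(i <- r) k i + \sum_(i <- r) k0 i)`!)%N.
Proof.
elim: r c => [|i r IH] c; first by rewrite !big_nil !addn0.
rewrite !big_cons; set P := \prod_(i <- r) _; set Q := \prod_(i <- r) _.
set S := \sum_(i <- r) k i; set S0 := \sum_(i <- r) k0 i.
have := IH (c + k i)%N; rewrite -/P -/Q -/S -/S0 => {}IH.
rewrite -!mulnA addnA.
apply: (@leq_trans ((k0 i + k i)`! * (Q * (c + k i + S + S0)`!))).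
  by rewrite leq_mul2l IH orbT.
rewrite mulnCA [leqRHS]mulnCA leq_mul2l; apply/orP; right.
have := fact_ratio_le (k i) (c + S + S0) (k0 i).
rewrite [(k i + k0 i)%N]addnC.
have -> : (k i + (c + S + S0) = c + k i + S + S0)%N by lia.
by have -> : (c + k i + S + S0 + k0 i = c + k i + S + (k0 i + S0))%N by lia.
Qed.

Lemma mdegD k0 k : mdeg (madd k0 k) = (mdeg k0 + mdeg k)%N.
Proof.
by rewrite /mdeg -big_split /=; apply: eq_bigr => i _; rewrite ffunE.
Qed.

(** Multiplication by a monomial is a bounded operator: up to the factor
    [(n + deg) ^ alpha], which changes by a bounded ratio, it decreases the
    weights. *)
Lemma D_weight_madd k0 : (0 < n)%N -> exists2 K, 0 < K &
  forall k, D_weight alpha (madd k0 k) <= K * D_weight alpha k.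
Proof.
move=> n0; pose c : R := (mdeg k0).+1%:R.
have c1 : 1 <= c by rewrite ler1n.
exists (c `^ `|alpha|); first by rewrite powR_gt0 // (lt_le_trans _ c1).
move=> k; rewrite /D_weight -!mulrA.
have nk0 j : 0 < (n + j)%N%:R :> R by rewrite ltr0n addn_gt0 n0.
apply: (@le_trans _ _ (c `^ `|alpha| * (n + mdeg k)%:R `^ alpha *
   (((n.-1)`! * mfact (madd k0 k))%:R / (n.-1 + mdeg (madd k0 k))`!%:R))).
  rewrite ler_wpM2r ?divr_ge0 //; apply: powR_ratio_le => //.
    by rewrite -natrM ler_nat mdegD; nia.
  rewrite -natrM ler_nat mdegD mulSn; apply: leq_trans (leq_addr _ _).
  by rewrite leq_add2l leq_addl.
rewrite !mulrA -!(mulrA (c `^ `|alpha| * _)).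
rewrite ler_wpM2l ?mulr_ge0 ?powR_ge0 //.
rewrite ler_pdivrMr ?ltr0n ?fact_gt0 // mulrAC ler_pdivlMr ?ltr0n ?fact_gt0 //.
rewrite -!natrM ler_nat -!mulnA leq_mul2l; apply/orP; right.
have := prod_fact_ratio_le (index_enum 'I_n) k0 k n.-1.
rewrite mdegD /mfact /mdeg.
rewrite addnAC -addnA.
by congr (_ * _ <= _)%N; apply: eq_bigr => i _; rewrite ffunE.
Qed.

Lemma energy_le_mshift k0 : (0 < n)%N -> exists2 K, 0 < K & forall a B,
  energy_le a B -> energy_le (mshift k0 a) (K * B).
Proof.
move=> n0; have [K K0 HK] := D_weight_madd k0 n0; exists K => // a B aB A.
pose s := [seq msub k k0 | k <- A & mle k0 k].
have us : uniq s.
  rewrite map_inj_in_uniq ?filter_uniq ?fset_uniq // => k k'.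
  rewrite !mem_filter => /andP[le _] /andP[le' _] E.
  by rewrite -(msubK le) E msubK.
rewrite (bigID (mle k0)) /= [X in _ + X]big1 ?addr0; last first.
  move=> k /negPf le; rewrite /energy /mshift le modulus0 expr0n /=.
  by rewrite mulr0.
apply: (@le_trans _ _ (K * \sum_(k <- s) energy a k)); last first.
  by rewrite ler_wpM2l ?(ltW K0) // energy_le_seq.
rewrite mulr_sumr big_map big_filter; apply: ler_sum => k le.
rewrite /energy /mshift le [leRHS]mulrA; apply: ler_wpM2r; first exact: sqr_ge0.
by rewrite -{1}(msubK le).
Qed.

Lemma energy_le_msum (r : seq MI) (c : MI -> C) : (0 < n)%N ->
  exists2 K, 0 < K & forall a B, energy_le a B ->
    energy_le (fun k => \sum_(k0 <- r) c k0 * mshift k0 a k) (K * B).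
Proof.
move=> n0; elim: r => [|k0 r [K K0 IH]].
  exists 1 => // a B aB A; rewrite mul1r big1 ?(energy_le_ge0 aB) // => k _.
  by rewrite /energy big_nil modulus0 expr0n mulr0.
have [K' K'0 HK'] := energy_le_mshift k0 n0.
exists (2 * (modulus (c k0) ^+ 2 * K' + K)).
  by rewrite mulr_gt0 // ltr_wpDl // mulr_ge0 ?sqr_ge0 // ltW.
move=> a B aB; have := energy_leD (energy_leZ (c k0) (HK' _ _ aB)) (IH _ _ aB).
rewrite (_ : 2 * _ = 2 * (modulus (c k0) ^+ 2 * K' + K) * B); last by ring.
by congr energy_le; apply: funext => k; rewrite big_cons.
Qed.

(** Finitely many coefficients carry the energy up to [e], by definition of the
    supremum; hence polynomials are dense. *)
Lemma energy_tail a B e : energy_le a B -> 0 < e -> exists A0 : {fset MI},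
  energy_le (fun k => if k \in A0 then 0 else a k) e.
Proof.
move=> aB e0; pose E := [set \sum_(k <- A) energy a k | A in [set: {fset MI}]].
have supE : has_sup E.
  by split; [exists 0, fset0 => //; rewrite big_nil|exists B => _ [A _ <-]].
have [_ [A0 _ <-] HA0] := sup_adherent e0 supE.
exists A0 => A.
have : \sum_(k <- fsetU A A0) energy a k <= sup E.
  by apply: ub_le_sup; [case: supE|exists (fsetU A A0)].
rewrite (bigID (mem A0)) /=.
have -> : \sum_(k <- fsetU A A0 | k \in A0) energy a k = \sum_(k <- A0) energy a k.
  rewrite -big_filter; apply: perm_big; apply: uniq_perm.
  - by rewrite filter_uniq ?fset_uniq.
  - exact: fset_uniq.
  by move=> k; rewrite mem_filter in_fsetU; case: (k \in A0); rewrite ?orbT.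
have -> : \sum_(k <- A) energy (fun k => if k \in A0 then 0 else a k) k =
    \sum_(k <- A | k \notin A0) energy a k.
  rewrite [RHS]big_mkcond; apply: eq_bigr => k _; rewrite /energy.
  by case: (k \in A0) => //=; rewrite modulus0 expr0n mulr0.
have : \sum_(k <- A | k \notin A0) energy a k <=
    \sum_(k <- fsetU A A0 | k \notin A0) energy a k.
  rewrite -big_filter -[leRHS]big_filter; apply: ler_sum_subset => [||k|k].
  - by rewrite filter_uniq ?fset_uniq.
  - by rewrite filter_uniq ?fset_uniq.
  - by rewrite !mem_filter in_fsetU => /andP[-> ->].
  - exact: energy_ge0.
by move: HA0; lra.
Qed.

End Energy.

(** * Diagonal functions *)

Section Diagonal.
Context {R : realType} {n : nat}.
Variables (m : nat) (M : multi_index n).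
Local Notation C := (cfield R).
Local Notation MI := {ffun 'I_n -> nat}.
Implicit Types (f g : 'rV[C]_n -> C) (a b P : MI -> C) (k : MI)
  (z : 'rV[C]_n) (x q : fps R).

Definition diag_exp (i : 'I_n) : nat := if (i < m)%N then M i else 0%N.
Definition diag_index (l : nat) : MI := [ffun i => (l * diag_exp i)%N].
Definition diag_deg : nat := (\sum_i diag_exp i)%N.
(** The normalization for which [diag_scale * z^M] maps the ball into the unit
    disc. *)
Definition diag_scale : R := mu R m M `^ 2^-1.

Local Notation idx := diag_index.
Local Notation tau := ((diag_scale%:C)%C : C).

Lemma mu_gt0 : 0 < mu R m M.
Proof.
rewrite /mu divr_gt0 // ltr0n ?expn_gt0.
  by case: (\sum_(i < n | (i < m)%N) M i)%N.
by rewrite prodn_gt0 // => i; rewrite expn_gt0; case: (M i).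
Qed.

Lemma diag_degE : (\sum_(i < n | (i < m)%N) M i)%N = diag_deg.
Proof. by rewrite big_mkcond. Qed.

Lemma diag_scale_gt0 : 0 < diag_scale.
Proof. by rewrite powR_gt0 // mu_gt0. Qed.

Lemma tau_neq0 : tau != 0.
Proof. by rewrite -modulus_gt0 modulus_real gtr0_norm diag_scale_gt0. Qed.

Lemma idx0 : idx 0 = mzero.
Proof. by apply/ffunP => i; rewrite !ffunE mul0n. Qed.

Lemma mdeg_idx l : mdeg (idx l) = (l * diag_deg)%N.
Proof.
by rewrite /mdeg /diag_deg big_distrr; apply: eq_bigr => i _; rewrite ffunE.
Qed.

Hypothesis deg_gt0 : (0 < diag_deg)%N.

Lemma exists_diag_exp : exists i, (0 < diag_exp i)%N.
Proof.
apply: contrapT => H; move: deg_gt0; rewrite /diag_deg big1 // => i _.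
by apply/eqP; rewrite -leqn0 leqNgt; apply/negP => Mi; apply: H; exists i.
Qed.

Lemma idx_inj : injective idx.
Proof.
have [i Mi] := exists_diag_exp => l l' /ffunP/(_ i); rewrite !ffunE => /eqP.
by rewrite eqn_pmul2r // => /eqP.
Qed.

(** If two diagonal multi-indices differ by [k] then [k] is diagonal as well: this
    is why the diagonal part of a product with a diagonal function only sees
    the diagonal part of the other factor. *)
Lemma idx_sub l k j : mle k (idx l) -> msub (idx l) k = idx j ->
  (j <= l)%N /\ k = idx (l - j).
Proof.
move=> /forallP le /ffunP E; have [i0 Mi0] := exists_diag_exp.
have jl i : (0 < diag_exp i)%N -> (j <= l)%N.
  move=> Mi; have := E i; have := le i; rewrite !ffunE => h1 h2.
  by rewrite -(leq_pmul2r Mi) -h2 leq_subr.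
split; first exact: jl Mi0.
apply/ffunP => i; have := E i; have := le i; rewrite !ffunE mulnBl => h1 <-.
by rewrite subKn.
Qed.

Lemma idx_msub l j : (j <= l)%N -> msub (idx l) (idx j) = idx (l - j).
Proof. by move=> jl; apply/ffunP => i; rewrite !ffunE mulnBl. Qed.

Lemma mle_idx l j : (j <= l)%N -> mle (idx j) (idx l).
Proof. by move=> jl; apply/forallP => i; rewrite !ffunE leq_mul2r jl orbT. Qed.

(** The Taylor coefficients of [z |-> x (tau * z^M)]. *)
Definition diag_coef x k : C :=
  if pselect (exists l, k = idx l) is left H
  then x (projT1 (cid H)) * tau ^+ projT1 (cid H) else 0.

Lemma diag_coef_idx x l : diag_coef x (idx l) = x l * tau ^+ l.
Proof.
rewrite /diag_coef; case: pselect => [H|[]]; last by exists l.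
by have := projT2 (cid H) => /idx_inj <-.
Qed.

Lemma diag_coef_neq0 x k : diag_coef x k != 0 -> exists l, k = idx l.
Proof. by rewrite /diag_coef; case: pselect => // _; rewrite eqxx. Qed.

Lemma diag_coef_off x k : (forall l, k <> idx l) -> diag_coef x k = 0.
Proof. by move=> H; rewrite /diag_coef; case: pselect => // -[l kl]; case: (H l kl). Qed.

Lemma diag_coef1 : diag_coef 1 = mone.
Proof.
apply: funext => k; rewrite /mone -idx0; have [->|k0] := eqVneq k (idx 0).
  by rewrite diag_coef_idx fps1 mul1r expr0.
have [[l kl]|H] := pselect (exists l, k = idx l); last first.
  by rewrite diag_coef_off // => l kl; apply: H; exists l.
move: k0; rewrite kl diag_coef_idx; case: l {kl} => [|l _]; first by rewrite eqxx.
by rewrite fps1 mul0r.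
Qed.

Lemma sums_to_msums y (x : fps R) (w s : C) : 0 <= y -> decay y x ->
  y * modulus w < 1 -> sums_to (at_pt x w) s -> msums (at_pt x w) s.
Proof.
move=> y0 [K K0 xK]; set u := y * modulus w => u1 xs e e0.
have u0 : 0 <= u by rewrite mulr_ge0 // modulus_ge0.
have e20 : 0 < e / 2 by rewrite divr_gt0.
have [n1 H1] := xs _ e20.
have [n2 H2] := geo_lt_eps (K / (1 - u)) u0 u1 e20.
pose N := maxn n1 n2; exists [fset l | l in iota 0 N]%fset => A NA.
have inN l : (l \in [fset l | l in iota 0 N]%fset) = (l < N)%N.
  by rewrite !inE mem_iota.
rewrite (bigID (fun l => (l < N)%N)) /=.
have -> : \sum_(l <- A | (l < N)%N) at_pt x w l = \sum_(l < N) at_pt x w l.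
  rewrite -(big_mkord xpredT (at_pt x w)) /index_iota subn0 -[LHS]big_filter.
  apply: perm_big; apply: uniq_perm; rewrite ?filter_uniq ?fset_uniq ?iota_uniq //.
  move=> l; rewrite mem_filter mem_iota /= add0n; case lN : (l < N)%N => //=.
  by rewrite (fsubsetP NA) // inN.
set S := \sum_(l <- A | _) _; rewrite addrAC [ltRHS]splitr.
apply: le_lt_trans (ler_modulusD _ _) _; apply: ltrD.
  by apply: H1; rewrite leq_maxl.
apply: le_lt_trans (H2 N (leq_maxr _ _)); rewrite mulrAC.
pose m' := (\max_(l <- A) l).+1.
apply: (@le_trans _ _ (\sum_(N <= l < m') K * u ^+ l)); last first.
  by rewrite -mulr_sumr -mulrA ler_wpM2l // geo_tail_le.
apply: le_trans (ler_modulus_sum _ _ _) _.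
apply: (@le_trans _ _ (\sum_(l <- A | ~~ (l < N)%N) K * u ^+ l)).
  apply: ler_sum => l _; rewrite modulusM modulusX exprMn mulrA.
  by rewrite ler_wpM2r ?exprn_ge0 ?modulus_ge0.
rewrite -big_filter; apply: ler_sum_subset => [||l|l].
- by rewrite filter_uniq ?fset_uniq.
- exact: iota_uniq.
- rewrite mem_filter -leqNgt mem_index_iota => /andP[-> lA] /=.
  by rewrite ltnS (@leq_bigmax_seq _ _ xpredT id).
- by rewrite mulr_ge0 // exprn_ge0.
Qed.

Definition diag_arg z : C := tau * \prod_(i < n | (i < m)%N) z 0 i ^+ M i.

Lemma monomial_idx l z :
  monomial (idx l) z = (\prod_(i < n | (i < m)%N) z 0 i ^+ M i) ^+ l.
Proof.
rewrite -prodrXl [RHS]big_mkcond; apply: eq_bigr => i _.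
by rewrite ffunE /diag_exp; case: ifP; rewrite ?muln0 // mulnC exprM.
Qed.

Lemma expansion_diag f y x : 0 <= y -> decay y x ->
  (forall z, unit_ball z -> y * modulus (diag_arg z) < 1) ->
  (forall z, unit_ball z -> sums_to (at_pt x (diag_arg z)) (f z)) ->
  expansion_ball f (diag_coef x).
Proof.
move=> y0 xy yz fz; apply/expansion_ballP => z zB.
apply: (msums_image idx_inj) (sums_to_msums y0 xy (yz z zB) (fz z zB)).
  move=> l; rewrite diag_coef_idx monomial_idx /at_pt /diag_arg exprMn.
  by rewrite mulrA.
by move=> k H; rewrite diag_coef_off // mul0r.
Qed.

Lemma sum_diag (V : nmodType) (s : seq MI) (G : MI -> V) p : uniq s ->
  (forall k, k \in s -> G k <> 0 -> exists2 j, (j < p)%N & k = idx j) ->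
  \sum_(k <- s) G k = \sum_(j < p) (if idx j \in s then G (idx j) else 0).
Proof.
move=> us HG; pose t := [seq idx j | j <- iota 0 p].
have ut : uniq t by rewrite map_inj_uniq ?iota_uniq //; exact: idx_inj.
have tP k : reflect (exists2 j, (j < p)%N & k = idx j) (k \in t).
  apply: (iffP mapP) => [[j]|[j jp ->]].
    by rewrite mem_iota => jp ->; exists j.
  by exists j; rewrite ?mem_iota.
rewrite -(big_mkord xpredT (fun j => if idx j \in s then G (idx j) else 0)).
rewrite /index_iota subn0 -(big_map idx xpredT (fun k => if k \in s then G k else 0)).
rewrite -big_mkcond -/t -big_filter (bigID (mem t)) /= [X in _ + X]big1_seq ?addr0.
  rewrite -big_filter; apply: perm_big; apply: uniq_perm; rewrite ?filter_uniq //.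
  by move=> k; rewrite !mem_filter andbC.
move=> k /andP[kt ks]; apply: contrapT => Gk; move/negP: kt; apply.
by apply/tP; exact: HG.
Qed.

(** The coefficients of [p * f] for a polynomial [p] in the box of size [N]. *)
Definition box_conv N P a : MI -> C := fun k =>
  \sum_(y : {ffun 'I_n -> 'I_N.+1}) P (box y) * mshift (box y) a k.

Definition in_box N k := [forall i, (k i <= N)%N].

(** The diagonal part of a polynomial in the box, as a one-variable polynomial. *)
Definition diag_restrict N P : fps R := fun j =>
  if in_box N (idx j) then P (idx j) / tau ^+ j else 0.

Lemma diag_restrict_deg N P : deg_le N (diag_restrict N P).
Proof.
move=> j Nj; rewrite /diag_restrict; case: ifP => // /forallP jN.
have [i Mi] := exists_diag_exp; have := jN i; rewrite ffunE leqNgt.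
by rewrite (leq_trans Nj) // leq_pmulr.
Qed.

Lemma box_seq N : let s := [seq box y | y <- enum {ffun 'I_n -> 'I_N.+1}] in
  uniq s /\ forall k, (k \in s) = in_box N k.
Proof.
split; first by rewrite map_inj_uniq ?enum_uniq //; exact: box_inj.
move=> k; apply/mapP/forallP => [[y _ ->] i|kN].
  by rewrite ffunE -ltnS.
have [y ->] := @box_image n N.+1 k kN.
by exists y => //; rewrite mem_enum.
Qed.

Lemma box_conv_idx N P x l :
  box_conv N P (diag_coef x) (idx l) = (diag_restrict N P * x) l * tau ^+ l.
Proof.
have [us sE] := box_seq N; set s := map _ _ in us sE.
rewrite /box_conv -(big_map (@box n N.+1) xpredT
  (fun k => P k * mshift k (diag_coef x) (idx l))).
rewrite -[index_enum _]enumT -/s (@sum_diag C s _ l.+1 us).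
  rewrite fpsM mulr_suml; apply: eq_bigr => j _; rewrite sE /diag_restrict.
  have jl : (j <= l)%N by rewrite -ltnS.
  case: ifP => _; last by rewrite !mul0r.
  rewrite /mshift mle_idx // idx_msub // diag_coef_idx.
  have -> : tau ^+ l = tau ^+ j * tau ^+ (l - j) by rewrite -exprD subnKC.
  have tj : tau ^+ j != 0 by rewrite expf_neq0 // tau_neq0.
  move: (tau ^+ j) tj (tau ^+ (l - j)) => t1 t10 t2.
  by field.
move=> k _ /eqP; rewrite mulf_eq0 negb_or => /andP[_]; rewrite /mshift.
case: ifP => [le|]; last by rewrite eqxx.
move=> /diag_coef_neq0[j E]; have [jl ->] := idx_sub le E.
by exists (l - j)%N => //; rewrite ltnS leq_subr.
Qed.

Lemma box_conv_diag N q x : (forall i j, q j != 0 -> (j * diag_exp i <= N)%N) ->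
  box_conv N (diag_coef q) (diag_coef x) = diag_coef (q * x).
Proof.
move=> qN; apply: funext => k.
have [[l ->]|H] := pselect (exists l, k = idx l).
  suff qE : diag_restrict N (diag_coef q) = q.
    by rewrite box_conv_idx diag_coef_idx qE.
  apply: funext => j; rewrite /diag_restrict.
  case: ifP => [_|/negbT jN].
    by rewrite diag_coef_idx mulfK // expf_neq0 // tau_neq0.
  apply/esym/eqP; apply: contraNT jN => qj; apply/forallP => i.
  by rewrite ffunE qN.
rewrite diag_coef_off => [|l kl]; last by apply: H; exists l.
rewrite /box_conv big1 // => y _; apply/eqP; apply: contraT.
rewrite mulf_eq0 negb_or => /andP[/diag_coef_neq0[i ->]].
rewrite /mshift; case: ifP => [le|]; last by rewrite eqxx.
move=> /diag_coef_neq0[j E]; case: H; exists (i + j)%N.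
rewrite -(msubK le) E; apply/ffunP => i'; rewrite !ffunE.
by rewrite mulnDl.
Qed.

Lemma expansion_box_mul N P f a : expansion_ball f a ->
  expansion_ball (fun z => 1 - (\sum_(y : {ffun 'I_n -> 'I_N.+1})
      P (box y) * \prod_i z 0 i ^+ y i) * f z)
    (fun k => mone k - box_conv N P a k).
Proof.
move=> fa.
have E := @expansion_ball_sum R n _ (index_enum {ffun 'I_n -> 'I_N.+1}) _ _
  (fun y => expansion_ballZ (c := P (box y)) (expansion_ball_monomial (k0 := box y) fa)).
have := expansion_ballD expansion_ball1 (expansion_ballZ (c := -1) E).
rewrite (_ : (fun k => mone k + _) = fun k => mone k - box_conv N P a k); last first.
  by apply: funext => k; rewrite mulN1r.
apply: eq_expansion_ball => z _; rewrite mulN1r mulr_suml; congr (_ - _).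
apply: eq_bigr => y _; rewrite -mulrA; congr (_ * (_ * _)).
by apply: eq_bigr => i _; rewrite ffunE.
Qed.

Variable alpha : R.

Definition diag_weight l : R := D_weight alpha (idx l) * (diag_scale ^+ l) ^+ 2.

Lemma energy_idx (c : C) a l : a (idx l) = c * tau ^+ l ->
  energy alpha a (idx l) = diag_weight l * modulus c ^+ 2.
Proof.
move=> E; rewrite /energy E modulusM modulusX modulus_real.
by rewrite gtr0_norm ?diag_scale_gt0 // /diag_weight exprMn; ring.
Qed.

Lemma energy_le_diag x B :
  (forall N, \sum_(l < N) diag_weight l * modulus (x l) ^+ 2 <= B) ->
  energy_le alpha (diag_coef x) B.
Proof.
move=> H A; have [i Mi] := exists_diag_exp.
pose p := (\max_(k <- A) k i).+1.
rewrite (@sum_diag R A _ p (fset_uniq A)).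
  apply: le_trans (H p); apply: ler_sum => l _; case: ifP => _.
    by rewrite (energy_idx (diag_coef_idx x l)).
  by rewrite mulr_ge0 ?sqr_ge0 // mulr_ge0 ?sqr_ge0 // D_weight_ge0.
move=> k kA /eqP Ek; have [|l kl] := @diag_coef_neq0 x k.
  by apply: contraNneq Ek => k0; rewrite /energy k0 modulus0 expr0n mulr0.
exists l => //; rewrite ltnS; apply: leq_trans (_ : k i <= _)%N.
  by rewrite kl ffunE leq_pmulr.
exact: (@leq_bigmax_seq _ _ xpredT (fun k : MI => k i)).
Qed.

Lemma energy_le_diag_lower a x B : (forall l, a (idx l) = x l * tau ^+ l) ->
  energy_le alpha a B ->
  forall N, \sum_(l < N) diag_weight l * modulus (x l) ^+ 2 <= B.
Proof.
move=> ax aB N; have us : uniq [seq idx l | l <- iota 0 N].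
  by rewrite map_inj_uniq ?iota_uniq //; exact: idx_inj.
apply: le_trans (energy_le_seq us aB); rewrite big_map.
rewrite -(big_mkord xpredT (fun l => diag_weight l * modulus (x l) ^+ 2)).
by rewrite /index_iota subn0; apply: ler_sum => l _; rewrite (energy_idx (ax l)).
Qed.

End Diagonal.

(** * Norms of the diagonal monomials *)

Section DiagonalWeight.
Context {R : realType} {n : nat}.
Variables (m : nat) (M : multi_index n) (alpha : R).
Hypotheses (m_gt0 : (0 < m)%N) (mn : (m <= n)%N) (deg_gt0 : (0 < diag_deg m M)%N).

Local Notation s := (diag_deg m M).
Local Notation idx := (diag_index m M).

Lemma ln_prod_nat (I : Type) (r : seq I) (P : pred I) (F : I -> nat) :
  (forall i, (0 < F i)%N) ->
  ln ((\prod_(i <- r | P i) F i)%N%:R : R) = \sum_(i <- r | P i) ln (F i)%:R.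
Proof.
move=> F0; elim: r => [|i r IH]; first by rewrite !big_nil ln1.
rewrite !big_cons; case: ifP => // _.
by rewrite natrM lnM ?posrE ?ltr0n ?IH // prodn_gt0.
Qed.

(** Each of the [p] extra factors contributes [ln l] up to a bounded error. *)
Lemma ln_fact_shift p : exists C : R, forall l,
  `|ln (p + l * s)`!%:R - (l%:R * s%:R * (ln l%:R + ln s%:R - 1)
     + ln l.+1%:R / 2 + p%:R * ln l.+1%:R)| <= C.
Proof.
elim: p => [|p [C HC]].
  have [C HC] := @ln_fact_mul R _ deg_gt0; exists C => l.
  by rewrite add0n mul0r addr0; exact: HC.
exists (C + ln (p.+1 + s)%:R) => l.
have /andP[h1 h2] : 0 <= ln ((p.+1 + l * s)%:R : R) - ln l.+1%:R
    <= ln (p.+1 + s)%:R.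
  apply: (@ln_nat_comparable R (fun l => p.+1 + l * s)%N) => [k|k|//].
    by rewrite addSn ltnS; apply: leq_trans (leq_addl _ _); rewrite leq_pmulr.
  by rewrite mulnS; nia.
set X := _ - _; rewrite (_ : X = (ln (p + l * s)`!%:R -
    (l%:R * s%:R * (ln l%:R + ln s%:R - 1) + ln l.+1%:R / 2 + p%:R * ln l.+1%:R))
    + (ln (p.+1 + l * s)%:R - ln l.+1%:R)); last first.
  rewrite /X [in (p.+1 + l * s)`!]addSn factS natrM lnM ?posrE ?ltr0n ?fact_gt0 //.
  by rewrite addSn -[p.+1%:R]natr1; ring.
by apply: le_trans (ler_normD _ _) _; apply: lerD (HC l) _; rewrite ger0_norm.
Qed.

Definition diag_stirling (i : 'I_n) l : R :=
  l%:R * (M i)%:R * (ln l%:R + ln (M i)%:R - 1) + ln l.+1%:R / 2.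

(** The logarithm of the denominator of [mu]. *)
Definition diag_entropy : R := \sum_(i < n | (i < m)%N) (M i)%:R * ln (M i)%:R.

Lemma sum_diag_stirling l : \sum_(i < n | (i < m)%N) diag_stirling i l =
  l%:R * s%:R * (ln l%:R - 1) + l%:R * diag_entropy + m%:R * (ln l.+1%:R / 2).
Proof.
rewrite big_split /= -(big_ord_widen n (fun=> ln l.+1%:R / 2 : R) mn) sum_ord_const.
congr (_ + _); rewrite -diag_degE natr_sum /diag_entropy !mulr_sumr mulr_suml.
by rewrite -big_split /=; apply: eq_bigr => i _; ring.
Qed.

Lemma ln_mu : ln (mu R m M) = s%:R * ln s%:R - diag_entropy.
Proof.
rewrite /mu ln_div ?posrE ?ltr0n ?prodn_gt0 //.
- rewrite ln_prod_nat => [|i]; last by rewrite expn_gt0; case: (M i).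
  rewrite diag_degE natrX lnXn ?ltr0n // mulr_natl; congr (_ - _).
  apply: eq_bigr => i _; case: (M i) => [|k]; first by rewrite expn0 ln1 mul0r.
  by rewrite natrX lnXn ?ltr0n // mulr_natl.
- by rewrite diag_degE expn_gt0 deg_gt0.
- by move=> i; rewrite expn_gt0; case: (M i).
Qed.

Lemma ln_diag_weight l : ln (diag_weight m M alpha l) =
  alpha * ln (n + l * s)%:R + ln (n.-1)`!%:R +
  \sum_(i < n | (i < m)%N) ln (l * M i)`!%:R
  - ln (n.-1 + l * s)`!%:R + l%:R * ln (mu R m M).
Proof.
have n0 : (0 < n)%N by apply: leq_trans mn.
have nl0 : 0 < (n + l * s)%:R :> R by rewrite ltr0n addn_gt0 n0.
have mf0 : (0 < mfact (idx l))%N by rewrite prodn_gt0 // => i; exact: fact_gt0.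
have sc0 : 0 < diag_scale m M :> R by exact: diag_scale_gt0.
have D0 : 0 < D_weight alpha (idx l) by exact: D_weight_gt0.
rewrite /diag_weight lnM ?posrE ?exprn_gt0 // -exprM lnXn // ln_powR.
have pw : 0 < (n + l * s)%:R `^ alpha :> R by exact: powR_gt0.
have f1 : 0 < (n.-1)`!%:R :> R by rewrite ltr0n fact_gt0.
have f2 : 0 < (n.-1 + l * s)`!%:R :> R by rewrite ltr0n fact_gt0.
have f3 : 0 < (mfact (idx l))%:R :> R by rewrite ltr0n.
rewrite /D_weight mdeg_idx natrM ln_div ?posrE ?mulr_gt0 //.
rewrite lnM ?posrE ?mulr_gt0 // ln_powR lnM ?posrE //.
have -> : ln ((mfact (idx l))%:R : R) =
    \sum_(i < n | (i < m)%N) ln (l * M i)`!%:R.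
  rewrite /mfact ln_prod_nat => [|i]; last exact: fact_gt0.
  rewrite [RHS]big_mkcond; apply: eq_bigr => i _; rewrite ffunE /diag_exp.
  by case: ifP => // _; rewrite muln0 fact0 ln1.
by rewrite -[_ *+ (l * 2)]mulr_natl natrM; field.
Qed.

(** By Stirling's approximation the terms of order [l ln l] cancel, and those of
    order [l] are compensated by [mu].  There remain multiples of [ln l]: [alpha]
    from the power, [1 / 2] from each of the [m] factorials, and
    [- (n - 1) - 1 / 2] from the factorial in the denominator; their sum is
    [beta]. *)
Lemma ln_diag_weight_beta : exists C : R, forall l,
  `|ln (diag_weight m M alpha l) - beta n m alpha * ln l.+1%:R -
    \sum_(i < n | (i < m)%N) (ln (l * M i)`!%:R - diag_stirling i l)| <= C.
Proof.
have n0 : (0 < n)%N by apply: leq_trans mn.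
have [C HC] := ln_fact_shift n.-1.
exists (C + `|alpha| * ln (n + s)%:R + `|ln (n.-1)`!%:R|) => l.
have /andP[h1 h2] : 0 <= ln ((n + l * s)%:R : R) - ln l.+1%:R <= ln (n + s)%:R.
  apply: (@ln_nat_comparable R (fun l => n + l * s)%N) => [k|k|].
  - exact: leq_add n0 (leq_pmulr k deg_gt0).
  - by rewrite mulnS; nia.
  - by rewrite addn_gt0 n0.
have nE : n%:R = n.-1%:R + 1 :> R by rewrite natr1 prednK.
rewrite ln_diag_weight ln_mu sumrB sum_diag_stirling /beta nE.
set X := _ - _ - _; rewrite (_ : X = - (ln (n.-1 + l * s)`!%:R -
     (l%:R * s%:R * (ln l%:R + ln s%:R - 1) + ln l.+1%:R / 2 +
      n.-1%:R * ln l.+1%:R)) +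
   alpha * (ln (n + l * s)%:R - ln l.+1%:R) + ln (n.-1)`!%:R); last first.
  by rewrite /X; field.
apply: le_trans (ler_normD _ _) _; rewrite lerD2r.
apply: le_trans (ler_normD _ _) _; rewrite normrN; apply: lerD; first exact: HC.
by rewrite normrM ler_wpM2l // ger0_norm.
Qed.

Lemma wt_expR b l : wt b l = expR (b * ln l.+1%:R) :> R.
Proof. by rewrite /wt /powR pnatr_eq0. Qed.

Lemma diag_weight_gt0 l : 0 < diag_weight m M alpha l.
Proof.
have n0 : (0 < n)%N by apply: leq_trans mn.
by rewrite mulr_gt0 ?exprn_gt0 ?D_weight_gt0 ?diag_scale_gt0.
Qed.

(** A vanishing exponent contributes [0! = 1], which is less than the factor
    [(l + 1) ^ (1 / 2)] accounted for in [beta]. *)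
Lemma diag_weight_le : exists2 C : R, 0 < C &
  forall l, diag_weight m M alpha l <= C * wt (beta n m alpha) l.
Proof.
have [C HC] := ln_diag_weight_beta.
have /choice[F HF] : forall i : 'I_n, exists C' : R, forall l,
    ln (l * M i)`!%:R - diag_stirling i l <= C'.
  move=> i; have [Mi|] := posnP (M i).
    exists 0 => l; rewrite /diag_stirling Mi muln0 fact0 ln1 mulr0 mul0r add0r.
    by rewrite oppr_le0 add0r divr_ge0 // ln_ge0 // ler1n.
  move=> Mi; have [C' HC'] := @ln_fact_mul R _ Mi; exists C' => l.
  exact: le_trans (ler_norm _) (HC' l).
exists (expR (C + \sum_(i < n | (i < m)%N) F i)); first exact: expR_gt0.
move=> l; rewrite wt_expR -expRD -[leLHS]lnK ?posrE ?diag_weight_gt0 // ler_expR.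
have := le_trans (ler_norm _) (HC l).
have : \sum_(i < n | (i < m)%N) (ln (l * M i)`!%:R - diag_stirling i l) <=
    \sum_(i < n | (i < m)%N) F i by apply: ler_sum => i _; exact: HF.
by lra.
Qed.

Lemma diag_weight_ge : (forall i : 'I_n, (i < m)%N -> (0 < M i)%N) ->
  exists2 c : R, 0 < c &
    forall l, c * wt (beta n m alpha) l <= diag_weight m M alpha l.
Proof.
move=> M0; have [C HC] := ln_diag_weight_beta.
have /choice[F HF] : forall i : 'I_n, exists C' : R, (i < m)%N -> forall l,
    - C' <= ln (l * M i)`!%:R - diag_stirling i l.
  move=> i; have [im|_] := boolP (i < m)%N; last by exists 0.
  have [C' HC'] := @ln_fact_mul R _ (M0 i im); exists C' => _ l.
  by have := HC' l; rewrite ler_norml => /andP[].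
exists (expR (- C - \sum_(i < n | (i < m)%N) F i)); first exact: expR_gt0.
move=> l; rewrite wt_expR -expRD -[leRHS]lnK ?posrE ?diag_weight_gt0 // ler_expR.
have := HC l; rewrite ler_norml => /andP[+ _].
have : \sum_(i < n | (i < m)%N) (- F i) <=
    \sum_(i < n | (i < m)%N) (ln (l * M i)`!%:R - diag_stirling i l).
  by apply: ler_sum => i im; exact: HF.
by rewrite sumrN; lra.
Qed.

End DiagonalWeight.

(** * From approximation of 1 to cyclicity *)

Section Cyclic.
Context {R : realType} {n : nat}.
Variable alpha : R.
Local Notation C := (cfield R).
Local Notation MI := {ffun 'I_n -> nat}.
Implicit Types (f g h : 'rV[C]_n -> C) (a b P : MI -> C) (k : MI) (z : 'rV[C]_n).

Lemma shift_span_sum f (J : Type) (r : seq J) (c : J -> C) (e : J -> MI) :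
  shift_span f (fun z => \sum_(j <- r) c j * (monomial (e j) z * f z)).
Proof.
elim: r => [|j r [A [d Ad]]].
  exists fset0, (fun=> 0); apply: funext => z; by rewrite !big_nil.
exists (fsetU [fset e j]%fset A), (fun k => (if k == e j then c j else 0) +
   (if k \in A then d k else 0)).
apply: funext => z; rewrite big_cons; have := congr1 (fun F => F z) Ad => /= ->.
under [RHS]eq_bigr do rewrite mulrDl.
rewrite big_split /=; congr (_ + _).
  rewrite (big_fsetD1 (e j)) /=; last by rewrite in_fsetU in_fset1 eqxx.
  rewrite eqxx big_seq_cond big1 ?addr0 // => k.
  by rewrite in_fsetD1 andbT => /andP[/negPf -> _]; rewrite mul0r.
rewrite [RHS](bigID (mem A)) /= [X in _ = _ + X]big1 ?addr0; last first.
  by move=> k /negPf ->; rewrite mul0r.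
under [RHS]eq_bigr => k kA do rewrite kA.
rewrite -[RHS]big_filter; apply: perm_big; apply: uniq_perm.
- exact: fset_uniq.
- by rewrite filter_uniq ?fset_uniq.
- by move=> k; rewrite mem_filter in_fsetU; case: (k \in A); rewrite ?orbT.
Qed.

(** Polynomials are dense, and multiplication by a polynomial is bounded: once [1]
    is approximated by multiples of [f], so is every element of the space. *)
Lemma cyclic_of_approx f a : (0 < n)%N -> expansion_ball f a ->
  (forall e : R, 0 < e -> exists N P,
     energy_le alpha (fun k => mone k - box_conv N P a k) e) ->
  cyclic_fun alpha f.
Proof.
move=> n0 fa approx; apply/seteqP; split => [g []//|g gD]; split => // eps eps0.
have [_ [b gb] g_fin] := gD.
have [B gB] : exists B, energy_le alpha b B.
  have : (D_norm alpha g ^+ 2 < +oo)%E.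
    have Dg0 : (0 <= D_norm alpha g)%E by exact: sqrte_ge0.
    move: g_fin Dg0; case: (D_norm alpha g) => [r| |] // _ _.
    by rewrite -EFin_expe ltry.
  have Dg0 : (0 <= D_norm alpha g ^+ 2)%E by rewrite expe2 mule_ge0 // sqrte_ge0.
  move: Dg0; case E : (D_norm alpha g ^+ 2)%E => [B| |] // _ _.
  by exists B; apply/(D_norm_sqr_le _ _ gb); rewrite E.
pose d := (eps / 2) ^+ 2 / 4.
have d0 : 0 < d by rewrite divr_gt0 // exprn_gt0 // divr_gt0.
have [A0 HA0] := energy_tail gB d0.
have [K K0 HK] := energy_le_msum alpha (enum_fset A0) b n0.
have [N [P HP]] := approx _ (divr_gt0 d0 K0).
pose p z := \sum_(y : {ffun 'I_n -> 'I_N.+1}) P (box y) * monomial (box y) z.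
pose Qp z := \sum_(k <- A0) b k * (monomial k z * (p z * f z)).
exists Qp.
  pose T := (MI * {ffun 'I_n -> 'I_N.+1})%type.
  pose r : seq T := [seq (k, y) | k <- A0, y <- enum {ffun 'I_n -> 'I_N.+1}].
  have := shift_span_sum f r (fun t => b t.1 * P (box t.2))
    (fun t => madd t.1 (box t.2)).
  congr shift_span; apply: funext => z; rewrite /Qp /r big_allpairs.
  apply: eq_bigr => k _; rewrite /p mulr_suml !mulr_sumr big_enum /=.
  by apply: eq_bigr => y _; rewrite monomialD /=; ring.
have pf := expansion_box_mul (N := N) (P := P) fa.
have e1 := @expansion_ball_sum R n _ (enum_fset A0) _ _
  (fun k => expansion_ballZ (c := b k) (expansion_ball_monomial (k0 := k) pf)).
have e2 := @expansion_ball_sum R n _ (enum_fset A0) _ _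
  (fun k => expansion_ballZ (c := b k)
     (expansion_ball_monomial (k0 := k) (@expansion_ball1 R n))).
have e3 := expansion_ballD (expansion_ballD gb (expansion_ballZ (c := -1) e2)) e1.
have EQ : energy_le alpha (fun k => (b k + -1 * \sum_(k0 <- A0) b k0 * mshift k0 mone k)
    + \sum_(k0 <- A0) b k0 * mshift k0 (fun k => mone k - box_conv N P a k) k)
    (2 * (d + d)).
  apply: energy_leD; last by have := HK _ _ HP; rewrite mulrC divfK ?gt_eqF.
  move: HA0; congr energy_le; apply: funext => k.
  have mE k0 : mshift k0 (mone : MI -> C) k = (k0 == k)%:R.
    rewrite /mshift /mone; have [<-|kk] := eqVneq k0 k.
      have -> : mle k0 k0 by apply/forallP => i.
      rewrite (_ : msub k0 k0 = mzero) ?eqxx //.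
      by apply/ffunP => i; rewrite !ffunE subnn.
    case: ifP => // le; case: eqP => // E; case/eqP: kk.
    by rewrite -(msubK le) E; apply/ffunP => i; rewrite !ffunE addn0.
  under eq_bigr do rewrite mE.
  rewrite mulN1r; case: ifPn => kA.
    rewrite (big_fsetD1 k) //= eqxx mulr1 big_seq_cond big1 ?addr0 ?subrr // => i.
    by rewrite in_fsetD1 andbT => /andP[/negPf -> _]; rewrite mulr0.
  rewrite big_seq_cond big1 ?subr0 // => i; rewrite andbT => iA.
  by case: eqP => [ik|_]; [rewrite -ik iA in kA|rewrite mulr0].
have e4 : expansion_ball (fun z => g z - Qp z) (fun k =>
    (b k + -1 * \sum_(k0 <- A0) b k0 * mshift k0 mone k)
    + \sum_(k0 <- A0) b k0 * mshift k0 (fun k => mone k - box_conv N P a k) k).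
  apply: eq_expansion_ball e3 => z _ /=; rewrite mulN1r -addrA; congr (_ + _).
  rewrite -sumrN -big_split -sumrN /=; apply: eq_bigr => k _.
  have -> : \sum_(y : {ffun 'I_n -> 'I_N.+1}) P (box y) * \prod_i z 0 i ^+ y i = p z.
    apply: eq_bigr => y _; congr (_ * _); apply: eq_bigr => i _.
    by rewrite ffunE.
  by ring.
have := (D_norm_sqr_le alpha (2 * (d + d)) e4).2 EQ.
have -> : 2 * (d + d) = (eps / 2) ^+ 2 by rewrite /d; field.
have D0 : (0 <= D_norm alpha (fun z => (g z - Qp z)%R))%E by exact: sqrte_ge0.
move: D0; case: (D_norm _ _) => [r| |] //=.
rewrite -EFinM !lee_fin lte_fin -expr2 => r0 rle.
apply: (@le_lt_trans _ _ (eps / 2)); last by lra.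
by rewrite -(@ler_pXn2r _ 2) ?nnegrE // divr_ge0 // ltW.
Qed.

End Cyclic.

(** * Approximation of 1 by multiples of a diagonal function *)

Section Main.
Context {R : realType}.
Local Notation C := (cfield R).

Lemma phi_unbounded (b X : R) : b <= 1 ->
  exists2 N : nat, (1 <= N)%N & X <= phi b (N%:R + 1).
Proof.
move=> b1; rewrite /phi; have [b1'|_] := boolP (b < 1).
  have g0 : 0 < 1 - b by rewrite subr_gt0.
  have [N HN] := exists_nat_ge (`|X| `^ (1 - b)^-1); exists N.+1 => //.
  apply: le_trans (ler_norm X) _.
  have -> : `|X| = (`|X| `^ (1 - b)^-1) `^ (1 - b).
    by rewrite -powRrM mulVf ?powRr1 // gt_eqF.
  rewrite ge0_ler_powR ?(ltW g0) ?nnegrE ?powR_ge0 ?addr_ge0 //.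
  by apply: le_trans HN _; rewrite natr1 ler_nat leqW.
have [N HN] := exists_nat_ge (expR X); exists N.+1 => //.
rewrite le_max; apply/orP; left; rewrite -[leLHS]expRK ler_ln ?posrE ?expR_gt0 //.
by apply: le_trans HN _; rewrite natr1 ler_nat leqW.
Qed.

Lemma dist_one_ge0 (n : nat) (alpha : R) (f : 'rV[C]_n -> C) N :
  (0 <= dist_one alpha f N)%E.
Proof. by apply: le_ereal_inf_tmp => _ [p _ <-]; exact: sqrte_ge0. Qed.

Section Fixed.
Variables (n m : nat) (M : multi_index n) (alpha : R).
Hypotheses (m_gt0 : (0 < m)%N) (mn : (m <= n)%N).
Hypotheses (deg_gt0 : (0 < diag_deg m M)%N) (b1 : beta n m alpha <= 1).
Variable x : fps R.
Local Notation phiN N := (phi (beta n m alpha) (N%:R + 1)).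

Lemma diag_coefB (y y' : fps R) :
  diag_coef m M (y - y') = fun k => diag_coef m M y k - diag_coef m M y' k.
Proof.
apply: funext => k; rewrite /diag_coef; case: pselect => [H|_].
  by rewrite fpsB mulrBl.
by rewrite subr0.
Qed.

(** The one-variable approximation of degree [k N'] is used with [N'] a fixed
    fraction of [N], so that it becomes a polynomial in the box of size [N]. *)
Lemma diagonal_upper : conv_beyond 1 x ->
  (forall z, modulus z < 1 -> ~ sums_to (at_pt x z) 0) ->
  exists2 K : R, 0 < K & forall N, (1 <= N)%N -> exists P,
    energy_le alpha (fun k => mone k - box_conv N P (diag_coef m M x) k)
      (K * (phiN N)^-1).
Proof.
move=> rx xz; have [B [k HB]] := one_variable_upper (beta n m alpha) rx xz.
have [C1 C10 HC1] := diag_weight_le alpha m_gt0 mn deg_gt0.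
pose d := (k.+1 * diag_deg m M)%N; have d0 : (0 < d)%N by rewrite muln_gt0.
have [Cd Cd0 HCd] := wt_sum_dilate (beta n m alpha) d0.
have [c [c' [c0 _ Hc]]] := wt_sum_phi b1.
have B0 : 0 <= B.
  have [q _ /(_ 0%N)] := HB 0%N.
  by rewrite big_ord0 pmulr_lge0 // invr_gt0 wt_sum_gt0.
exists (C1 * B * (Cd / c) + 1).
  by rewrite ltr_wpDl // !mulr_ge0 ?invr_ge0 // ltW.
move=> N N1; pose N' := (N %/ d)%N; have [q qN Hq] := HB N'.
exists (diag_coef m M q).
have [phi0 Lphi _] := Hc N N1.
have qbox : forall i j, q j != 0 -> (j * diag_exp m M i <= N)%N.
  move=> i j qj; have jN : (j <= k * N')%N.
    by rewrite leqNgt; apply: contra qj => /qN ->.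
  apply: leq_trans (leq_trunc_div N d); rewrite -/N' /d.
  apply: (@leq_trans (k * N' * diag_deg m M)).
    by apply: leq_mul => //; rewrite /diag_deg (bigD1 i) //= leq_addr.
  by rewrite mulnA [(N' * _)%N]mulnC leq_mul2r leq_mul2r leqnSn !orbT.
rewrite (box_conv_diag deg_gt0 x qbox) -(diag_coef1 deg_gt0) -diag_coefB.
apply: energy_le_diag => // l.
apply: (@le_trans _ _ (C1 * (B / wt_sum (beta n m alpha) N'))).
  apply: le_trans (ler_wpM2l (ltW C10) (Hq l)); rewrite mulr_sumr.
  apply: ler_sum => i _; rewrite [leRHS]mulrA; apply: ler_wpM2r => //.
  exact: sqr_ge0.
have LN : c * phiN N <= Cd * wt_sum (beta n m alpha) N'.
  apply: le_trans Lphi _; apply: le_trans (HCd N'.+1).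
  have [e eE] : exists e, (d * N'.+1 = e.+1)%N.
    by exists (d * N'.+1).-1; rewrite prednK // muln_gt0 d0.
  rewrite eE; apply: wt_sum_homo.
  by rewrite -ltnS -eE mulnC ltn_ceil.
have W0 := wt_sum_gt0 (beta n m alpha) N'.
apply: (@le_trans _ _ (C1 * B * (Cd / c) * (phiN N)^-1)); last first.
  by rewrite ler_wpM2r ?invr_ge0 ?(ltW phi0) // lerDl.
have key : (wt_sum (beta n m alpha) N')^-1 <= Cd * (c * phiN N)^-1.
  rewrite -[leLHS]mul1r ler_pdivrMr // mulrAC ler_pdivlMr ?mulr_gt0 //.
  by rewrite mul1r.
rewrite (_ : _ * (Cd / c) * _ = C1 * B * (Cd * (c * phiN N)^-1)); last first.
  by rewrite invfM; ring.
by rewrite mulrA ler_wpM2l // mulr_ge0 // ltW.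
Qed.

(** Keeping only the diagonal coefficients does not increase the norm, and reduces
    an arbitrary polynomial in the box to a one-variable polynomial. *)
Lemma diagonal_lower (z : C) : conv_beyond 1 x -> x 0%N != 0 ->
  modulus z = 1 -> sums_to (at_pt x z) 0 ->
  (forall i : 'I_n, (i < m)%N -> (0 < M i)%N) ->
  exists2 c : R, 0 < c & forall N P B, (1 <= N)%N ->
    energy_le alpha (fun k => mone k - box_conv N P (diag_coef m M x) k) B ->
    c * (phiN N)^-1 <= B.
Proof.
move=> rx x0 z1 xz M0.
have [c c0 Hc] := one_variable_lower (beta n m alpha) rx x0 z1 xz.
have [c1 c10 Hc1] := diag_weight_ge alpha m_gt0 mn deg_gt0 M0.
have [c2 [C2 [_ C20 HC2]]] := wt_sum_phi b1.
exists (c1 * c / C2); first by rewrite divr_gt0 // mulr_gt0.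
move=> N P B N1 EB; have [phi0 _ Lphi] := HC2 N N1.
have aE l : mone (diag_index m M l) - box_conv N P (diag_coef m M x) (diag_index m M l)
    = (1 - diag_restrict m M N P * x) l * ((diag_scale m M)%:C)%C ^+ l.
  by rewrite box_conv_idx // -(diag_coef1 deg_gt0) diag_coef_idx // fpsB mulrBl.
have E := energy_le_diag_lower deg_gt0 aE EB.
have key : c / wt_sum (beta n m alpha) N <= B / c1.
  apply: Hc N1 _ _; first exact: (@diag_restrict_deg R n m M deg_gt0 N P).
  move=> l.
  rewrite ler_pdivlMr // mulrC mulr_sumr; apply: le_trans (E l).
  apply: ler_sum => i _; rewrite [leLHS]mulrA; apply: ler_wpM2r => //.
  exact: sqr_ge0.
rewrite ler_pdivlMr // in key; apply: le_trans key.
have W0 := wt_sum_gt0 (beta n m alpha) N.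
have -> : c1 * c / C2 * (phiN N)^-1 = c * c1 * (C2 * phiN N)^-1.
  by rewrite invfM; ring.
have -> : c / wt_sum (beta n m alpha) N * c1 =
    c * c1 * (wt_sum (beta n m alpha) N)^-1 by ring.
rewrite ler_wpM2l ?mulr_ge0 ?(ltW c10) ?(ltW c0) //.
by rewrite lef_pV2 ?posrE ?mulr_gt0.
Qed.

End Fixed.
End Main.

(** * The one-variable function on the unit disc *)

Section Continuation.
Context {R : realType} {n : nat}.
Variables (m : nat) (M : multi_index n).
Local Notation C := (cfield R).
Local Notation r := (diag_radius R m M).

Lemma diag_radius_gt0 : 0 < r.
Proof. by rewrite powR_gt0 // mu_gt0. Qed.

(** If the distinguished exponents all vanish then [mu = 1] and the diagonal map
    is the constant [1], on the boundary of the disc. *)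
Lemma diag_deg_gt0 (z : 'rV[C]_n) :
  disc r (diag_map m M z) -> (0 < diag_deg m M)%N.
Proof.
rewrite lt0n; apply: contraPneq => deg0.
have M0 (i : 'I_n) : (i < m)%N -> M i = 0%N.
  move=> im; apply/eqP; rewrite -leqn0 -deg0 /diag_deg (bigD1 i) //=.
  by rewrite {1}/diag_exp im leq_addr.
have mu1 : mu R m M = 1.
  rewrite /mu diag_degE deg0 expn0 big1 ?divr1 // => i /M0 ->.
  by rewrite expn0.
rewrite /disc /diag_map /diag_radius /= mu1 !powR1 big1; last first.
  by move=> i /M0 ->.
by rewrite mulr1 modulus_real normr1 ltxx.
Qed.

Lemma diag_mapE (z : 'rV[C]_n) : diag_map m M z = (r%:C)%C * diag_arg m M z.
Proof.
rewrite /diag_map /diag_arg mulrA -rmorphM /=; congr ((_%:C)%C * _).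
rewrite /diag_radius /diag_scale -powRD; last first.
  by apply/implyP => _; rewrite gt_eqF // mu_gt0.
by congr (_ `^ _); field.
Qed.

(** Dilation to the unit disc: if [h] has coefficients [a] then these are the
    coefficients of [w |-> h (r w)]. *)
Definition rescale (a : nat -> C) : fps R := fun l => a l * (r%:C)%C ^+ l.

Lemma expansion_disc_sums (rho : R) h a w : expansion_disc rho h a ->
  disc rho ((r%:C)%C * w) -> sums_to (at_pt (rescale a) w) (h ((r%:C)%C * w)).
Proof.
move=> ha wD; have /cvg_sums_to := ha _ wD.
by apply: eq_sums_to => l; rewrite /at_pt /rescale exprMn mulrA.
Qed.

Lemma sums_to_bounded (v : nat -> C) s : sums_to v s ->
  exists2 K : R, 0 <= K & forall l, modulus (v l) <= K.
Proof.
move=> /(_ 1 ltr01)[N HN].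
exists (\sum_(l < N) modulus (v l) + 2).
  by rewrite addr_ge0 // sumr_ge0 // => l _; exact: modulus_ge0.
move=> l; have [lN|Nl] := ltnP l N.
  rewrite (bigD1 (Ordinal lN)) //= -addrA lerDl addr_ge0 // sumr_ge0 // => i _.
  exact: modulus_ge0.
have h1 := HN l Nl; have h2 := HN l.+1 (leqW Nl).
rewrite big_ord_recr /= in h2.
have -> : v l = (\sum_(i < l) v i + v l - s) - (\sum_(i < l) v i - s) by ring.
apply: le_trans (ler_modulusB _ _) _.
have : 0 <= \sum_(i < N) modulus (v i).
  by rewrite sumr_ge0 // => i _; exact: modulus_ge0.
by move: h1 h2; lra.
Qed.

(** The terms are bounded at a point strictly between the two circles. *)
Lemma rescale_conv_beyond (rho : R) h a : r < rho -> expansion_disc rho h a ->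
  conv_beyond 1 (rescale a).
Proof.
move=> r_rho ha; have r0 := diag_radius_gt0.
have [r1 r2] := midf_lt r_rho; set t := (r + rho) / 2 in r1 r2.
have t0 : 0 < t by apply: lt_trans r1.
have tD : disc rho ((t%:C)%C : C) by rewrite /disc /= modulus_real gtr0_norm.
have /cvg_sums_to/sums_to_bounded[K K0 HK] := ha _ tD.
exists (r / t); split; first by rewrite divr_gt0.
  by rewrite mulr1 ltr_pdivrMr // mul1r.
exists K => // l; have := HK l.
rewrite !modulusM !modulusX !modulus_real !gtr0_norm // => HKl.
have -> : (r / t) ^+ l = r ^+ l / t ^+ l by rewrite expr_div_n.
rewrite mulrA ler_pdivlMr ?exprn_gt0 // mulrAC ler_wpM2r //.
by rewrite exprn_ge0 // ltW.
Qed.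

End Continuation.

(** * The distance to the multiples of a function *)

Section Distance.
Context {R : realType} {n : nat}.
Local Notation C := (cfield R).
Implicit Types (f : 'rV[C]_n -> C).

Lemma dist_one_upper (alpha : R) f a N P B : expansion_ball f a ->
  energy_le alpha (fun k => mone k - box_conv N P a k) B ->
  (dist_one alpha f N ^+ 2 <= B%:E)%E.
Proof.
move=> fa EB; have pf := expansion_box_mul (N := N) (P := P) fa.
apply: le_trans ((D_norm_sqr_le alpha B pf).2 EB).
rewrite lee_sqr ?dist_one_ge0 //; last exact: sqrte_ge0.
apply: ereal_inf_lbound.
by eexists; [exists (fun y => P (box y))|].
Qed.

Lemma dist_one_lower (alpha : R) f a N c : 0 <= c -> expansion_ball f a ->
  (forall P B, energy_le alpha (fun k => mone k - box_conv N P a k) B -> c <= B) ->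
  (c%:E <= dist_one alpha f N ^+ 2)%E.
Proof.
move=> c0 fa H; rewrite -(@sqr_sqrte R c%:E) ?lee_fin //.
rewrite lee_sqr ?dist_one_ge0 ?sqrte_ge0 //.
apply: le_ereal_inf_tmp => _ [p [d ->] <-].
(* The coefficients of a box polynomial are indexed by the box; they are
   extended by [0] to all multi-indices. *)
pose P (k : {ffun 'I_n -> nat}) : C :=
  if [pick y | box y == k] is Some y then d y else 0.
have PE y : P (box y) = d y.
  rewrite /P; case: pickP => [y' /eqP/box_inj -> //|/(_ y)].
  by rewrite eqxx.
have pf := expansion_box_mul (N := N) (P := P) fa.
rewrite -lee_sqr; [|exact: sqrte_ge0..]; rewrite sqr_sqrte ?lee_fin //.
set F := fun z => _; have FE : F = fun z => 1 - (\sum_(y : {ffun 'I_n -> 'I_N.+1})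
    P (box y) * \prod_i z 0 i ^+ y i) * f z.
  apply: funext => z; rewrite /F; congr (1 - _ * _); apply: eq_bigr => y _.
  by rewrite PE.
rewrite FE; have := (sqrte_ge0 _ : (0 <= D_norm alpha (fun z => (1 -
    (\sum_(y : {ffun 'I_n -> 'I_N.+1}) P (box y) * \prod_i z 0 i ^+ y i) * f z)%R))%E).
move=> D0; have {D0} := mule_ge0 D0 D0; rewrite -expe2.
case E : (_ ^+ 2)%E => [B| |] //= _; last by rewrite leey.
by rewrite lee_fin; apply: (H P); apply/(D_norm_sqr_le alpha B pf); rewrite E.
Qed.

End Distance.

(** * Cyclicity and rate of approximation *)

Theorem theorem10 (R : realType) (n m : nat) (hm0 : (0 < m)%N)
    (hmn : (m <= n)%N) (M : multi_index n) (alpha : R)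
    (hbeta : beta n m alpha <= 1)
    (f : 'rV[cfield R]_n -> cfield R) (hf : J_space m M alpha f)
    (g : cfield R -> cfield R) (hg : one_variable_fun m M alpha f g)
    (hzero_free : forall z, disc (diag_radius R m M) z -> g z <> 0)
    (hboundary : exists2 h, continuation (diag_radius R m M) g h &
       exists2 z, modulus z = diag_radius R m M & h z = 0) :
  (alpha <= (2 * n%:R - m%:R + 1) / 2 -> cyclic_fun alpha f) /\
  (exists c C : R, [/\ 0 < c, 0 < C & forall N : nat, (1 <= N)%N ->
     ((forall i : 'I_n, (i < m)%N -> (0 < M i)%N) ->
      ((c * (phi (beta n m alpha) (N%:R + 1))^-1)%:E
         <= dist_one alpha f N ^+ 2)%E) /\
     (dist_one alpha f N ^+ 2
        <= (C * (phi (beta n m alpha) (N%:R + 1))^-1)%:E)%E]).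
Proof.
have n0 : (0 < n)%N by apply: leq_trans hmn.
have r0 := @diag_radius_gt0 R n m M; set r := diag_radius R m M in r0.
have [h [rho r_rho [_ [a ha] hgE]] [zeta zeta_r hzeta]] := hboundary.
have [_ fg] := hg.
have ball0 : unit_ball (0 : 'rV[cfield R]_n).
  rewrite /unit_ball /= big1 // => i _.
  by rewrite mxE modulus0 expr0n.
have deg_gt0 := diag_deg_gt0 (fg _ ball0).1.
pose x : fps R := rescale m M a.
have rx : conv_beyond 1 x by exact: rescale_conv_beyond r_rho ha.
pose rc : cfield R := (r%:C)%C.
have rcE : modulus rc = r by rewrite modulus_real gtr0_norm.
have rc0 : rc != 0 by rewrite -modulus_gt0 rcE.
have xsum w : modulus w <= 1 -> sums_to (at_pt x w) (h (rc * w)).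
  move=> w1; apply: expansion_disc_sums ha _; rewrite /disc /= modulusM.
  by rewrite rcE (le_lt_trans _ r_rho) // ler_piMr // ltW.
have in_disc w : modulus w < 1 -> disc r (rc * w).
  by move=> w1; rewrite /disc /= modulusM rcE gtr_pMr.
have xz w : modulus w < 1 -> ~ sums_to (at_pt x w) 0.
  move=> w1 /(sums_to_unique (xsum w (ltW w1))); rewrite hgE; last exact: in_disc.
  by apply: hzero_free; exact: in_disc.
have arg1 (z : 'rV[cfield R]_n) : unit_ball z -> modulus (diag_arg m M z) < 1.
  move=> zB; have [] := fg z zB.
  rewrite diag_mapE /disc /= modulusM rcE => dz _.
  by rewrite -(ltr_pM2l r0) mulr1.
have fx : expansion_ball f (diag_coef m M x).
  have [y [y0 y1 xy]] := rx; rewrite mulr1 in y1.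
  apply: (expansion_diag deg_gt0 (ltW y0) xy) => z zB.
    apply: le_lt_trans y1; rewrite ler_piMr ?(ltW y0) //.
    exact: ltW (arg1 z zB).
  have [zD ->] := fg z zB; rewrite -hgE //.
  by rewrite diag_mapE; apply: xsum; exact: ltW (arg1 z zB).
have [K K0 HK] := diagonal_upper hm0 hmn deg_gt0 hbeta rx xz.
split.
  move=> _; apply: (cyclic_of_approx n0 fx) => e e0.
  have [N N1 phiN] := phi_unbounded (K / e) hbeta.
  have [P HP] := HK N N1; exists N, P => A; apply: le_trans (HP A) _.
  have phi0 : 0 < phi (beta n m alpha) (N%:R + 1).
    by apply: lt_le_trans phiN; rewrite divr_gt0.
  by rewrite ler_pdivrMr // mulrC -ler_pdivrMr.
have upper N : (1 <= N)%N -> (dist_one alpha f N ^+ 2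
        <= (K * (phi (beta n m alpha) (N%:R + 1))^-1)%:E)%E.
  by move=> /HK[P HP]; exact: dist_one_upper fx HP.
have [M0|M0] := pselect (forall i : 'I_n, (i < m)%N -> (0 < M i)%N); last first.
  (* Some distinguished exponent vanishes: the lower bound is then vacuous. *)
  by exists 1, K; split => // N N1; split => //; exact: upper.
pose w := zeta / rc.
have w1 : modulus w = 1 by rewrite modulusM modulusV rcE zeta_r mulfV // gt_eqF.
have xw : sums_to (at_pt x w) 0.
  have := xsum w; rewrite w1 lexx => /(_ isT).
  by rewrite /w mulrCA mulfV // mulr1 hzeta.
have x0 : x 0%N != 0.
  apply/eqP => x0; apply: (xz 0); first by rewrite modulus0.
  by have := sums_to_0 x; rewrite x0.
have [c c0 Hc] := diagonal_lower hm0 hmn deg_gt0 hbeta rx x0 w1 xw M0.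
have [c1 [c2 [_ _ Hphi]]] := wt_sum_phi hbeta.
exists c, K; split => // N N1; split; last exact: upper.
move=> _; apply: (dist_one_lower _ fx) => [|P B]; last exact: Hc.
have [phi0 _ _] := Hphi N N1.
by rewrite mulr_ge0 ?invr_ge0 ?ltW.
Qed.
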